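(* Let $\rho,\gamma,L\ge 0$ and $\delta,\sigma>0$. Let $\varphi:\mathbb{R}^d\to(-\infty,+\infty]$ be a proper, lower semicontinuous, $(\rho,\gamma)$-semiconvex function such that $|\varphi(x)-\varphi(y)|\le L+L|x-y|$ for all $x,y\in\mathrm{Dom}(\varphi)$, and such that $\mathrm{Dom}(\varphi)$ satisfies the $(\gamma,\delta,\sigma)$-shifted uniform interior ball condition. Let $x_{0n},x_0\in\overline{\mathrm{Dom}(\varphi)}$ and $m_n,m\in C(\mathbb{R}_+;\mathbb{R}^d)$ with $m_n(0)=m(0)=0$ ($n\in\mathbb{N}^*$) be such that (i) $(x_n,k_n)=\mathcal{SP}(\partial^-\varphi;x_{0n},m_n)$ for all $n$; (ii) $x_{0n}\to x_0$; (iii) $m_n\to m$ in $C([0,T];\mathbb{R}^d)$ for all $T\ge0$. Then $\sup_{n\in\mathbb{N}^*}\mathrm{Var}_T(k_n)<\infty$ for all $T\ge0$, and there exist $x,k\in C(\mathbb{R}_+;\mathbb{R}^d)$ such that, for any $T\ge0$, (a) $\|x_n-x\|_T+\|k_n-k\|_T\to0$ as $n\to\infty$; (b) $(x,k)=\mathcal{SP}(\partial^-\varphi;x_0,m)$.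
   Context: Here $|\cdot|$ and $\langle\cdot,\cdot\rangle$ are the Euclidean norm and inner product, $\overline B(x,r)$ is the closed ball, $\mathrm{Bd}(E)$ is the boundary of $E$, and $\|z\|_T=\sup_{r\in[0,T]}|z(r)|$. For $\varphi:\mathbb{R}^d\to(-\infty,+\infty]$, $\mathrm{Dom}(\varphi)=\{v:\varphi(v)<+\infty\}$; $\varphi$ is proper if $\mathrm{Dom}(\varphi)$ is nonempty and has no isolated points. The Fréchet subdifferential is $\partial^-\varphi(x)=\emptyset$ if $x\notin\mathrm{Dom}(\varphi)$, and for $x\in\mathrm{Dom}(\varphi)$ $$\partial^-\varphi(x)=\Big\{\hat x\in\mathbb{R}^d:\liminf_{y\to x}\frac{\varphi(y)-\varphi(x)-\langle\hat x,y-x\rangle}{|y-x|}\ge 0\Big\}.$$ A nonempty closed set $E\subset\mathbb{R}^d$ is $\gamma$-semiconvex ($\gamma\ge0$) if for every $x\in\mathrm{Bd}(E)$ there is $\hat x\in\mathbb{R}^d\setminus\{0\}$ with $\langle\hat x,y-x\rangle\le\gamma|\hat x||y-x|^2$ for all $y\in E$. The function $\varphi$ is $(\rho,\gamma)$-semiconvex ($\rho,\gamma\ge0$) if: $\overline{\mathrm{Dom}(\varphi)}$ is $\gamma$-semiconvex; $\partial^-\varphi(x)\ne\emptyset$ for some $x$; and for all $x$, all $\hat x\in\partial^-\varphi(x)$ and all $y\in\mathbb{R}^d$, $\langle\hat x,y-x\rangle+\varphi(x)\le\varphi(y)+(\rho+\gamma|\hat x|)|y-x|^2$. A set $E$ satisfies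 the $(\gamma,\delta,\sigma)$-shifted uniform interior ball condition if for every $y\in E$ there exist $\lambda_y\in(0,1]$ and $v_y\in\mathbb{R}^d$, $|v_y|\le1$, with $\lambda_y-(|v_y|+\lambda_y)^2\gamma\ge\sigma$ and $\overline B(x+v_y,\lambda_y)\subset E$ for all $x\in E\cap\overline B(y,\delta)$. $\mathrm{Var}_t(k)$ denotes the total variation of $k$ on $[0,t]$; $BV_{loc}(\mathbb{R}_+;\mathbb{R}^d)$ is the set of functions with $\mathrm{Var}_t(k)<\infty$ for all $t$. A pair $(x,k)$ of continuous functions $\mathbb{R}_+\to\mathbb{R}^d$ is a solution of the generalized Skorohod problem, written $(x,k)=\mathcal{SP}(\partial^-\varphi;x_0,m)$, if: (j) $x(t)\in\overline{\mathrm{Dom}(\varphi)}$ for all $t\ge0$ and $\varphi(x(\cdot))\in L^1_{loc}(\mathbb{R}_+)$; (jj) $k\in BV_{loc}(\mathbb{R}_+;\mathbb{R}^d)$, $k(0)=0$; (jjj) $x(t)+k(t)=x_0+m(t)$ for all $t\ge0$; (jv) for all $0\le s\le t$ and all continuous $y:\mathbb{R}_+\to\mathbb{R}^d$, $$\int_s^t\langle y(r)-x(r),dk(r)\rangle+\int_s^t\varphi(x(r))dr\le\int_s^t\varphi(y(r))dr+\int_s^t|y(r)-x(r)|^2\big(\rho\,dr+\gamma\,d\mathrm{Var}_r(k)\big).$$ *)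

(* Defs.v *)
From HB Require Import structures.
From mathcomp Require Import all_boot all_order all_algebra.
From mathcomp Require Import all_classical all_reals all_analysis.

Set Implicit Arguments.
Unset Strict Implicit.
Unset Printing Implicit Defensive.

Import Order.TTheory GRing.Theory Num.Theory.
Import numFieldNormedType.Exports.

Local Open Scope classical_set_scope.
Local Open Scope ring_scope.

(* The library norm on 'rV[R]_d is the sup norm. It induces the Euclidean
   topology, so continuity, closure, interior and neighbourhoods below are the
   library's; every quantity that depends on the norm uses [enorm]. *)
Definition dot (R : realType) (d : nat) (u v : 'rV[R]_d) : R :=
  \sum_(i < d) u 0 i * v 0 i.

Definition enorm (R : realType) (d : nat) (u : 'rV[R]_d) : R :=
  Num.sqrt (dot u u).

Definition ecball (R : realType) (d : nat) (x : 'rV[R]_d) (r : R) :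
    set 'rV[R]_d :=
  [set y | enorm (y - x) <= r].

Definition Bd (T : topologicalType) (E : set T) : set T :=
  closure E `\` interior E.

Definition Dom (R : realType) (d : nat) (phi : 'rV[R]_d -> \bar R) :
    set 'rV[R]_d :=
  [set v | (phi v < +oo)%E].

Definition proper_fun (R : realType) (d : nat) (phi : 'rV[R]_d -> \bar R) :
    Prop :=
  Dom phi !=set0 /\ isolated (Dom phi) = set0.

(* The lower limit is taken along the punctured neighbourhoods of x, where the
   quotient is defined. *)
Definition frechet_subdiff (R : realType) (d : nat)
    (phi : 'rV[R]_d -> \bar R) (x : 'rV[R]_d) : set 'rV[R]_d :=
  [set xh | Dom phi x /\
    (0 <= limf_einf (fun y => (phi y - phi x - (dot xh (y - x))%:E)
                              * ((enorm (y - x))^-1)%:E) x^')%E].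

Definition semiconvex_set (R : realType) (d : nat) (gamma : R)
    (E : set 'rV[R]_d) : Prop :=
  [/\ E !=set0, closed E &
      forall x, Bd E x -> exists2 xh : 'rV[R]_d, xh != 0 &
        forall y, E y ->
          dot xh (y - x) <= gamma * enorm xh * enorm (y - x) ^+ 2].

Definition semiconvex_fun (R : realType) (d : nat) (rho gamma : R)
    (phi : 'rV[R]_d -> \bar R) : Prop :=
  [/\ semiconvex_set gamma (closure (Dom phi)),
      exists x, frechet_subdiff phi x !=set0 &
      forall x xh y, frechet_subdiff phi x xh ->
        ((dot xh (y - x))%:E + phi x <=
         phi y + ((rho + gamma * enorm xh) * enorm (y - x) ^+ 2)%:E)%E].

Definition shifted_uniform_interior_ball (R : realType) (d : nat)
    (gamma delta sigma : R) (E : set 'rV[R]_d) : Prop :=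
  forall y, E y -> exists (lam : R) (v : 'rV[R]_d),
    [/\ 0 < lam <= 1, enorm v <= 1,
        sigma <= lam - (enorm v + lam) ^+ 2 * gamma &
        forall x, E x -> ecball y delta x -> ecball (x + v) lam `<=` E].

(* Functions on [0, +oo[ are represented by functions on R whose values at
   negative times are irrelevant. *)
Definition continuous_Rplus (R : realType) (d : nat) (z : R -> 'rV[R]_d) :
    Prop :=
  {within `[0, +oo[, continuous z}.

Definition supnorm (R : realType) (d : nat) (T : R) (z : R -> 'rV[R]_d) :
    \bar R :=
  ereal_sup [set (enorm (z r))%:E | r in `[0, T]].

(* [total_variation] with the Euclidean norm in place of the absolute value. *)
Definition Var (R : realType) (d : nat) (k : R -> 'rV[R]_d) (t : R) : \bar R :=
  ereal_sup [set (let F := k \o nth t (0 :: s) in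
                  \sum_(0 <= i < size s) enorm (F i.+1 - F i))%:E
            | s in itv_partition 0 t].

Definition BV_loc (R : realType) (d : nat) (k : R -> 'rV[R]_d) : Prop :=
  forall t, 0 <= t -> (Var k t < +oo)%E.

Definition cumulative_of (R : realType) (F : R -> R)
    (ndF : {homo F : x y / x <= y}) (rcF : right_continuous F) :
    cumulative R R :=
  HB.pack F (isCumulative.Build R _ R F ndF rcF).

(* The Lebesgue-Stieltjes measure dF on [0, +oo[: F is frozen at F 0 on
   negative times, so that they carry no mass. The zero measure is a junk
   value, used only when F is not nondecreasing and right-continuous. *)
Definition freeze (R : realType) (F : R -> R) : R -> R :=
  fun r => F (Num.max 0 r).

Definition stieltjes (R : realType) (F : R -> R) :
    {measure set (measurableTypeR R) -> \bar R} :=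
  match pselect ({homo freeze F : x y / x <= y} /\
                 right_continuous (freeze F)) with
  | left h => lebesgue_stieltjes_measure (cumulative_of h.1 h.2)
  | right _ => mzero
  end.

Definition dVar (R : realType) (d : nat) (k : R -> 'rV[R]_d) :
    {measure set (measurableTypeR R) -> \bar R} :=
  stieltjes (fun r => fine (Var k r)).

(* The integral of g dh for a scalar h of locally bounded variation, through
   the Jordan decomposition h = pos_tv 0 h - neg_tv 0 h. *)
Definition BV_integral (R : realType) (s t : R) (g h : R -> R) : R :=
  \int[stieltjes (fun r => fine (pos_tv 0 h r))]_(r in `[s, t]) g r -
  \int[stieltjes (fun r => fine (neg_tv 0 h r))]_(r in `[s, t]) g r.

Definition dot_integral (R : realType) (d : nat) (s t : R)
    (g k : R -> 'rV[R]_d) : R :=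
  \sum_(i < d) BV_integral s t (fun r => g r 0 i) (fun r => k r 0 i).

Definition skorohod_ineq (R : realType) (d : nat) (rho gamma : R)
    (phi : 'rV[R]_d -> \bar R) (x k y : R -> 'rV[R]_d) (s t : R) : Prop :=
  ((dot_integral s t (fun r => y r - x r) k)%:E
   + \int[lebesgue_measure]_(r in `[s, t]) phi (x r)
   <= \int[lebesgue_measure]_(r in `[s, t]) phi (y r)
   + (rho%:E * \int[lebesgue_measure]_(r in `[s, t])
                  (enorm (y r - x r) ^+ 2)%:E
      + gamma%:E * \int[dVar k]_(r in `[s, t])
                  (enorm (y r - x r) ^+ 2)%:E))%E.

Record skorohod_solution (R : realType) (d : nat) (rho gamma : R)
    (phi : 'rV[R]_d -> \bar R) (x0 : 'rV[R]_d) (m x k : R -> 'rV[R]_d) :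
    Prop := SkorohodSolution {
  sp_continuous_x : continuous_Rplus x ;
  sp_continuous_k : continuous_Rplus k ;
  sp_domain : forall t : R, 0 <= t -> closure (Dom phi) (x t) ;
  sp_integrable : forall T : R, 0 <= T ->
    lebesgue_measure.-integrable `[0, T] (phi \o x) ;
  sp_BV : BV_loc k ;
  sp_k0 : k 0 = 0 ;
  sp_equation : forall t : R, 0 <= t -> x t + k t = x0 + m t ;
  sp_ineq : forall s t : R, 0 <= s -> s <= t ->
    forall y, continuous_Rplus y -> skorohod_ineq rho gamma phi x k y s t
}.

(* Main.v *)
Require Import Defs.
From mathcomp Require Import all_boot all_order all_algebra.
From mathcomp Require Import all_classical all_reals all_analysis.
From mathcomp Require Import measurable_realfun ring lra.

Set Implicit Arguments.
Unset Strict Implicit.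
Unset Printing Implicit Defensive.

Import Order.TTheory GRing.Theory Num.Theory.
Import numFieldNormedType.Exports.

Local Open Scope classical_set_scope.
Local Open Scope ring_scope.

(** The proof has three stages.

   A priori bounds. The variational inequality of a solution [(x, k)] may be
   tested against any continuous path, and two families of tests give
   everything. As long as [x] stays within [delta] of its starting point, the
   shifted interior ball condition makes [x + v + lam *: u] admissible for
   every unit vector [u]; taking for [u] the direction of the increment of [k]
   on each interval of a partition bounds the variation of [k] on [[s, t]] by a
   multiple of [enorm (k t - k s) + (t - s)] ([variation_estimate]). Testing
   against the constant [x s] bounds [enorm (k t - k s) ^+ 2] by the
   oscillation of [m], by [t - s] and by a term that is cubic in the
   oscillation of [x] ([oscillation_estimate]). For small oscillations a cube
   is negligible against a square, so the modulus of continuity of [x], and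
   with it those of [k] and of its variation, depends on that of [m] only
   ([equicontinuity]). Along the sequence this gives equicontinuity and a
   uniform bound of the variations.

   Convergence. Testing two solutions against each other bounds the growth of
   [enorm (k - k') ^+ 2] by the distance of the data and by its own supremum
   times the time and the two variations ([comparison]). On intervals of a
   common length, short enough for time and variations to be small, the
   supremum is absorbed ([stability]), and finitely many such intervals cover
   [[0, T]]: the sequence is Cauchy for the uniform norm ([solutions_cauchy]),
   with no subsequence involved.

   The variational inequality of the limit. The variations of the [k_n] need
   not converge to that of [k], so the term [gamma] does not pass to the limit.
   But [variation_estimate] bounds the variation of [k_n] on a short interval
   by its increment, which does converge; hence the limit satisfies the
   inequality, for short intervals and constant tests, with larger constants in
   place of [rho] and [gamma] ([limit_local]). The sharp constants come back
   from the semiconvexity of [phi]: for [h = t - s] and [q = k t - k s],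
   minimising [h * phi w - dot q (w - x) + K * enorm (w - x) ^+ 2] over [w]
   gives a point close to [x] at which nearly [q / h] is a Frechet subgradient,
   and the semiconvexity inequality at that point is the inequality with [rho *
   h + gamma * enorm q] ([prox_improve]). As [enorm q] is at most the variation
   of [k], summing over fine partitions concludes ([limit_ineq_in_Dom]).

   All integrals are handled through partitions: an interval function that is
   additive and, on short intervals, negligible against the increments of a
   fixed function is nonpositive ([additive_le0]). The Stieltjes integrals then
   enter only through their additivity and their size on short intervals. *)

(** * The Euclidean norm *)
Section Euclid.
Context {R : realType} {d : nat}.
Implicit Types (u v w : 'rV[R]_d) (a b : R).

Lemma dotC u v : dot u v = dot v u.
Proof. by apply: eq_bigr => i _; rewrite mulrC. Qed.

Lemma dotDl u v w : dot (u + v) w = dot u w + dot v w.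
Proof. by rewrite -big_split; apply: eq_bigr => i _; rewrite mxE mulrDl. Qed.

Lemma dotZl a u v : dot (a *: u) v = a * dot u v.
Proof. by rewrite mulr_sumr; apply: eq_bigr => i _; rewrite mxE mulrA. Qed.

Lemma dotNl u v : dot (- u) v = - dot u v.
Proof. by rewrite -scaleN1r dotZl mulN1r. Qed.

Lemma dotBl u v w : dot (u - v) w = dot u w - dot v w.
Proof. by rewrite dotDl dotNl. Qed.

Lemma dotDr u v w : dot w (u + v) = dot w u + dot w v.
Proof. by rewrite !(dotC w) dotDl. Qed.

Lemma dotNr u v : dot u (- v) = - dot u v.
Proof. by rewrite !(dotC u) dotNl. Qed.

Lemma dotBr u v w : dot w (u - v) = dot w u - dot w v.
Proof. by rewrite !(dotC w) dotBl. Qed.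

Lemma dotZr a u v : dot u (a *: v) = a * dot u v.
Proof. by rewrite !(dotC u) dotZl. Qed.

Lemma dot0l u : dot 0 u = 0.
Proof. by rewrite -(scale0r 0) dotZl mul0r. Qed.

Lemma dot0r u : dot u 0 = 0.
Proof. by rewrite dotC dot0l. Qed.

Lemma dot_ge0 u : 0 <= dot u u.
Proof. by apply: sumr_ge0 => i _; rewrite -expr2 sqr_ge0. Qed.

Lemma enorm_ge0 u : 0 <= enorm u.
Proof. exact: sqrtr_ge0. Qed.

Lemma enorm_sqr u : enorm u ^+ 2 = dot u u.
Proof. by rewrite sqr_sqrtr ?dot_ge0. Qed.

Lemma enorm0 : enorm (0 : 'rV[R]_d) = 0.
Proof. by rewrite /enorm dot0l sqrtr0. Qed.

Lemma enormN u : enorm (- u) = enorm u.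
Proof. by rewrite /enorm dotNl dotNr opprK. Qed.

Lemma enormBC u v : enorm (u - v) = enorm (v - u).
Proof. by rewrite -enormN opprB. Qed.

Lemma enormZ a u : enorm (a *: u) = `|a| * enorm u.
Proof.
by rewrite /enorm dotZl dotZr mulrA -expr2 sqrtrM ?sqr_ge0// sqrtr_sqr.
Qed.

Lemma coord_le_enorm u i : `|u 0 i| <= enorm u.
Proof.
rewrite -sqrtr_sqr ler_wsqrtr// /dot (bigD1 i)//= -expr2 lerDl.
by apply: sumr_ge0 => j _; rewrite -expr2 sqr_ge0.
Qed.

Lemma enorm_eq0 u : enorm u = 0 -> u = 0.
Proof.
move=> u0; apply/matrixP => i j; rewrite ord1 mxE; apply/eqP.
by rewrite -normr_le0 -u0 coord_le_enorm.
Qed.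

Lemma dot_le_enorm u v : dot u v <= enorm u * enorm v.
Proof.
have [u0|u0] := ltP 0 (enorm u); last first.
  rewrite (@enorm_eq0 u) ?enorm0 ?dot0l ?mul0r//.
  by apply/le_anti; rewrite u0 enorm_ge0.
have [v0|v0] := ltP 0 (enorm v); last first.
  rewrite (@enorm_eq0 v) ?enorm0 ?dot0r ?mulr0//.
  by apply/le_anti; rewrite v0 enorm_ge0.
have := dot_ge0 (enorm v *: u - enorm u *: v).
rewrite dotBl !dotBr !dotZl !dotZr (dotC v u) -!enorm_sqr => H.
have : 0 <= (enorm u * enorm v) * (enorm u * enorm v - dot u v) by nra.
by rewrite pmulr_rge0 ?mulr_gt0// subr_ge0.
Qed.

Lemma ler_dot u v : `|dot u v| <= enorm u * enorm v.
Proof.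
rewrite ler_norml dot_le_enorm andbT lerNl -dotNl.
by rewrite (le_trans (dot_le_enorm _ _))// enormN.
Qed.

Lemma enorm_triangle u v : enorm (u + v) <= enorm u + enorm v.
Proof.
rewrite -(@ler_pXn2r _ 2)// ?nnegrE ?addr_ge0 ?enorm_ge0//.
rewrite enorm_sqr dotDl !dotDr (dotC v u) sqrrD !enorm_sqr.
have := dot_le_enorm u v; lra.
Qed.

Lemma enorm_dist_triangle w u v : enorm (u - v) <= enorm (u - w) + enorm (w -
  v).
Proof. by rewrite -(subrKA w) enorm_triangle. Qed.

Lemma enorm_le_sum u : enorm u <= \sum_(i < d) `|u 0 i|.
Proof.
rewrite -(@ler_pXn2r _ 2)// ?nnegrE ?sumr_ge0 ?enorm_ge0//.
rewrite enorm_sqr expr2 mulr_suml; apply: ler_sum => i _.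
apply: le_trans (ler_norm _) _; rewrite normrM ler_wpM2l//.
by rewrite (bigD1 i)//= lerDl sumr_ge0.
Qed.

Lemma norm_le_enorm u : `|u| <= enorm u.
Proof.
rewrite /Num.Def.normr/= mx_normrE; apply: bigmax_le => [|i _].
  exact: enorm_ge0.
by rewrite (ord1 i.1) coord_le_enorm.
Qed.

Lemma enorm_le_norm u : enorm u <= d%:R * `|u|.
Proof.
apply: le_trans (enorm_le_sum _) _; rewrite mulr_natl -[X in _ *+ X]card_ord.
by rewrite -sumr_const; apply: ler_sum => i _;
  rewrite /Num.Def.normr/= mx_normrE;
    exact: (le_bigmax _ (fun ij => `|u ij.1 ij.2|) (0, i)).
Qed.

End Euclid.

Section EuclidTopology.
Context {R : realType} {d : nat}.
Implicit Types x y : 'rV[R]_d.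

Lemma nbhs_enorm x (e : R) : 0 < e -> nbhs x [set y | enorm (y - x) < e].
Proof.
move=> e0; apply/nbhs_ballP; exists (e / d.+1%:R); first by rewrite /= divr_gt0.
move=> y; rewrite -ball_normE /= => xy.
rewrite enormBC (le_lt_trans (enorm_le_norm _))//.
have [d0|d0] := ltP 0 (d%:R : R); last first.
  by rewrite (le_lt_trans _ e0)// mulr_le0_ge0.
apply: (@lt_trans _ _ (d%:R * (e / d.+1%:R))); first by rewrite ltr_pM2l.
by rewrite mulrCA gtr_pMr// ltr_pdivrMr// mul1r ltr_nat.
Qed.

Lemma nbhs_enormP x (V : set 'rV[R]_d) : nbhs x V ->
  exists2 e, 0 < e & forall y, enorm (y - x) < e -> V y.
Proof.
move=> /nbhs_ballP[e /= e0 eV]; exists e => // y xy; apply: eV.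
by rewrite -ball_normE /= (le_lt_trans (norm_le_enorm _))// enormBC.
Qed.

(** Moving the base point of a quadratic penalty from [x] to [w]. *)
Lemma enorm_sqr_dist x y w :
  enorm (y - x) ^+ 2 = enorm (w - x) ^+ 2 + 2 * dot (w - x) (y - w) + enorm (y
    - w) ^+ 2.
Proof.
rewrite (_ : y - x = (w - x) + (y - w)); last by rewrite [RHS]addrC subrKA.
move: (w - x) (y - w) => a b; rewrite !enorm_sqr dotDl !dotDr (dotC b a); ring.
Qed.

End EuclidTopology.

(** * Passing from short intervals to long ones *)
Section RealInduction.
Context {R : realType}.

(** Induction along an interval by steps of length at most [tau]; [P] may be an
   asymptotic property, such as a convergence, since finitely many steps occur.
   *)
Lemma step_ind (P : R -> Prop) (s t tau : R) : 0 < tau -> s <= t -> P s ->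
  (forall r r', s <= r -> r <= r' -> r' <= t -> r' - r <= tau -> P r -> P r') ->
  P t.
Proof.
move=> tau0 st Ps step.
have H (n : nat) : P (Num.min t (s + tau *+ n)).
  elim: n => [|n IH]; first by rewrite mulr0n addr0 min_r.
  have sn : s <= s + tau *+ n by rewrite lerDl mulrn_wge0// ltW.
  apply: step IH.
  - by rewrite le_min st.
  - by rewrite le_min !ge_min lexx/= mulrS lerD2l lerDr (ltW tau0) orbT.
  - by rewrite ge_min lexx.
  - rewrite lerBlDr; have [tn|tn] := leP t (s + tau *+ n).
      by rewrite ge_min; apply/orP; left; rewrite ler_wpDl// ltW.
    by rewrite ge_min; apply/orP; right; rewrite mulrS addrCA.
have := H (Num.truncn ((t - s) / tau)).+1; rewrite min_l//.
rewrite -lerBlDl -mulr_natl -ler_pdivrMr//.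
by rewrite ltW// truncnS_gt.
Qed.

(** The sum over a fine partition is at most [e * (G b - G a)], for every [e].
   *)
Lemma additive_le0 (Phi : R -> R -> R) (G : R -> R) (a b : R) : a <= b ->
  (forall s r t, a <= s -> s <= r -> r <= t -> t <= b ->
    Phi s t = Phi s r + Phi r t) ->
  (forall e, 0 < e -> exists2 tau, 0 < tau &
    forall s t, a <= s -> s < t -> t <= b -> t - s <= tau ->
      Phi s t <= e * (G t - G s)) ->
  Phi a b <= 0.
Proof.
move=> ab add loc; have Phi0 s : a <= s <= b -> Phi s s = 0.
  by case/andP=> as' sb; have := add s s s as' (lexx _) (lexx _) sb; lra.
have H e : 0 < e -> Phi a b <= e * (G b - G a).
  move=> e0; have [tau tau0 Htau] := loc e e0.
  apply: (@step_ind (fun r => Phi a r <= e * (G r - G a)) a b tau) => //.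
    by rewrite Phi0 ?lexx// subrr mulr0.
  move=> r r' ar rr' r'b tr IH.
  rewrite (add a r r')// (_ : e * _ = e * (G r - G a) + e * (G r' - G r)).
    apply: lerD => //; move: (rr'); rewrite le_eqVlt => /predU1P[rE|lrr'].
      by rewrite -rE Phi0 ?subrr ?mulr0// ar (le_trans rr').
    exact: Htau.
  by ring.
apply/ler_addgt0Pr => e e0; rewrite add0r.
have [G0|G0] := leP (G b - G a) 0.
  apply: le_trans (H 1 ltr01) _; rewrite mul1r; exact: le_trans G0 (ltW e0).
apply: le_trans (H (e / (G b - G a)) _) _; first by rewrite divr_gt0.
by rewrite divfK ?gt_eqF.
Qed.

End RealInduction.

Section Continuity.
Context {R : realType} {d : nat}.
Implicit Types z : R -> 'rV[R]_d.

(** Heine's theorem on each [[0, T]]; the Euclidean and the sup norm are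
   equivalent. *)
Lemma continuous_RplusP z : continuous_Rplus z <->
  forall T e, 0 < e -> exists2 tau, 0 < tau &
    forall s t, 0 <= s -> s <= t -> t <= T -> t - s <= tau ->
      enorm (z t - z s) <= e.
Proof.
split=> [cz T e e0|uc].
  have cK : compact `[0, T] by exact: segment_compact.
  have {cz}cz x : 0 <= x -> forall e, 0 < e -> exists2 eta, 0 < eta &
      forall y, 0 <= y -> `|x - y| < eta -> enorm (z x - z y) <= e.
    move=> x0 e' e'0; have /subspace_continuousP/(_ x) := cz.
    rewrite /= in_itv/= andbT => /(_ x0) /cvgrPdist_le.
    have e'd : 0 < e' / d.+1%:R by rewrite divr_gt0.
    move=> /(_ _ e'd) [eta eta0 H]; exists eta => // y y0 xy.
    have := H y xy; rewrite /= in_itv/= andbT => /(_ y0) zxy.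
    apply: le_trans (enorm_le_norm _) _.
    apply: le_trans (ler_wpM2l (ler0n _ _) zxy) _.
    rewrite mulrCA ler_piMr ?(ltW e'0)// ler_pdivrMr// mul1r.
    by rewrite ler_nat.
  have := proj1 (compact_near_coveringP `[0, T]) cK _ (0 : R)^'+
    (fun tau s => 0 <= s -> forall t, 0 <= t -> `|t - s| < tau -> enorm (z t -
      z s) <= e).
  case.
  - move=> x; rewrite /= in_itv/= => /andP[x0 xT].
    have [|eta eta0 Heta] := cz x x0 (e / 2); first by rewrite divr_gt0.
    exists (ball x (eta / 2), [set tau | 0 < tau < eta / 2]).
      split; first by apply: nbhsx_ballx; rewrite divr_gt0.
      exists (eta / 2); first by rewrite /= divr_gt0.
      by move=> y /=; rewrite sub0r normrN => + y0; rewrite gtr0_norm// y0.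
    move=> [y tau] /= [xy /andP[tau0 taue]] y0 t t0 ty.
    have xt : `|x - t| < eta.
      rewrite -(subrKA y) (le_lt_trans (ler_normD _ _))// [eta]splitr.
      by rewrite ltrD// distrC (lt_trans ty).
    rewrite (le_trans (enorm_dist_triangle (z x) _ _))// [e]splitr lerD//.
      by rewrite enormBC Heta.
    by rewrite Heta// (lt_trans xy)// ltr_pdivrMr// ltr_pMr// ltr1n.
  - move=> tau0 /= tau00 H; exists (tau0 / 4); first by rewrite divr_gt0.
    move=> s t s0 st tT ts; apply: (H (tau0 / 2)) => //.
    - by rewrite /= sub0r normrN gtr0_norm ?divr_gt0// ltr_pdivrMr// ltr_pMr//
      ltr1n.
    - by rewrite divr_gt0.
    - by rewrite /= in_itv/= s0 (le_trans st).
    - exact: le_trans st.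
    - by rewrite ger0_norm ?subr_ge0//; lra.
apply/subspace_continuousP => x; rewrite /= in_itv/= andbT => x0.
apply/cvgrPdist_le => e e0; have [tau tau0 H] := uc (x + 1) e e0.
exists (Num.min tau 1); first by rewrite /= lt_min tau0 ltr01.
move=> y /=; rewrite lt_min => /andP[xy xy1]; rewrite in_itv/= andbT => y0.
apply: le_trans (norm_le_enorm _) _.
move: xy xy1; rewrite !ltr_distl => /andP[? ?] /andP[? ?].
have [xley|yx] := leP x y; first by rewrite enormBC H//; lra.
by rewrite H//; lra.
Qed.

End Continuity.

(** * Stieltjes measures of continuous functions *)
Section DiffuseMeasure.
Context {R : realType} (mu : {measure set (measurableTypeR R) -> \bar R}).
Hypothesis mu1 : forall r : R, mu [set r] = 0%E.
Implicit Types g : R -> R.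

Lemma Rintegral_itvD g (s r t : R) : s <= r -> r <= t ->
  mu.-integrable `[s, t] (EFin \o g) ->
  \int[mu]_(x in `[s, t]) g x =
  \int[mu]_(x in `[s, r]) g x + \int[mu]_(x in `[r, t]) g x.
Proof.
move=> sr rt intg.
have m1 : measurable ([set r] : set (measurableTypeR R)).
  exact: measurable_set1.
have stE : `[s, t]%classic = `[s, r] `|` `]r, t].
  by rewrite -(@itv_bndbnd_setU _ _ _ (BRight r)).
have rtE : `[r, t]%classic = [set r] `|` `]r, t] :> set R by rewrite setU1itv.
have i2 : mu.-integrable `[r, t] (EFin \o g).
  by apply: integrableS intg => //; apply: subset_itvr; rewrite bnd_simp.
rewrite stE Rintegral_setU//; first last.
- rewrite disj_set2E; apply/eqP/seteqP; split => // x [] /=.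
  by rewrite !in_itv/= => /andP[_ xr] /andP[rx _]; move: xr; rewrite leNgt rx.
- by rewrite -stE.
congr (_ + _); rewrite rtE Rintegral_setU//.
- rewrite [X in X + _](_ : _ = 0) ?add0r// /Rintegral null_set_integral ?mu1//;
  last first.
  have : mu.-integrable [set r] (EFin \o g).
    apply: (integrableS _ m1 _ intg) => //.
    by move=> _ ->; rewrite /= in_itv/= sr.
  by case/integrableP.
- by rewrite -rtE.
- rewrite disj_set2E; apply/eqP/seteqP; split => // x [] /= ->.
  by rewrite in_itv/= ltxx.
Qed.

(** The only estimate of integrals in use: pinching [g] between constants. *)
Lemma Rintegral_itv_bounds g (s t l a b : R) : s <= t ->
  mu `[s, t]%classic = l%:E -> mu.-integrable `[s, t] (EFin \o g) ->
  (forall r, s <= r <= t -> a <= g r <= b) ->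
  a * l <= \int[mu]_(r in `[s, t]) g r <= b * l.
Proof.
move=> st mul intg gab.
have cint c : mu.-integrable `[s, t] (EFin \o cst c : R -> \bar R).
  apply: measurable_bounded_integrable => //; first by rewrite mul ltry.
  exact: bounded_cst.
have E c : c * l = \int[mu]_(r in `[s, t]) c by rewrite Rintegral_cst// mul.
rewrite !E; apply/andP; split; apply: le_Rintegral => //; try exact: cint.
- by move=> r; rewrite /= in_itv/= => /gab/andP[].
- by move=> r; rewrite /= in_itv/= => /gab/andP[].
Qed.

Lemma continuous_integrable g (s t : R) : (mu `[s, t]%classic < +oo)%E ->
  0 <= s -> continuous (freeze g) -> mu.-integrable `[s, t] (EFin \o g).
Proof.
move=> mufin s0 cg; apply: (@eq_integrable _ _ _ mu _ _ (EFin \o freeze g)) =>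
  //.
  move=> r; rewrite inE/= in_itv/= => /andP[sr _].
  by rewrite /freeze max_r// (le_trans s0).
apply: measurable_bounded_integrable => //.
  by apply: measurable_funTS; exact: continuous_measurable_fun.
have cc : {within `[s, t], continuous (freeze g)} by exact:
  continuous_subspaceT.
have /compact_bounded[M [_ mrt]] := continuous_compact cc (segment_compact (a
  := s) (b := t)).
by exists M; split; rewrite ?num_real // => ? ? ? ?; exact: mrt.
Qed.

End DiffuseMeasure.

Section Stieltjes.
Context {R : realType}.
Implicit Types F g : R -> R.

(** Under these two conditions [stieltjes F] is the Lebesgue-Stieltjes measure,
   not its default value. *)
Definition integrator F :=
  {homo freeze F : x y / x <= y} /\ continuous (freeze F).

Lemma cumulative_ocitv (f : cumulative R R) (s t : R) : s <= t ->
  lebesgue_stieltjes_measure f `]s, t]%classic = (f t - f s)%:E.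
Proof.
move=> st; rewrite /lebesgue_stieltjes_measure /measure_extension/=.
rewrite measurable_mu_extE/=; last exact: is_ocitv.
by rewrite wlength_itv_bnd// EFinB.
Qed.

Lemma stieltjes_ocitv F (s t : R) : integrator F -> s <= t ->
  stieltjes F `]s, t]%classic = (freeze F t - freeze F s)%:E.
Proof.
move=> [ndF cF] st; rewrite /stieltjes; case: pselect => [h|[]]; last first.
  by split => //; exact: right_continuousW.
exact: cumulative_ocitv.
Qed.

(** A continuous [F] has no atoms. Hence closed intervals can be cut at a
   common end point, as in [Rintegral_itvD]. *)
Lemma stieltjes_set1 F (r : R) : integrator F -> stieltjes F [set r] = 0%E.
Proof.
move=> iF; apply/eqP; rewrite eq_le measure_ge0 andbT.
apply/lee_addgt0Pr => e e0; rewrite add0e.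
have /cvgrPdist_le/(_ _ e0)[eta eta0 H] := iF.2 r.
have rr : r - eta / 2 <= r by rewrite gerBl divr_ge0// ltW.
apply: (@le_trans _ _ (stieltjes F `](r - eta / 2), r]%classic)).
  have m1 : measurable ([set r] : set (measurableTypeR R)).
    exact: measurable_set1.
  apply: le_measure; rewrite ?inE//.
  by move=> _ ->; rewrite /= in_itv/= lexx andbT gtrBl divr_gt0.
rewrite stieltjes_ocitv// lee_fin (le_trans (ler_norm _))// H//=.
by rewrite opprB addrC subrK gtr0_norm ?divr_gt0// ltr_pdivrMr// ltr_pMr//
  ltr1n.
Qed.

Lemma stieltjes_itv F (s t : R) : integrator F -> 0 <= s -> s <= t ->
  stieltjes F `[s, t]%classic = (F t - F s)%:E.
Proof.
move=> iF s0 st; have <- : [set s] `|` `]s, t] = `[s, t]%classic.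
  by rewrite setU1itv.
have m1 : measurable ([set s] : set (measurableTypeR R)).
  exact: measurable_set1.
rewrite measureU//; first last.
- apply/seteqP; split => // x [] /= ->.
  by rewrite in_itv/= ltxx.
rewrite [X in (X + _)%E](_ : _ = 0%E) ?add0e; last exact: stieltjes_set1.
rewrite [LHS](stieltjes_ocitv iF st).
by rewrite /freeze !max_r// (le_trans s0).
Qed.

End Stieltjes.

Section Freeze.
Context {R : realType}.
Implicit Types F G : R -> R.

Lemma dist_max0 (x y : R) : `|Num.max 0 x - Num.max 0 y| <= `|x - y|.
Proof.
have := ler_norm (x - y); have := ler_norm (y - x); rewrite distrC ler_norml.
by case: (leP 0 x) => x0; case: (leP 0 y) => y0 H1 H2; apply/andP; split; lra.
Qed.

Lemma freeze_continuous F :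
  (forall b, 0 < b -> {within `[0, b], continuous F}) -> continuous (freeze F).
Proof.
move=> cF x; apply/cvgrPdist_le => e e0.
have b0 : 0 < Num.max 0 x + 1 by rewrite ltr_wpDl// le_max lexx.
have /subspace_continuousP/(_ (Num.max 0 x)) := cF _ b0.
rewrite /= in_itv/= le_max lexx lerDl ler01 => /(_ isT)/cvgrPdist_le/(_ _ e0).
move=> [eta eta0 H]; exists (Num.min eta 1);
  first by rewrite /= lt_min eta0 ltr01.
move=> y /=; rewrite lt_min => /andP[xy xy1]; apply: H => /=.
  exact: le_lt_trans (dist_max0 _ _) xy.
rewrite in_itv/= le_max lexx/=; have := le_lt_trans (dist_max0 x y) xy1.
by rewrite ltr_distl => /andP[]; lra.
Qed.

Lemma freezeE F t : 0 <= t -> freeze F t = F t.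
Proof. by move=> t0; rewrite /freeze max_r. Qed.

Lemma eq_freeze F G : (forall r, 0 <= r -> F r = G r) -> freeze F = freeze G.
Proof. by move=> FG; apply/funext => r; rewrite /freeze FG// le_max lexx. Qed.

Lemma eq_integrator F G : (forall r, 0 <= r -> F r = G r) ->
  integrator G -> integrator F.
Proof. by move=> /eq_freeze FG; rewrite /integrator FG. Qed.

Lemma integratorP F : (forall s t, 0 <= s -> s <= t -> F s <= F t) ->
  continuous (freeze F) -> integrator F.
Proof.
move=> ndF cF; split=> // s t st; apply: ndF; first by rewrite le_max lexx.
by rewrite ge_max le_max lexx/= le_max st orbT.
Qed.

Lemma freeze_continuousD F G : continuous (freeze F) -> continuous (freeze G) ->
  continuous (freeze (F \+ G)).
Proof. by move=> cF cG r; apply: cvgD; [exact: cF|exact: cG]. Qed.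

Lemma freeze_continuousZ (a : R) F : continuous (freeze F) ->
  continuous (freeze (fun r => a * F r)).
Proof. by move=> cF r; apply: cvgM; [exact: cvg_cst|exact: cF]. Qed.

Lemma freeze_continuous_sum (I : Type) (l : seq I) (f : I -> R -> R) :
  (forall i, continuous (freeze (f i))) ->
  continuous (freeze (fun r => \sum_(i <- l) f i r)).
Proof.
move=> cf; elim: l => [|i l IH] r.
  rewrite (_ : freeze _ = cst 0); first exact: cvg_cst.
  by apply/funext => x; rewrite /freeze big_nil.
rewrite (_ : freeze _ = freeze (f i) \+ freeze (fun r => \sum_(i <- l) f i r)).
  by apply: cvgD; [exact: cf|exact: IH].
by apply/funext => x; rewrite /freeze big_cons.
Qed.

End Freeze.

(** The converse direction of [continuous_RplusP], for scalar functions. *)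
Lemma freeze_continuousP (R : realType) (F : R -> R) :
  (forall T e, 0 < e -> exists2 tau, 0 < tau &
    forall s t, 0 <= s -> s <= t -> t <= T -> t - s <= tau ->
      `|F t - F s| <= e) -> continuous (freeze F).
Proof.
move=> H x; apply/cvgrPdist_le => e e0.
have [tau tau0 {}H] := H (Num.max 0 x + 1) e e0.
exists (Num.min tau 1); first by rewrite /= lt_min tau0 ltr01.
move=> y /=; rewrite lt_min => /andP[xy xy1]; rewrite /freeze.
have m0 (z : R) : 0 <= Num.max 0 z by rewrite le_max lexx.
have := le_lt_trans (dist_max0 x y) xy1; rewrite ltr_distl => /andP[? ?].
have := le_lt_trans (dist_max0 x y) xy; rewrite ltr_distl => /andP[? ?].
have [xy'|yx] := leP (Num.max 0 x) (Num.max 0 y).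
  by rewrite distrC; apply: H => //; lra.
by apply: H => //; [exact: ltW|lra|lra].
Qed.


Section VectorFreeze.
Context {R : realType} {d : nat}.
Implicit Types z : R -> 'rV[R]_d.

Lemma continuous_coord z i : continuous_Rplus z ->
  continuous (freeze (fun r => z r 0 i)).
Proof.
move=> /continuous_RplusP cz; apply: freeze_continuousP => T e e0.
have [tau tau0 H] := cz T e e0; exists tau => // s t s0 st tT ts.
apply: le_trans (H s t s0 st tT ts).
by have := coord_le_enorm (z t - z s) i; rewrite !mxE.
Qed.

Lemma continuous_enorm_sqr z : continuous_Rplus z ->
  continuous (freeze (fun r => enorm (z r) ^+ 2)).
Proof.
move=> cz; rewrite (_ : (fun r => _) = (fun r => \sum_(i < d) z r 0 i * z r 0
  i)).
  apply: freeze_continuous_sum => i r.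
  by apply: cvgM; exact: continuous_coord.
by apply/funext => r; rewrite enorm_sqr.
Qed.

Lemma continuous_RplusB z z' : continuous_Rplus z -> continuous_Rplus z' ->
  continuous_Rplus (fun r => z r - z' r).
Proof.
move=> cz cz'; move: cz cz' => /subspace_continuousP cz /subspace_continuousP
  cz'.
by apply/subspace_continuousP => x x0; apply: cvgB; [exact: cz|exact: cz'].
Qed.

Lemma continuous_Rplus_cst (c : 'rV[R]_d) : continuous_Rplus (fun=> c).
Proof. by apply/subspace_continuousP => x x0; exact: cvg_cst. Qed.

End VectorFreeze.

Section BoundedPath.
Context {R : realType} {d : nat}.
Implicit Types z : R -> 'rV[R]_d.

Lemma continuous_Rplus_bounded z T : continuous_Rplus z ->
  exists2 B, 0 <= B & forall r, 0 <= r -> r <= T -> enorm (z r) <= B.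
Proof.
move=> /continuous_RplusP cz; have [T0|T0] := ltP T 0.
  by exists 0 => // r r0 rT; have := le_lt_trans (le_trans r0 rT) T0;
    rewrite ltxx.
have [tau tau0 H] := cz T 1 ltr01.
apply: (@step_ind _ (fun t => exists2 B, 0 <= B &
    forall r, 0 <= r -> r <= t -> enorm (z r) <= B) 0 T tau) => //.
  exists (enorm (z 0)) => [|r r0 r0']; first exact: enorm_ge0.
  by have -> : r = 0 by apply/le_anti/andP.
move=> s t s0 st tT ts [B B0 HB]; exists (B + 1); first by rewrite addr_ge0.
move=> r r0 rt; have [rs|sr] := leP r s.
  by rewrite (le_trans (HB r r0 rs))// lerDl.
rewrite -(subrK (z s) (z r)) (le_trans (enorm_triangle _ _))// addrC lerD ?HB//.
apply: H => //; [exact: ltW|exact: le_trans rt tT|].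
by rewrite (le_trans _ ts)// lerD2r.
Qed.

(** Extending a path of the half-line to the whole line, so that results on
   functions of a real variable apply. *)
Lemma continuous_Rplus_clamp z : continuous_Rplus z ->
  continuous (fun r : R => z (Num.max 0 r)).
Proof.
move=> /subspace_continuousP cz x; apply/cvgrPdist_le => e e0.
have : Num.max 0 x \in `[0, +oo[ by rewrite in_itv/= andbT le_max lexx.
move=> /cz/cvgrPdist_le/(_ _ e0)[eta eta0 H]; exists eta => // y xy.
apply: H => /=; first exact: le_lt_trans (dist_max0 _ _) xy.
by rewrite in_itv/= andbT le_max lexx.
Qed.

End BoundedPath.

Section Lebesgue.
Context {R : realType}.
Local Notation mu := (@lebesgue_measure R).

Lemma lebesgue_segment (s t : R) : s <= t -> mu `[s, t]%classic = (t - s)%:E.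
Proof.
move=> st; rewrite lebesgue_measure_itv/= lte_fin.
by case: ltgtP st => // ->; rewrite subrr.
Qed.

Lemma Lebesgue_itvD (q : R -> R) s r t : s <= r -> r <= t ->
  mu.-integrable `[s, t] (EFin \o q) ->
  \int[mu]_(u in `[s, t]) q u =
  \int[mu]_(u in `[s, r]) q u + \int[mu]_(u in `[r, t]) q u.
Proof.
by move=> sr rt; apply: Rintegral_itvD => // u; exact: lebesgue_measure_set1.
Qed.

Lemma Lebesgue_itv_bounds (q : R -> R) s t a b : s <= t ->
  mu.-integrable `[s, t] (EFin \o q) ->
  (forall r, s <= r <= t -> a <= q r <= b) ->
  a * (t - s) <= \int[mu]_(u in `[s, t]) q u <= b * (t - s).
Proof.
by move=> st; apply: Rintegral_itv_bounds => //; exact: lebesgue_segment.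
Qed.

Lemma Lebesgue_integrable (q : R -> R) s t : 0 <= s -> s <= t ->
  continuous (freeze q) -> mu.-integrable `[s, t] (EFin \o q).
Proof.
move=> s0 st; apply: continuous_integrable => //.
by rewrite [X in (X < _)%E](lebesgue_segment st) ltry.
Qed.

End Lebesgue.

(** * Total variation and Stieltjes integrals of vector paths *)
Section PartitionSum.
Context {R : realType}.

Lemma partition_sum_le (D : R -> R -> R) (G : R -> R) (x0 a b : R) l :
  itv_partition a b l ->
  (forall s t, a <= s -> s <= t -> t <= b -> D s t <= G t - G s) ->
  \sum_(0 <= i < size l) D (nth x0 (a :: l) i) (nth x0 (a :: l) i.+1)
    <= G b - G a.
Proof.
elim: l a => [|c l IH] a abl DG.
  by rewrite (itv_partition_nil abl) big_nil subrr.
rewrite big_nat_recl//= (_ : G b - G a = (G c - G a) + (G b - G c));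
  last by ring.
have cb : c <= b by apply: itv_partition_le (itv_partition_cons abl).
have ac : a <= c by case: abl => /= /andP[/ltW].
apply: lerD; first exact: DG.
apply: IH; first exact: itv_partition_cons abl.
by move=> s t cs; apply: DG; exact: le_trans cs.
Qed.

Lemma partition_sum_rcons (D : R -> R -> R) (x0 a t : R) l :
  \sum_(0 <= i < size (rcons l t))
    D (nth x0 (a :: rcons l t) i) (nth x0 (a :: rcons l t) i.+1) =
  \sum_(0 <= i < size l) D (nth x0 (a :: l) i) (nth x0 (a :: l) i.+1)
    + D (last a l) t.
Proof.
elim: l a => [|c l IH] a /=; first by rewrite big_nat1 big_nil add0r.
by rewrite !big_nat_recl//= IH addrA.
Qed.

Lemma itv_partition_rcons (a b c : R) l :
  itv_partition a b l -> b < c -> itv_partition a c (rcons l c).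
Proof.
move=> abl bc; rewrite -cats1; apply: itv_partition_cat abl _.
exact: itv_partition1.
Qed.

End PartitionSum.

Section VarTheory.
Context {R : realType} {d : nat}.
Variable k : R -> 'rV[R]_d.

Definition evar (t : R) := fine (Var k t).

Lemma Var_ge0 t : 0 <= t -> (0 <= Var k t)%E.
Proof.
move=> t0; rewrite le_eqVlt in t0; apply: le_ereal_sup_tmp;
  case/predU1P: t0 => [<-|t0].
  by exists 0%E => //; exists [::]; [split => //=|rewrite /= big_nil].
exists (enorm (k t - k 0))%:E; last by rewrite lee_fin enorm_ge0.
by exists [:: t]; [exact: itv_partition1|rewrite /= big_nat1].
Qed.

Hypothesis kBV : BV_loc k.

Lemma evarE t : 0 <= t -> Var k t = (evar t)%:E.
Proof.
move=> t0; rewrite fineK// ge0_fin_numE ?Var_ge0//; exact: kBV.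
Qed.

Lemma partition_le_evar t l : 0 <= t -> itv_partition 0 t l ->
  \sum_(0 <= i < size l) enorm (k (nth t (0 :: l) i.+1) - k (nth t (0 :: l) i))
  <= evar t.
Proof.
move=> t0 tl; rewrite -lee_fin -evarE//; apply: ereal_sup_ubound.
by exists l.
Qed.

Lemma evar_ge s t : 0 <= s -> s <= t -> enorm (k t - k s) <= evar t - evar s.
Proof.
move=> s0; rewrite le_eqVlt => /predU1P[<-|st].
  by rewrite !subrr enorm0.
have t0 : 0 <= t by rewrite (le_trans s0)// ltW.
rewrite lerBrDr -lerBrDl -lee_fin -evarE//; apply: ge_ereal_sup => _ [l sl <-].
rewrite /= lee_fin lerBrDl addrC.
apply: le_trans (partition_le_evar t0 (itv_partition_rcons sl st)).
rewrite (partition_sum_rcons (fun a b => enorm (k b - k a))).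
rewrite lerD//; last by case: sl => _ /eqP ->.
rewrite le_eqVlt; apply/orP; left; apply/eqP;
  apply: eq_big_nat => i /andP[_ il].
by rewrite !(set_nth_default t)//= ltnS// ltnW.
Qed.

Lemma evar0 : evar 0 = 0.
Proof.
apply/le_anti; rewrite fine_ge0 ?Var_ge0// andbT -lee_fin -evarE//.
apply: ge_ereal_sup => _ [l sl <-].
by rewrite (itv_partitionxx sl) /= big_nil.
Qed.

Lemma evar_nd s t : 0 <= s -> s <= t -> evar s <= evar t.
Proof.
by move=> s0 st; rewrite -subr_ge0 (le_trans (enorm_ge0 _) (evar_ge s0 st)).
Qed.

(** Continuing the variation by [G] after [s] gives a function whose increments
   still dominate those of [k], hence all partition sums of [k]. *)
Lemma evar_le (G : R -> R) s t : 0 <= s -> s <= t ->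
  (forall s' t', s <= s' -> s' <= t' -> t' <= t ->
    enorm (k t' - k s') <= G t' - G s') ->
  evar t - evar s <= G t - G s.
Proof.
move=> s0 st kG.
(* The competitor on the whole of [0, t]: the variation itself up to [s]. *)
pose G' r := if r <= s then evar r else evar s + (G r - G s).
have t0 : 0 <= t by exact: le_trans st.
have G't : G' t = evar s + (G t - G s).
  rewrite /G'; case: leP => // ts; have -> : t = s by apply/le_anti/andP.
  by rewrite subrr addr0.
rewrite lerBlDl -G't -lee_fin -evarE//; apply: ge_ereal_sup => _ [l sl <-].
rewrite lee_fin (_ : G' t = G' t - G' 0); last by rewrite {3}/G' s0 evar0 subr0.
apply: (@partition_sum_le _ (fun a b => enorm (k b - k a)) G' t 0 t l sl).
move=> a b a0 ab bt.
rewrite /G'; case: (leP b s) => bs; case: (leP a s) => as'.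
- exact: evar_ge.
- by have := lt_le_trans as' ab; rewrite ltNge bs.
- apply: le_trans (enorm_dist_triangle (k s) _ _) _.
  have := evar_ge a0 as'; have := kG s b (lexx _) (ltW bs) bt; lra.
- have := kG a b (ltW as') ab bt; lra.
Qed.

End VarTheory.

Section ScalarBV.
Context {R : realType}.
Variable h : R -> R.
Hypothesis hc : continuous (freeze h).
Hypothesis hBV : forall t : R, 0 <= t -> bounded_variation 0 t h.

Definition tv (t : R) := fine (total_variation 0 t h).

Lemma tvE t : 0 <= t -> total_variation 0 t h = (tv t)%:E.
Proof. by move=> t0; rewrite fineK//; apply/bounded_variationP => //;
  exact: hBV. Qed.

Lemma tvB s t : 0 <= s -> s <= t ->
  total_variation s t h = (tv t - tv s)%:E.
Proof.
move=> s0 st; have t0 : 0 <= t by exact: le_trans st.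
by rewrite EFinB -!tvE// (total_variationD h s0 st) tvE// addeAC subee// add0e.
Qed.

Lemma tv_ge s t : 0 <= s -> s <= t -> `|h t - h s| <= tv t - tv s.
Proof. by move=> s0 st; rewrite -lee_fin -tvB// total_variation_ge. Qed.

Lemma tv_continuous : continuous (freeze tv).
Proof.
apply: freeze_continuous => b b0; apply: total_variation_continuous => //.
  have : {within `[0, b], continuous (freeze h)} by exact: continuous_subspaceT.
  apply: subspace_eq_continuous => r; rewrite inE/= in_itv/= => /andP[r0 _].
  exact: freezeE.
exact: hBV (ltW b0).
Qed.

Lemma neg_tvE t : 0 <= t -> fine (neg_tv 0 h t) = (tv t - h t) / 2.
Proof. by move=> t0; rewrite /neg_tv tvE. Qed.

Lemma pos_tvE t : 0 <= t -> fine (pos_tv 0 h t) = (tv t + h t) / 2.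
Proof. by move=> t0; rewrite /pos_tv /neg_tv total_variationN tvE//= opprK. Qed.

Let half_continuous a : continuous (freeze (fun t => (tv t + a * h t) / 2)).
Proof.
rewrite (_ : (fun t => _) = (fun t => 2^-1 * (tv \+ (fun t => a * h t)) t)).
  apply: freeze_continuousZ; apply: freeze_continuousD;
    first exact: tv_continuous.
  exact: freeze_continuousZ.
by apply/funext => r /=; rewrite mulrC.
Qed.

Lemma neg_tv_integrator : integrator (fun t => fine (neg_tv 0 h t)).
Proof.
apply: (eq_integrator neg_tvE); apply: integratorP => [s t s0 st|].
  by have := tv_ge s0 st; rewrite ler_norml => /andP[]; lra.
rewrite (_ : (fun t => _) = (fun t => (tv t + -1 * h t) / 2)).
  exact: half_continuous.
by apply/funext => t; rewrite mulN1r.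
Qed.

Lemma pos_tv_integrator : integrator (fun t => fine (pos_tv 0 h t)).
Proof.
apply: (eq_integrator pos_tvE); apply: integratorP => [s t s0 st|].
  by have := tv_ge s0 st; rewrite ler_norml => /andP[]; lra.
rewrite (_ : (fun t => _) = (fun t => (tv t + 1 * h t) / 2)).
  exact: half_continuous.
by apply/funext => t; rewrite mul1r.
Qed.

Lemma stieltjes_lty (F : R -> R) (s t : R) : integrator F -> 0 <= s -> s <= t ->
  (stieltjes F `[s, t]%classic < +oo)%E.
Proof. by move=> iF s0 st; rewrite [X in (X < _)%E](stieltjes_itv iF s0 st)
  ltry. Qed.

Lemma BV_integralD (g : R -> R) s r t : continuous (freeze g) ->
  0 <= s -> s <= r -> r <= t ->
  BV_integral s t g h = BV_integral s r g h + BV_integral r t g h.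
Proof.
move=> cg s0 sr rt; have st := le_trans sr rt.
have [iN iP] := (neg_tv_integrator, pos_tv_integrator).
rewrite /BV_integral.
rewrite (Rintegral_itvD _ sr rt); first last.
- exact: continuous_integrable (stieltjes_lty iP s0 st) s0 cg.
- by move=> u; exact: stieltjes_set1.
rewrite (Rintegral_itvD _ sr rt); first last.
- exact: continuous_integrable (stieltjes_lty iN s0 st) s0 cg.
- by move=> u; exact: stieltjes_set1.
by rewrite opprD addrACA.
Qed.

(** The positive and negative variations have increments adding up to those of
   the total variation, so both integrals together err by at most [e] times
   these. *)
Lemma BV_integral_approx (g : R -> R) s t c e : continuous (freeze g) ->
  0 <= s -> s <= t -> (forall r, s <= r <= t -> `|g r - c| <= e) ->
  `|BV_integral s t g h - c * (h t - h s)| <= e * (tv t - tv s).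
Proof.
move=> cg s0 st gc; have t0 : 0 <= t by exact: le_trans st.
have [iN iP] := (neg_tv_integrator, pos_tv_integrator).
have gce r : s <= r <= t -> c - e <= g r <= c + e.
  by move/gc; rewrite ler_distl.
have := Rintegral_itv_bounds st (stieltjes_itv iN s0 st)
  (continuous_integrable (stieltjes_lty iN s0 st) s0 cg) gce.
have := Rintegral_itv_bounds st (stieltjes_itv iP s0 st)
  (continuous_integrable (stieltjes_lty iP s0 st) s0 cg) gce.
rewrite !neg_tvE// !pos_tvE// /BV_integral.
move: (Rintegral _ _ _) (Rintegral _ _ _) => A B /andP[P1 P2] /andP[N1 N2].
rewrite ler_norml; apply/andP; split; lra.
Qed.

End ScalarBV.

Section VectorBV.
Context {R : realType} {d : nat}.
Variable k : R -> 'rV[R]_d.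
Hypothesis kBV : BV_loc k.
Hypothesis kc : continuous_Rplus k.

Let h i (r : R) := k r 0 i.

Let TV_le i s t : 0 <= s -> s <= t ->
  (total_variation s t (h i) <= (evar k t - evar k s)%:E)%E.
Proof.
move=> s0 st; apply: ge_ereal_sup => _ [_ [l sl <-] <-]; rewrite lee_fin.
apply: (@partition_sum_le _ (fun a b => `|h i b - h i a|) (evar k) t s t l sl).
move=> a b sa ab bt; apply: le_trans (evar_ge kBV (le_trans s0 sa) ab).
by have := coord_le_enorm (k b - k a) i; rewrite !mxE.
Qed.

Lemma coord_BV i t : 0 <= t -> bounded_variation 0 t (h i).
Proof.
move=> t0; apply/bounded_variationP => //.
rewrite ge0_fin_numE ?total_variation_ge0//.
by apply: le_lt_trans (TV_le i (lexx _) t0) _; rewrite ltry.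
Qed.

Lemma coord_tv_le i s t : 0 <= s -> s <= t ->
  tv (h i) t - tv (h i) s <= evar k t - evar k s.
Proof.
by move=> s0 st; rewrite -lee_fin -tvB ?TV_le// => u; exact: coord_BV.
Qed.

(** The Euclidean variation grows at most like the sum of the variations of the
   coordinates, whose continuity is known. *)
Lemma evar_integrator : integrator (evar k).
Proof.
apply: integratorP => [s t|]; first exact: evar_nd.
have ct : continuous (freeze (fun r => \sum_(i < d) tv (h i) r)).
  apply: freeze_continuous_sum => i; apply: tv_continuous.
    exact: continuous_coord.
  by move=> t; exact: coord_BV.
have WT s t : 0 <= s -> s <= t -> `|evar k t - evar k s| <=
    `|\sum_(i < d) tv (h i) t - \sum_(i < d) tv (h i) s|.
  move=> s0 st; rewrite [leLHS]ger0_norm ?subr_ge0 ?evar_nd//.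
  apply: le_trans _ (ler_norm _).
  apply: (@evar_le _ _ _ kBV (fun r => \sum_(i < d) tv (h i) r)) => // a b sa
    ab bt.
  apply: le_trans (enorm_le_sum _) _; rewrite -sumrB; apply: ler_sum => i _.
  rewrite !mxE; apply: tv_ge => //; last exact: le_trans sa.
  by move=> r; exact: coord_BV.
move=> x; apply/cvgrPdist_le => e e0.
move: (ct x) => /cvgrPdist_le/(_ e e0)[eta eta0 H]; exists eta => // y /H.
apply: le_trans; rewrite /freeze.
have m0 (z : R) : 0 <= Num.max 0 z by rewrite le_max lexx.
case: (leP (Num.max 0 x) (Num.max 0 y)) => xy; last by apply: WT => //;
  exact: ltW.
by rewrite distrC (distrC (\sum_(i < d) tv (h i) _)); exact: WT.
Qed.

Lemma dot_integralD (g : R -> 'rV[R]_d) s r t : continuous_Rplus g ->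
  0 <= s -> s <= r -> r <= t ->
  dot_integral s t g k = dot_integral s r g k + dot_integral r t g k.
Proof.
move=> cg s0 sr rt; rewrite /dot_integral -big_split; apply: eq_bigr => i _.
apply: BV_integralD => //; [exact: continuous_coord| |exact: continuous_coord].
by move=> u; exact: coord_BV.
Qed.

(** Integration over a short interval is a single term of a Riemann sum, up to
   the oscillation of the integrand times the variation. Summing over
   coordinates costs a factor [d], harmless since oscillations are made small.
   *)
Lemma dot_integral_approx (g : R -> 'rV[R]_d) s t c e : continuous_Rplus g ->
  0 <= s -> s <= t -> (forall r, s <= r <= t -> enorm (g r - c) <= e) ->
  `|dot_integral s t g k - dot c (k t - k s)| <= d%:R * (e * (evar k t - evar k
    s)).
Proof.
move=> cg s0 st gc; rewrite /dot_integral /dot -sumrB.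
apply: le_trans (ler_norm_sum _ _ _) _.
rewrite mulr_natl -[X in _ *+ X]card_ord -sumr_const; apply: ler_sum => i _.
have e0 : 0 <= e by apply: le_trans (enorm_ge0 _) (gc s _); rewrite lexx.
have /= := @BV_integral_approx _ (h i) _ _ (fun r => g r 0 i) s t (c 0 i) e.
rewrite /h !mxE => H; apply: le_trans (H _ _ _ _ _ _) _ => //.
- exact: continuous_coord.
- by move=> u; exact: coord_BV.
- exact: continuous_coord.
- move=> r /gc; apply: le_trans.
  by have := coord_le_enorm (g r - c) i; rewrite !mxE.
- by rewrite ler_wpM2l// coord_tv_le.
Qed.

Lemma dVar_integrable (q : R -> R) s t : continuous (freeze q) -> 0 <= s ->
  s <= t -> (dVar k).-integrable `[s, t] (EFin \o q).
Proof.
move=> cq s0 st.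
exact: continuous_integrable (stieltjes_lty evar_integrator s0 st) s0 cq.
Qed.

Lemma dVar_integralD (q : R -> R) s r t : continuous (freeze q) -> 0 <= s ->
  s <= r -> r <= t ->
  \int[dVar k]_(u in `[s, t]) q u =
  \int[dVar k]_(u in `[s, r]) q u + \int[dVar k]_(u in `[r, t]) q u.
Proof.
move=> cq s0 sr rt; apply: Rintegral_itvD => //.
  by move=> u; exact: stieltjes_set1 evar_integrator.
by apply: dVar_integrable => //; exact: le_trans rt.
Qed.

Lemma dVar_integral_bounds (q : R -> R) s t a b : continuous (freeze q) ->
  0 <= s -> s <= t -> (forall r, s <= r <= t -> a <= q r <= b) ->
  a * (evar k t - evar k s) <= \int[dVar k]_(u in `[s, t]) q u
    <= b * (evar k t - evar k s).
Proof.
move=> cq s0 st; apply: Rintegral_itv_bounds => //.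
  exact: stieltjes_itv evar_integrator s0 st.
exact: dVar_integrable.
Qed.

End VectorBV.

Lemma eq_dot_integral (R : realType) (d : nat) (g g' k : R -> 'rV[R]_d) s t :
  (forall r, s <= r <= t -> g r = g' r) ->
  dot_integral s t g k = dot_integral s t g' k.
Proof.
move=> gg'; apply: eq_bigr => i _; congr (_ - _); apply: eq_Rintegral => r;
  by rewrite inE/= in_itv/= => /gg' ->.
Qed.


Section SquareChainRule.
Context {R : realType} {d : nat}.
Implicit Types k : R -> 'rV[R]_d.

Lemma BV_loc_cst (c : 'rV[R]_d) : BV_loc (fun=> c).
Proof.
move=> t t0; apply: (@le_lt_trans _ _ 0%E); last exact: ltry.
apply: ge_ereal_sup => _ [l _ <-]; rewrite lee_fin /= big1// => i _.
by rewrite subrr enorm0.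
Qed.

Lemma evar_cst (c : 'rV[R]_d) s t : 0 <= s -> s <= t ->
  evar (fun=> c) t - evar (fun=> c) s = 0.
Proof.
move=> s0 st; apply/le_anti; rewrite subr_ge0 (evar_nd (BV_loc_cst c))// andbT.
have -> : 0 = (fun=> 0 : R) t - (fun=> 0 : R) s by rewrite subrr.
apply: (evar_le (BV_loc_cst c) s0 st) => s' t' _ _ _.
by rewrite !subrr enorm0.
Qed.

Variables k k' : R -> 'rV[R]_d.
Hypotheses (kBV : BV_loc k) (kc : continuous_Rplus k).
Hypotheses (kBV' : BV_loc k') (kc' : continuous_Rplus k').

(** With [u = k - k'], the integral of [u] against [du] is half the increment
   of [enorm u ^+ 2]; a perturbation [M] of the integrand costs at most [om]
   times the variations. On a short interval [dot (u s) (u t - u s)] differs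
   from half the increment of the square by [enorm (u t - u s) ^+ 2 / 2], which
   is negligible against the variation. *)
Lemma square_chain_rule_le (M : R -> 'rV[R]_d) a b om : continuous_Rplus M ->
  0 <= a -> a <= b -> (forall r, a <= r <= b -> enorm (M r) <= om) ->
  (enorm (k b - k' b) ^+ 2 - enorm (k a - k' a) ^+ 2) / 2
  - om * (evar k b - evar k a + (evar k' b - evar k' a)) <=
  dot_integral a b (fun r => k r - k' r - M r) k -
  dot_integral a b (fun r => k r - k' r - M r) k'.
Proof.
move=> cM a0 ab HM; pose u r := k r - k' r; pose g r := u r - M r.
have cu : continuous_Rplus u by exact: continuous_RplusB.
have cg : continuous_Rplus g by exact: continuous_RplusB.
(* The defect of the claim on an interval, to which [additive_le0] applies. *)
pose Phi s t := (enorm (u t) ^+ 2 - enorm (u s) ^+ 2) / 2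
  - om * (evar k t - evar k s + (evar k' t - evar k' s))
  - (dot_integral s t g k - dot_integral s t g k').
suff : Phi a b <= 0 by rewrite /Phi subr_le0.
apply: (@additive_le0 _ Phi (fun r => evar k r + evar k' r)) => //.
  move=> s r t as' sr rt tb; have s0 : 0 <= s by exact: le_trans as'.
  rewrite /Phi (dot_integralD kBV kc cg s0 sr rt) (dot_integralD kBV' kc' cg s0
    sr rt).
  move: (dot_integral s r g k) (dot_integral r t g k) => ? ?.
  move: (dot_integral s r g k') (dot_integral r t g k') => ? ?; lra.
move=> e e0; pose e' := e / d.+1%:R.
have e'0 : 0 < e' by rewrite divr_gt0.
have [t1 t10 H1] := (continuous_RplusP u).1 cu b e' e'0.
have [t2 t20 H2] := (continuous_RplusP g).1 cg b e' e'0.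
exists (Num.min t1 t2); first by rewrite lt_min t10.
move=> s t as' /ltW st tb; rewrite le_min => /andP[ts1 ts2].
have s0 : 0 <= s by exact: le_trans as'.
have osc r : s <= r <= t -> enorm (g r - g s) <= e'.
  move=> /andP[sr rt]; apply: H2 => //; first exact: le_trans rt tb.
  by rewrite (le_trans _ ts2)// lerD2r.
have := dot_integral_approx kBV kc cg s0 st osc.
have := dot_integral_approx kBV' kc' cg s0 st osc.
rewrite /Phi; move: (dot_integral s t g k) (dot_integral s t g k') => I I'.
have du := H1 s t s0 st tb ts1.
have uE : u t - u s = (k t - k s) - (k' t - k' s).
  by rewrite /u; apply/matrixP => i j; rewrite !mxE; ring.
have duW : enorm (u t - u s) <= evar k t - evar k s + (evar k' t - evar k' s).
  rewrite uE (le_trans (enorm_triangle _ _))// enormN lerD//.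
    exact: evar_ge.
  exact: evar_ge.
move: duW; set V := (evar k t - evar k s + _) => duW.
have -> : evar k t + evar k' t - (evar k s + evar k' s) = V by rewrite /V; lra.
have gu : dot (g s) (k t - k s) - dot (g s) (k' t - k' s) =
    dot (u s) (u t - u s) - dot (M s) (u t - u s).
  by rewrite -dotBr -uE /g dotBl.
have Ms : dot (M s) (u t - u s) <= om * V.
  apply: le_trans (dot_le_enorm _ _) _.
  by rewrite ler_pM ?enorm_ge0// HM// as' (le_trans st).
have usq : enorm (u t) ^+ 2 = enorm (u s) ^+ 2 + 2 * dot (u s) (u t - u s)
    + enorm (u t - u s) ^+ 2.
  by have := enorm_sqr_dist 0 (u t) (u s); rewrite !subr0.
have du2 : enorm (u t - u s) ^+ 2 <= e' * V.
  by rewrite expr2 ler_pM ?enorm_ge0.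
rewrite !ler_norml => /andP[J1 J2] /andP[J3 J4].
have V0 : 0 <= V by exact: le_trans (enorm_ge0 _) duW.
have eV : e * V = d%:R * (e' * V) + e' * V.
  by rewrite /e' -natr1; field; rewrite natr1.
have eVs : d%:R * (e' * (evar k t - evar k s)) + d%:R * (e' * (evar k' t - evar
  k' s)) =
   d%:R * (e' * V) by rewrite -mulrDr -mulrDr.
rewrite eV usq; have : 0 <= e' * V by rewrite mulr_ge0// ltW.
lra.
Qed.

End SquareChainRule.

(** * Uniform convergence and lower limits *)
Section UniformLimits.
Context {R : realType} {d : nat}.

Lemma dot_integralN (g k : R -> 'rV[R]_d) s t : BV_loc k -> continuous_Rplus k
  ->
  continuous_Rplus g -> 0 <= s -> s <= t ->
  dot_integral s t (fun r => - g r) k = - dot_integral s t g k.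
Proof.
move=> kBV kc cg s0 st; rewrite /dot_integral -sumrN; apply: eq_bigr => i _.
have hc := continuous_coord (i := i) kc;
  have hBV u (u0 : 0 <= u) := coord_BV kBV i u0.
have iN := neg_tv_integrator hc hBV; have iP := pos_tv_integrator hc hBV.
have gi := continuous_coord (i := i) cg.
rewrite /BV_integral.
have E (F : R -> R) : integrator F ->
  \int[stieltjes F]_(r in `[s, t]) (- g r) 0 i =
    - \int[stieltjes F]_(r in `[s, t]) g r 0 i.
  move=> iF; rewrite -mulN1r -RintegralZl//; last first.
    exact: continuous_integrable (stieltjes_lty iF s0 st) s0 gi.
  by apply: eq_Rintegral => r _; rewrite mxE mulN1r.
by rewrite !E// opprB opprK addrC.
Qed.

Lemma supnorm_ge (T : R) (z : R -> 'rV[R]_d) (r : R) : 0 <= r -> r <= T ->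
  ((enorm (z r))%:E <= supnorm T z)%E.
Proof.
move=> r0 rT; apply: ereal_sup_ubound; exists r; last by [].
by rewrite /= in_itv/= r0.
Qed.

Lemma supnorm_le (T e : R) (z : R -> 'rV[R]_d) :
  (forall r, 0 <= r -> r <= T -> enorm (z r) <= e) -> (supnorm T z <= e%:E)%E.
Proof.
move=> H; apply: ge_ereal_sup => y [r /=]; rewrite in_itv/= => /andP[r0 rT] <-.
by rewrite lee_fin H.
Qed.

Lemma supnorm_ge0 (T : R) (z : R -> 'rV[R]_d) : 0 <= T -> (0 <= supnorm T z)%E.
Proof.
by move=> T0; apply: le_trans (supnorm_ge z (lexx _) T0);
  rewrite lee_fin enorm_ge0.
Qed.

Lemma cvg0eP (u : nat -> \bar R) : (forall n, 0 <= u n)%E ->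
  u n @[n --> \oo] --> 0%E <->
  (forall e : R, 0 < e -> exists N, forall n, (N <= n)%N -> (u n <= e%:E)%E).
Proof.
move=> u0; split=> [/fine_cvgP[fu /cvgrPdist_le cu] e e0|H].
  have := cu e e0 => cue; have := filterI fu cue => -[N _ HN].
  exists N => n Nn; have [fn /=] := HN n Nn.
  by rewrite sub0r normrN => H; rewrite -(fineK fn) lee_fin (le_trans (ler_norm
    _)).
apply/fine_cvgP; split.
  have [N HN] := H 1 ltr01; exists N => // n /= /HN un.
  by rewrite ge0_fin_numE// (le_lt_trans un)// ltry.
apply/cvgrPdist_le => e e0; have [N HN] := H e e0; exists N => // n /= /HN un.
have fn : u n \is a fin_num by rewrite ge0_fin_numE// (le_lt_trans un)// ltry.
by rewrite sub0r normrN ger0_norm ?fine_ge0// -lee_fin fineK.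
Qed.

Lemma supnorm_cvgP (T : R) (z : nat -> R -> 'rV[R]_d) : 0 <= T ->
  supnorm T (z n) @[n --> \oo] --> 0%E <->
  (forall e : R, 0 < e -> exists N, forall n, (N <= n)%N ->
    forall r, 0 <= r -> r <= T -> enorm (z n r) <= e).
Proof.
move=> T0; rewrite cvg0eP; last by move=> n; exact: supnorm_ge0.
split=> H e e0; have [N HN] := H e e0; exists N => n Nn.
  move=> r r0 rT; rewrite -lee_fin (le_trans _ (HN n Nn))//; exact: supnorm_ge.
by apply: supnorm_le; exact: HN.
Qed.

Lemma enorm_cauchy_cvg (z : nat -> 'rV[R]_d) :
  (forall e, 0 < e -> exists N, forall n p, (N <= n)%N -> (N <= p)%N ->
    enorm (z n - z p) <= e) ->
  exists l, forall e, 0 < e -> exists N, forall n, (N <= n)%N ->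
    enorm (z n - l) <= e.
Proof.
move=> H; have cz : cvg (z @ \oo).
  apply/cauchy_cvgP/cauchy_exP => e /= e0.
  have e20 : 0 < e / 2 by rewrite divr_gt0.
  have [N HN] := H _ e20; exists (z N), N => // n /= Nn.
  rewrite -ball_normE/=; apply: le_lt_trans (norm_le_enorm _) _.
  apply: le_lt_trans (HN N n (leqnn _) Nn) _.
  by rewrite ltr_pdivrMr// ltr_pMr// ltr1n.
exists (lim (z @ \oo)) => e e0.
have [N _ HN] := cz _ (nbhs_enorm (lim (z @ \oo)) e0).
by exists N => n Nn; apply: ltW; exact: HN.
Qed.

Lemma cvg_enorm (z : nat -> 'rV[R]_d) (l : 'rV[R]_d) : z n @[n --> \oo] --> l ->
  forall e : R, 0 < e -> exists N, forall n, (N <= n)%N -> enorm (z n - l) <= e.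
Proof.
move=> zl e e0; have [N _ HN] := zl _ (nbhs_enorm l e0).
by exists N => n Nn; apply: ltW; exact: HN.
Qed.

(** A function bounded in terms of its own supremum: if the coefficient of the
   supremum is less than one, it can be absorbed. Boundedness by [B] only
   ensures that the supremum exists. *)
Lemma sqr_self_bound (I : Type) (P : I -> Prop) (g : I -> R) (A B : R) :
  (forall i, P i -> 0 <= g i) -> (forall i, P i -> g i <= B) ->
  (forall S, (forall i, P i -> g i <= S) -> forall i, P i ->
    g i ^+ 2 <= A + S ^+ 2 / 4) ->
  forall i, P i -> g i ^+ 2 <= 2 * A.
Proof.
move=> g0 gB H i0 Pi0; pose E := [set g i | i in P].
have Esup : has_sup E.
  split; first by exists (g i0), i0.
  by exists B => _ [i Pi <-]; exact: gB.
have gS i : P i -> g i <= sup E by move=> Pi; apply: ub_le_sup;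
  [exact: Esup.2|exists i].
have S0 : 0 <= sup E by apply: le_trans (gS _ Pi0); exact: g0.
have A0 : 0 <= A + sup E ^+ 2 / 4 by apply: le_trans (H _ gS _ Pi0);
  exact: sqr_ge0.
have Sq : sup E <= Num.sqrt (A + sup E ^+ 2 / 4).
  apply: ge_sup; first exact: Esup.1.
  move=> _ [i Pi <-]; rewrite -(ger0_norm (g0 i Pi)) -sqrtr_sqr ler_sqrt//.
  exact: H gS i Pi.
have : sup E ^+ 2 <= A + sup E ^+ 2 / 4.
  rewrite -[leRHS]sqr_sqrtr// ler_pXn2r// nnegrE ?sqrtr_ge0//.
have := H _ gS _ Pi0; have := sqr_ge0 (sup E); lra.
Qed.

End UniformLimits.

Section LowerLimit.
Context {R : realType}.
Implicit Types u : nat -> \bar R.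

Lemma limn_einf_supE u : limn_einf u = ereal_sup (range (einfs u)).
Proof. by rewrite limn_einf_lim; apply/cvg_lim => //; exact: cvg_einfs_sup. Qed.

Lemma limn_einf_ge u a N : (forall n, (N <= n)%N -> (a <= u n)%E) ->
  (a <= limn_einf u)%E.
Proof.
move=> H; rewrite limn_einf_supE; apply: le_ereal_sup_tmp.
exists (einfs u N); first by exists N.
by apply: le_ereal_inf_tmp => _ [n /= Nn <-]; exact: H.
Qed.

Lemma limn_einf_le u b N : (forall n, (N <= n)%N -> (u n <= b)%E) ->
  (limn_einf u <= b)%E.
Proof.
move=> H; rewrite limn_einf_supE; apply: ge_ereal_sup => _ [n _ <-].
apply: le_trans (H (maxn n N) (leq_maxr _ _)); apply: ereal_inf_lbound.
by exists (maxn n N) => //=; exact: leq_maxl.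
Qed.

End LowerLimit.

(** * The potential and its proximal points *)
Section Skorohod.
Context {R : realType} {d : nat}.
Variables (rho gamma L delta sigma : R) (phi : 'rV[R]_d -> \bar R).
Hypothesis rho_ge0 : 0 <= rho.
Hypothesis gamma_ge0 : 0 <= gamma.
Hypothesis L_ge0 : 0 <= L.
Hypothesis delta_gt0 : 0 < delta.
Hypothesis sigma_gt0 : 0 < sigma.
Hypothesis phi_gtNy : forall v, (-oo < phi v)%E.
Hypothesis phi_lsc : lower_semicontinuous phi.
Hypothesis phi_growth : forall x y, Dom phi x -> Dom phi y ->
  (`|phi x - phi y| <= (L + L * enorm (x - y))%:E)%E.
Hypothesis phi_semiconvex : forall x xh y, frechet_subdiff phi x xh ->
  ((dot xh (y - x))%:E + phi x <=
   phi y + ((rho + gamma * enorm xh) * enorm (y - x) ^+ 2)%:E)%E.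
Hypothesis Dom_ball :
  shifted_uniform_interior_ball gamma delta sigma (Dom phi).
Local Notation D := (Dom phi).
Local Notation mu := (@lebesgue_measure R).

Definition rphi v := fine (phi v).
Local Notation f := rphi.

Lemma phiE v : D v -> phi v = (f v)%:E.
Proof. by move=> Dv; rewrite fineK// fin_real// phi_gtNy. Qed.

Lemma phiNE v : ~ D v -> phi v = +oo%E.
Proof. by move=> /negP; rewrite -leNgt leye_eq => /eqP. Qed.

Lemma rphi_growth x y : D x -> D y -> `|f x - f y| <= L + L * enorm (x - y).
Proof.
by move=> Dx Dy; rewrite -lee_fin; have := phi_growth Dx Dy; rewrite !phiE.
Qed.

Lemma rphi_lsc x a : D x -> a < f x -> exists2 e, 0 < e &
  forall y, D y -> enorm (y - x) < e -> a < f y.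
Proof.
move=> Dx afx; have [|V /nbhs_enormP[e e0 eV] Va] := phi_lsc (x := x) (a := a).
  by rewrite phiE// lte_fin.
by exists e => // y Dy /eV/Va; rewrite phiE// lte_fin.
Qed.

(** Along points of the domain converging to [x] the growth condition keeps
   [phi] bounded, while lower semicontinuity would force it to tend to infinity
   if [x] were outside the domain. *)
Lemma Dom_closed x : closure D x -> D x.
Proof.
move=> clx; apply: contrapT => NDx.
have [y1 [Dy1 xy1]] := clx _ (nbhs_enorm x ltr01).
have [|V Vx Va] := phi_lsc (x := x) (a := f y1 + L + L * 2).
  by rewrite phiNE// ltry.
have [y [Dy [xy Vy]]] := clx _ (filterI (nbhs_enorm x ltr01) Vx).
have := Va _ Vy; rewrite phiE// lte_fin; apply/negP; rewrite -leNgt.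
have := rphi_growth Dy Dy1; rewrite ler_norml => /andP[_].
have := enorm_dist_triangle x y y1; rewrite (enormBC x y1).
have /= := xy; have /= := xy1; move: L_ge0 => ? ? ? ?; nra.
Qed.

Section Prox.
Variables (h K : R) (x q : 'rV[R]_d).
Hypothesis h0 : 0 < h.
Hypothesis K0 : 0 < K.
Hypothesis Dx : D x.

Let F w := h * f w - dot q (w - x) + K * enorm (w - x) ^+ 2.

Let F_lsc w e : D w -> 0 < e -> exists2 r, 0 < r &
  forall y, D y -> enorm (y - w) < r -> F w - e < F y.
Proof.
move=> Dw e0; have [|r1 r10 H1] := @rphi_lsc w (f w - e / (2 * h)) Dw.
  by rewrite gtrBl divr_gt0// mulr_gt0.
pose M := enorm q + 2 * K * enorm (w - x) + 1.
have M0 : 0 < M by rewrite ltr_wpDl// addr_ge0 ?mulr_ge0 ?enorm_ge0// ltW.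
exists (Num.min r1 (e / (2 * M))).
  by rewrite lt_min r10 divr_gt0// mulr_gt0.
move=> y Dy; rewrite lt_min => /andP[/(H1 _ Dy) fy yw].
have qyx : dot q (y - x) = dot q (y - w) + dot q (w - x) by rewrite -dotDr
  subrKA.
rewrite /F (@enorm_sqr_dist _ _ x y w) qyx.
have fy' : h * f w - e / 2 < h * f y.
  rewrite (_ : _ - _ = h * (f w - e / (2 * h))) ?ltr_pM2l//.
  by field; rewrite gt_eqF.
have qy := dot_le_enorm q (y - w).
have wy := ler_dot (w - x) (y - w); move: wy; rewrite ler_norml => /andP[wy _].
have yw' : M * enorm (y - w) < e / 2.
  by move: yw; rewrite ltr_pdivlMr ?mulr_gt0// ltr_pdivlMr//; lra.
have := enorm_ge0 (y - w); have := enorm_ge0 (w - x).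
have : 0 <= K * enorm (y - w) ^+ 2 by rewrite mulr_ge0 ?sqr_ge0// ltW.
have : K * dot (w - x) (y - w) >= - (K * (enorm (w - x) * enorm (y - w))).
  by rewrite -mulrN ler_pM2l.
rewrite /M in yw'; lra.
Qed.

Let B := 1 + (h * L + enorm q + h * L) / K.

Let F_coercive w : D w -> B <= enorm (w - x) -> F x <= F w.
Proof.
move=> Dw Bw; rewrite /F subrr dot0r enorm0 expr0n/= mulr0 subr0 addr0.
have := rphi_growth Dw Dx; rewrite ler_norml => /andP[H _].
have := dot_le_enorm q (w - x).
have q0 := enorm_ge0 q; have hL : 0 <= h * L by rewrite mulr_ge0// ltW.
have b1 : 1 <= enorm (w - x).
  by apply: le_trans _ Bw; rewrite lerDl divr_ge0 ?(ltW K0)// !addr_ge0.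
have Kb : h * L + enorm q + h * L <= K * enorm (w - x).
  by rewrite [leRHS]mulrC -ler_pdivrMr//; apply: le_trans _ Bw; rewrite lerDr.
have : (h * L + enorm q + h * L) * enorm (w - x) <= K * enorm (w - x) ^+ 2.
  by rewrite expr2 mulrA ler_wpM2r// enorm_ge0.
have : h * (- (L + L * enorm (w - x))) <= h * (f w - f x) by rewrite ler_pM2l.
set b := enorm (w - x) in b1 *; nra.
Qed.

(** A minimiser of the proximal functional exists: the functional is coercive,
   as [phi] has linear growth, and lower semicontinuous on a compact part of
   the closed domain. *)
Lemma prox_exists : exists2 w, D w & forall y, D y -> F w <= F y.
Proof.
have B0 : 0 <= B.
  rewrite addr_ge0// divr_ge0 ?(ltW K0)// !addr_ge0 ?enorm_ge0 ?mulr_ge0//;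
    exact: ltW.
pose C := D `&` [set w | enorm (w - x) <= B].
have Cx : C x by split => //=; rewrite subrr enorm0.
have Ccl w : closure C w -> C w.
  move=> clw; split.
    by apply: Dom_closed => V /clw[y [[Dy _] Vy]]; exists y.
  apply/ler_addgt0Pr => e e0; have [y [[_ yB] /= yw]] := clw _ (nbhs_enorm w
    e0).
  apply: le_trans (enorm_dist_triangle y _ _) _.
  by rewrite addrC lerD// enormBC ltW.
have Ccpt : compact C.
  apply: bounded_closed_compact.
    exists (enorm x + B); split; first exact: num_real.
    move=> M MB w [_ /= wB]; apply: le_trans (norm_le_enorm _) _.
    rewrite -(subrK x w); apply: le_trans (enorm_triangle _ _) _.
    by rewrite addrC (le_trans _ (ltW MB))// lerD2l.
  by move=> w /Ccl.
have Flb w : C w -> F x - h * L - h * L * B - enorm q * B <= F w.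
  move=> [Dw /= wB]; rewrite /F subrr dot0r enorm0 expr0n/= mulr0 subr0 addr0.
  have := rphi_growth Dw Dx; rewrite ler_norml => /andP[H _].
  have := dot_le_enorm q (w - x).
  have : 0 <= K * enorm (w - x) ^+ 2 by rewrite mulr_ge0 ?sqr_ge0// ltW.
  have : h * (- (L + L * enorm (w - x))) <= h * (f w - f x) by rewrite ler_pM2l.
  have : enorm q * enorm (w - x) <= enorm q * B by rewrite ler_wpM2l//
    enorm_ge0.
  have : h * L * enorm (w - x) <= h * L * B.
    by rewrite ler_wpM2l// mulr_ge0// ltW.
  lra.
pose S := F @` C.
have Sinf : has_inf S.
  split; first by exists (F x), x.
  by exists (F x - h * L - h * L * B - enorm q * B) => _ [w Cw <-]; exact: Flb.
have pick n : exists w, C w /\ F w < inf S + n.+1%:R^-1.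
  have n0 : 0 < n.+1%:R^-1 :> R by rewrite invr_gt0.
  have [_ [w Cw <-] Fw] := inf_adherent n0 Sinf.
  by exists w.
have [w_ Hw] := choice pick.
have [|p [Cp clp]] := Ccpt (w_ @ \oo) _.
  by exists 0%N => // n _; exact: (Hw n).1.
have Fp y : C y -> F p <= F y.
  move=> Cy; suff : F p <= inf S.
    by move/le_trans; apply; apply: ge_inf; [exact: Sinf.2|exists y].
  apply/ler_addgt0Pr => e e0.
  have e20 : 0 < e / 2 by rewrite divr_gt0.
  have [r r0 Hr] := F_lsc Cp.1 e20.
  have A : (w_ @ \oo) [set w | C w /\ F w < inf S + e / 2].
    have := near_infty_natSinv_lt (PosNum e20); apply: filterS => n /= ne.
    by split; [exact: (Hw n).1|rewrite (lt_trans (Hw n).2)// ltrD2l].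
  have [w [[Cw Fw] /= wp]] := clp _ _ A (nbhs_enorm p r0).
  have := Hr w Cw.1 wp; lra.
exists p; first exact: Cp.1.
move=> y Dy; have [yB|/ltW yB] := leP (enorm (y - x)) B; first exact: Fp.
by apply: le_trans (Fp x Cx) _; exact: F_coercive.
Qed.

End Prox.

(** The difference quotient is at least [- c * enorm (y - w)], which tends to
   0; outside the domain it is infinite. *)
Lemma frechet_of_quadratic (w p : 'rV[R]_d) c : D w ->
  (forall y, D y -> dot p (y - w) + f w <= f y + c * enorm (y - w) ^+ 2) ->
  frechet_subdiff phi w p.
Proof.
move=> Dw H; split => //; rewrite limf_einfE; apply/lee_addgt0Pr => e e0.
rewrite -leeBlDr// sub0e; apply: le_ereal_sup_tmp.
have c0 : 0 < `|c| + 1 by rewrite ltr_wpDl.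
pose V := [set y | enorm (y - w) < e / (`|c| + 1)] `&` [set y | y != w].
exists (ereal_inf [set ((phi y - phi w - (dot p (y - w))%:E) *
    ((enorm (y - w))^-1)%:E)%E | y in V]).
  exists V => //; have := nbhs_enorm w (divr_gt0 e0 c0).
  by rewrite /dnbhs /within /=; apply: filterS => y ye yw; split.
apply: le_ereal_inf_tmp => _ [y [/= ye yw] <-].
have yw0 : 0 < enorm (y - w).
  rewrite lt_neqAle enorm_ge0 andbT eq_sym; apply: contra yw => /eqP/enorm_eq0.
  by move/eqP; rewrite subr_eq0.
have [Dy|NDy] := pselect (D y); last first.
  by rewrite (phiNE NDy) (phiE Dw)/= mulr_infty sgrV gtr0_sg// mul1e leey.
rewrite !phiE// -!EFinB -EFinM lee_fin ler_pdivlMr//.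
have := H y Dy; rewrite expr2 mulrA.
have : c * enorm (y - w) <= e.
  move: ye; rewrite ltr_pdivlMr// => /ltW; apply: le_trans.
  by rewrite mulrC ler_wpM2l ?enorm_ge0// (le_trans (ler_norm c))// lerDl.
move=> /(ler_wpM2r (ltW yw0)); lra.
Qed.


(** Collects the constants of the error terms in [prox_improve]. *)
Definition improve_cst (c : R) :=
  4 * (rho + gamma) + 16 * gamma * (c + 1) + 8 * (c + 1) + 4 * c + 1.

(** Self-improvement of the variational inequality. Here [N] bounds both [h]
   and [enorm q], so that the hypothesis is an inequality with some constant
   [c] instead of [rho] and [gamma], up to the small error [kap ^+ 2 * N]. Let
   [w] minimise the proximal functional with penalty [(c + 1) * N]: comparing
   with [x] and using the hypothesis at [w] leaves [N * enorm (w - x) ^+ 2] at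
   most of the order of the error, so [w] is within [2 * kap] of [x]. The slope
   [h^-1 *: (q - (2 * K) *: (w - x))] is a Frechet subgradient at [w], and the
   semiconvexity inequality there, transported back from [w] to [x], has the
   constants [rho] and [gamma]. *)
Lemma prox_improve (h N kap c A : R) (x q : 'rV[R]_d) :
  0 < h -> h <= N -> enorm q <= N -> 0 <= c -> 0 <= kap <= 1 -> D x ->
  h * f x <= A + kap ^+ 2 * N ->
  (forall z, D z -> dot q (z - x) + A <=
     h * f z + c * N * enorm (z - x) ^+ 2 + kap ^+ 2 * N) ->
  forall z, D z -> dot q (z - x) + A <=
    h * f z + (rho * h + gamma * enorm q) * enorm (z - x) ^+ 2
    + kap * N * improve_cst c * (1 + enorm (z - x)) ^+ 2.
Proof.
move=> h0 hN qN c0 /andP[kap0 kap1] Dx hfx H z Dz.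
have N0 : 0 < N by exact: lt_le_trans hN.
pose K := (c + 1) * N.
have K0 : 0 < K by rewrite mulr_gt0// ltr_wpDl.
have [w Dw wmin] :=
  prox_exists q h0 K0 Dx.
have := wmin x Dx; rewrite subrr dot0r enorm0 expr0n/= mulr0 subr0 addr0 => Fwx.
pose p := h^-1 *: (q - (2 * K) *: (w - x)).
have hp : h *: p = q - (2 * K) *: (w - x) by rewrite scalerA divff ?scale1r
  ?gt_eqF.
have pw : frechet_subdiff phi w p.
  apply: (@frechet_of_quadratic w p (K / h)) => // y Dy.
  have := wmin y Dy; rewrite (@enorm_sqr_dist _ _ x y w).
  have qyx : dot q (y - x) = dot q (y - w) + dot q (w - x) by rewrite -dotDr
    subrKA.
  rewrite qyx /p dotZl (dotBl q) (dotZl (2 * K)).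
  move: (dot q (y - w)) (dot (w - x) (y - w)) (enorm (y - w)) => u r c' F.
  rewrite -(ler_pM2l h0).
  have -> : h * (h^-1 * (u - 2 * K * r) + f w) = u - 2 * K * r + h * f w.
    by field; rewrite gt_eqF.
  have -> : h * (f y + K / h * c' ^+ 2) = h * f y + K * c' ^+ 2.
    by field; rewrite gt_eqF.
  lra.
set a := enorm (w - x) in Fwx.
have a0 : 0 <= a by exact: enorm_ge0.
(* The penalty exceeds by [N] the constant of the hypothesis at [w]. *)
have a2 : a ^+ 2 <= 2 * kap ^+ 2.
  rewrite -(ler_pM2r N0); have := H w Dw; rewrite -/a /K in Fwx *; lra.
have ak : a <= 2 * kap.
  rewrite -(@ler_pXn2r _ 2)// ?nnegrE ?mulr_ge0//; have := sqr_ge0 kap; nra.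
have sc : h * (dot p (z - w)) + h * f w <=
    h * f z + (rho * h + gamma * (h * enorm p)) * enorm (z - w) ^+ 2.
  have := phi_semiconvex z pw; rewrite (phiE Dw) (phiE Dz).
  rewrite -!EFinD lee_fin -(ler_pM2l h0); lra.
have hpn : h * enorm p <= enorm q + 2 * K * a.
  rewrite -{1}(gtr0_norm h0) -enormZ hp; apply: le_trans (enorm_triangle _ _) _.
  by rewrite enormN enormZ gtr0_norm// mulr_gt0.
have hpz : h * dot p (z - w) = dot q (z - w) - 2 * K * dot (w - x) (z - w).
  by rewrite -dotZl hp (dotBl q) (dotZl (2 * K)).
have qzx : dot q (z - x) = dot q (z - w) + dot q (w - x) by rewrite -dotDr
  subrKA.
have Hw := H w Dw; rewrite -/a in Hw.
set b := enorm (z - x); set t := enorm (z - w) in sc.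
have b0 : 0 <= b by exact: enorm_ge0.
have t0 : 0 <= t by exact: enorm_ge0.
have tba : t <= b + a.
  by rewrite /t (le_trans (enorm_dist_triangle x _ _))// lerD2l enormBC.
have inner : dot (w - x) (z - w) <= a * t by exact: dot_le_enorm.
have q0 := enorm_ge0 q.
have t2 : t ^+ 2 <= b ^+ 2 + 4 * kap * (b + 1).
  have : t ^+ 2 <= (b + a) ^+ 2 by rewrite ler_pXn2r// nnegrE addr_ge0.
  nra.
have t2' : t <= 2 * (b + 1) by lra.
have kapN : 0 <= kap * N by rewrite mulr_ge0// ltW.
have Ka : K * a <= 2 * (c + 1) * (kap * N).
  by have := ler_wpM2l (ltW K0) ak; rewrite /K; lra.
have e1 : (rho * h + gamma * enorm q) * t ^+ 2 <=
    (rho * h + gamma * enorm q) * b ^+ 2 + 4 * (rho + gamma) * (kap * N) * (b +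
      1).
  have r1 : rho * h + gamma * enorm q <= (rho + gamma) * N.
    by rewrite mulrDl lerD// ler_wpM2l.
  have r0 : 0 <= rho * h + gamma * enorm q by rewrite addr_ge0 ?mulr_ge0// ltW.
  apply: le_trans (ler_wpM2l r0 t2) _; rewrite mulrDr lerD2l.
  have k0 : 0 <= 4 * kap * (b + 1) by rewrite !mulr_ge0// addr_ge0.
  by apply: le_trans (ler_wpM2r k0 r1) _; lra.
have Ka0 : 0 <= K * a by rewrite mulr_ge0// ltW.
have e2 : 2 * gamma * (K * a) * t ^+ 2 <= 16 * gamma * (c + 1) * (kap * N) * (b
  + 1) ^+ 2.
  have tt : t ^+ 2 <= 4 * (b + 1) ^+ 2 by nra.
  have g0 : 0 <= 2 * gamma * (K * a) by rewrite mulr_ge0// mulr_ge0.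
  apply: le_trans (ler_wpM2l g0 tt) _.
  have g1 : 0 <= 8 * gamma * (b + 1) ^+ 2 by rewrite mulr_ge0 ?sqr_ge0//
    mulr_ge0.
  by have := ler_wpM2l g1 Ka; lra.
have e3 : 2 * (K * a) * t <= 8 * (c + 1) * (kap * N) * (b + 1).
  have g0 : 0 <= 2 * (K * a) by rewrite mulr_ge0.
  apply: le_trans (ler_wpM2l g0 t2') _.
  have g1 : 0 <= 4 * (b + 1) by rewrite mulr_ge0// addr_ge0.
  by have := ler_wpM2l g1 Ka; lra.
have k2 : kap ^+ 2 * N <= kap * N.
  by rewrite ler_wpM2r ?(ltW N0)// expr2 ler_piMr.
have e4 : c * N * a ^+ 2 <= 2 * c * (kap * N).
  have := ler_wpM2l c0 (ler_wpM2l (ltW N0) a2).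
  have := ler_wpM2l c0 k2; lra.
have e5 : 2 * (K * dot (w - x) (z - w)) <= 2 * (K * a) * t.
  by rewrite -(mulrA 2) -(mulrA K) ler_pM2l// ler_wpM2l// ltW.
have e6 : gamma * (h * enorm p) * t ^+ 2 <=
    gamma * enorm q * t ^+ 2 + 2 * gamma * (K * a) * t ^+ 2.
  have := ler_wpM2r (sqr_ge0 t) (ler_wpM2l gamma_ge0 hpn); lra.
have b1 : kap * N * (4 * (rho + gamma) + 8 * (c + 1)) * (b + 1) <=
    kap * N * (4 * (rho + gamma) + 8 * (c + 1)) * (b + 1) ^+ 2.
  rewrite ler_wpM2l//; last by rewrite expr2 ler_peMl ?addr_ge0// lerDr.
  by rewrite mulr_ge0// !(addr_ge0, mulr_ge0).
have b2 : kap * N * (4 * c + 1) <= kap * N * (4 * c + 1) * (b + 1) ^+ 2.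
  rewrite ler_peMr//; first by rewrite mulr_ge0// addr_ge0// mulr_ge0.
  by rewrite exprn_ege1// lerDr.
have c2 : 0 <= c * (kap * N) by rewrite mulr_ge0.
rewrite /improve_cst (addrC 1 b); lra.
Qed.


Lemma improve_cst_ge0 (c : R) : 0 <= c -> 0 <= improve_cst c.
Proof.
move=> c0; have := mulr_ge0 gamma_ge0 c0; have := rho_ge0; have := gamma_ge0.
rewrite /improve_cst; lra.
Qed.

(** * Integrals of the potential along paths *)
Section PathCost.
Implicit Types z y : R -> 'rV[R]_d.

Lemma phi_measurable z s t : continuous_Rplus z -> 0 <= s ->
  measurable_fun (`[s, t] : set (measurableTypeR R)) (phi \o z).
Proof.
move=> /continuous_Rplus_clamp cz s0.
have lz : lower_semicontinuous (phi \o (fun r : R => z (Num.max 0 r))).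
  move=> x a /phi_lsc[V Vx Va]; exists ((fun r : R => z (Num.max 0 r)) @^-1` V).
    exact: cz.
  by move=> y /Va.
have mz := lower_semicontinuous_measurable lz.
apply: (@eq_measurable_fun _ _ _ _ _ (phi \o (fun r : R => z (Num.max 0 r)))).
  move=> r; rewrite inE/= in_itv/= => /andP[sr _].
  by rewrite max_r// (le_trans s0).
exact: measurable_funTS.
Qed.

Definition in_Dom z (s t : R) := forall r, s <= r -> r <= t -> D (z r).

Lemma in_DomW z s t s' t' : s <= s' -> t' <= t -> in_Dom z s t -> in_Dom z s'
  t'.
Proof.
by move=> ss' tt' H r sr rt; apply: H; [exact: le_trans sr|exact: le_trans tt'].
Qed.

Lemma rphi_integrable z s t : continuous_Rplus z -> 0 <= s -> s <= t ->
  in_Dom z s t -> mu.-integrable `[s, t] (EFin \o (fun r => f (z r))).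
Proof.
move=> cz s0 st Dz; have [B B0 HB] := continuous_Rplus_bounded t cz.
apply: measurable_bounded_integrable => //.
- by rewrite [X in (X < _)%E](lebesgue_segment st) ltry.
- apply/measurable_EFinP.
  apply: (eq_measurable_fun (phi \o z)); last exact: phi_measurable.
  by move=> r; rewrite inE/= in_itv/= => /andP[sr rt]; rewrite phiE//;
    exact: Dz.
- exists (`|f (z s)| + (L + L * (B + B))); split; first exact: num_real.
  move=> M MB r; rewrite /= in_itv/= => /andP[sr rt]; apply: le_trans (ltW MB).
  rewrite -(subrK (f (z s)) (f (z r))) addrC (le_trans (ler_normD _ _))//
    lerD2l.
  have := rphi_growth (Dz r sr rt) (Dz s (lexx _) st).
  move=> /le_trans; apply; rewrite lerD2l ler_wpM2l//.
  apply: le_trans (enorm_triangle _ _) _; rewrite enormN lerD// HB//.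
  exact: le_trans sr.
Qed.

Definition path_cost z (s t : R) := \int[mu]_(r in `[s, t]) f (z r).

Lemma integral_phiE z s t : continuous_Rplus z -> 0 <= s -> s <= t ->
  in_Dom z s t -> (\int[mu]_(r in `[s, t]) phi (z r) = (path_cost z s t)%:E)%E.
Proof.
move=> cz s0 st Dz; rewrite /path_cost /Rintegral fineK; last first.
  by apply: integrable_fin_num => //; exact: rphi_integrable.
apply: eq_integral => r; rewrite inE/= in_itv/= => /andP[sr rt].
by rewrite phiE//; exact: Dz.
Qed.

Lemma path_costD z s r t : continuous_Rplus z -> 0 <= s -> s <= r -> r <= t ->
  in_Dom z s t -> path_cost z s t = path_cost z s r + path_cost z r t.
Proof.
move=> cz s0 sr rt Dz; apply: Lebesgue_itvD => //.
by apply: rphi_integrable => //; exact: le_trans rt.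
Qed.

Lemma path_cost_bounds z s t a b : continuous_Rplus z -> 0 <= s -> s <= t ->
  in_Dom z s t -> (forall r, s <= r <= t -> a <= f (z r) <= b) ->
  a * (t - s) <= path_cost z s t <= b * (t - s).
Proof.
move=> cz s0 st Dz; apply: Lebesgue_itv_bounds => //; exact: rphi_integrable.
Qed.

Lemma path_cost_dist z y s t M : continuous_Rplus z -> continuous_Rplus y ->
  0 <= s -> s <= t -> in_Dom z s t -> in_Dom y s t ->
  (forall r, s <= r <= t -> enorm (y r - z r) <= M) ->
  `|path_cost y s t - path_cost z s t| <= (L + L * M) * (t - s).
Proof.
move=> cz cy s0 st Dz Dy H.
have iz := rphi_integrable cz s0 st Dz; have iy := rphi_integrable cy s0 st Dy.
have := @Lebesgue_itv_bounds _ (fun r => f (y r) - f (z r)) s t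
  (- (L + L * M)) (L + L * M) st.
rewrite RintegralB// mulNr ler_norml; apply.
  by have := @integrableB _ _ _ mu _ _ _ _ iy iz; apply; exact: measurable_itv.
move=> r rst; have /andP[sr rt] := rst; rewrite -ler_norml.
apply: le_trans (rphi_growth (Dy r sr rt) (Dz r sr rt)) _.
by rewrite lerD2l ler_wpM2l// H.
Qed.

(** As [phi] need not be continuous on its domain, the point representing a
   short interval is not arbitrary: the value of [phi] there must not exceed
   its mean. *)
Lemma path_cost_mean z s t e : continuous_Rplus z -> 0 <= s -> s < t ->
  in_Dom z s t -> 0 < e ->
  exists2 r, s <= r <= t & (t - s) * f (z r) <= path_cost z s t + e * (t - s).
Proof.
move=> cz s0 st Dz e0; apply: contrapT => H.
have ts0 : 0 < t - s by rewrite subr_gt0.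
have [B B0 HB] := continuous_Rplus_bounded t cz.
have hb r : s <= r <= t -> path_cost z s t / (t - s) + e <= f (z r) <=
    f (z s) + (L + L * (B + B)).
  move=> rst; have /andP[sr rt] := rst; apply/andP; split.
    rewrite leNgt; apply/negP => fr; apply: H; exists r => //.
    have -> : path_cost z s t + e * (t - s) = (t - s) * (path_cost z s t / (t -
      s) + e).
      by field; rewrite gt_eqF.
    by rewrite ler_pM2l// ltW.
  have := rphi_growth (Dz r sr rt) (Dz s (lexx _) (ltW st)).
  rewrite ler_norml => /andP[_]; rewrite lerBlDl => /le_trans; apply.
  rewrite lerD2l lerD2l ler_wpM2l// (le_trans (enorm_triangle _ _))// enormN.
  by rewrite lerD// HB//; [exact: le_trans sr|exact: ltW].
have /andP[+ _] := path_cost_bounds cz s0 (ltW st) Dz hb.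
rewrite mulrDl divfK ?gt_eqF//.
by rewrite gerDl leNgt mulr_gt0.
Qed.

Lemma not_in_Dom_itv y s t : continuous_Rplus y -> 0 <= s -> s < t ->
  ~ in_Dom y s t ->
  exists a b, [/\ s <= a, a < b, b <= t & forall r, a <= r <= b -> ~ D (y r)].
Proof.
move=> cy s0 st; rewrite /in_Dom -existsNE => -[r /not_implyP[sr /not_implyP[rt
  NDr]]].
have r0 : 0 <= r by exact: le_trans sr.
have : nbhs (y r) (~` D).
  apply: open_nbhs_nbhs; split => //; rewrite openC.
  by move=> v; exact: Dom_closed v.
move=> /nbhs_enormP[e e0 He].
have /continuous_RplusP/(_ t (e / 2)) := cy.
rewrite divr_gt0// => /(_ isT)[tau tau0 Htau].
exists (Num.max s (r - tau)), (Num.min t (r + tau)); split.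
- by rewrite le_max lexx.
- by rewrite lt_min !gt_max st; lra.
- by rewrite ge_min lexx.
move=> u; rewrite ge_max le_min => /andP[/andP[su ru] /andP[ut ur]].
apply: He; apply: (@le_lt_trans _ _ (e / 2));
  last by rewrite ltr_pdivrMr// ltr_pMr// ltr1n.
have [xu|ux] := leP r u; first by apply: Htau => //; lra.
by rewrite enormBC; apply: Htau => //; [exact: le_trans su|exact: ltW|lra].
Qed.

(** A test path leaving the closed domain stays outside during an interval, and
   [phi] is bounded below along it; such a path makes the variational
   inequality trivial. *)
Lemma integral_phi_infty y s t : continuous_Rplus y -> 0 <= s -> s < t ->
  ~ in_Dom y s t -> (\int[mu]_(r in `[s, t]) phi (y r) = +oo)%E.
Proof.
move=> cy s0 st NDy.
have [a [b [sa ab bt Hab]]] := not_in_Dom_itv cy s0 st NDy.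
have [B B0 HB] := continuous_Rplus_bounded t cy.
have my := phi_measurable (t := t) cy s0.
have [M HM] : exists M : R, forall r, s <= r <= t -> (M%:E <= phi (y r))%E.
  have [[r0 r0st Dr0]|ND] := pselect (exists2 r0, s <= r0 <= t & D (y r0)).
    exists (f (y r0) - (L + L * (B + B))) => r /andP[sr rt].
    have [Dr|NDr] := pselect (D (y r)); last by rewrite phiNE// leey.
    rewrite phiE// lee_fin.
    have := rphi_growth Dr Dr0.
    rewrite ler_norml => /andP[+ _].
    have : L * enorm (y r - y r0) <= L * (B + B).
      rewrite ler_wpM2l// (le_trans (enorm_triangle _ _))// enormN.
      move: r0st => /andP[? ?].
      by rewrite lerD// HB// (le_trans s0).
    lra.
  exists 0 => r rst; rewrite phiNE ?leey// => Dr; apply: ND; by exists r.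
have pos_infty : (\int[mu]_(r in `[s, t]) (fun r => phi (y r))^\+ r = +oo)%E.
  apply/eqP; rewrite -leye_eq.
  have <- : (\int[mu]_(r in `[a, b]) (fun r => phi (y r))^\+ r = +oo)%E.
    rewrite (eq_integral (cst +oo%E)); last first.
      move=> r; rewrite inE/= in_itv/= => /Hab NDr.
      by rewrite funeposE phiNE// max_l// leey.
    rewrite integral_cst// [X in (_ * X)%E](lebesgue_segment (ltW ab)).
    by rewrite mulyr gtr0_sg ?mul1e// subr_gt0.
  apply: ge0_subset_integral => //.
  - exact: measurable_funepos.
  - by move=> r /=; rewrite !in_itv/= => /andP[ar rb];
    rewrite (le_trans sa ar) (le_trans rb).
have neg_fin : (\int[mu]_(r in `[s, t]) (fun r => phi (y r))^\- r < +oo)%E.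
  apply: (@le_lt_trans _ _ (\int[mu]_(r in `[s, t]) (cst `|M|%:E r))%E).
    apply: ge0_le_integral => //; first exact: measurable_funeneg.
    move=> r; rewrite /= in_itv/= => /HM Mr.
    rewrite funenegE ge_max lee_fin normr_ge0 andbT leeNl.
    by apply: le_trans Mr; rewrite -EFinN lee_fin lerNl -normrN ler_norm.
  rewrite integral_cst// [X in (_ * X)%E](lebesgue_segment (ltW st)).
  by rewrite -EFinM ltry.
rewrite integralE pos_infty addye// -ltNye lteNr.
by rewrite (lt_le_trans neg_fin).
Qed.

(** Inside the domain all terms are finite, and the variational inequality is
   one between real numbers. *)
Lemma skorohod_real x k y s t :
  continuous_Rplus x -> continuous_Rplus y -> BV_loc k -> continuous_Rplus k ->
  0 <= s -> s <= t -> in_Dom x s t -> in_Dom y s t ->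
  skorohod_ineq rho gamma phi x k y s t <->
  dot_integral s t (fun r => y r - x r) k + path_cost x s t <= path_cost y s t +
    (rho * \int[mu]_(r in `[s, t]) (enorm (y r - x r) ^+ 2) +
     gamma * \int[dVar k]_(r in `[s, t]) (enorm (y r - x r) ^+ 2)).
Proof.
move=> cx cy kBV kc s0 st Dx Dy; rewrite /skorohod_ineq !integral_phiE//.
have cq := continuous_enorm_sqr (continuous_RplusB cy cx).
rewrite -[X in (rho%:E * X)%E]fineK; last first.
  by apply: integrable_fin_num => //; exact: Lebesgue_integrable.
rewrite -[X in (gamma%:E * X)%E]fineK; last first.
  by apply: integrable_fin_num => //; exact: dVar_integrable.
by rewrite -!EFinM -!EFinD lee_fin.
Qed.


Lemma path_cost_shift z s t M : continuous_Rplus z -> 0 <= s -> s <= t ->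
  in_Dom z s t ->
  (\int[mu]_(r in `[s, t]) (f (z r) + M)%:E = (path_cost z s t + M * (t -
    s))%:E)%E.
Proof.
move=> cz s0 st Dz.
have iz := rphi_integrable cz s0 st Dz.
have ic : mu.-integrable `[s, t] (EFin \o cst M : R -> \bar R).
  apply: measurable_bounded_integrable => //; last exact: bounded_cst.
  by rewrite [X in (X < _)%E](lebesgue_segment st) ltry.
have id : mu.-integrable `[s, t] (fun r => (f (z r) + M)%:E).
  by have := @integrableD _ _ _ mu _ _ _ _ iz ic; apply; exact: measurable_itv.
rewrite -[LHS]fineK; last exact: integrable_fin_num.
congr EFin; rewrite -/(Rintegral _ _ _) RintegralD//; congr (_ + _).
by rewrite Rintegral_cst// [X in fine X](lebesgue_segment st).
Qed.

(** Fatou's lemma for the functions [phi (zn n)], shifted by a constant that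
   makes them nonnegative. The conclusion for infinitely many [n] suffices, as
   all other quantities will converge. *)
Lemma path_cost_fatou (zn : nat -> R -> 'rV[R]_d) (z : R -> 'rV[R]_d) s t :
  (forall n, continuous_Rplus (zn n)) -> continuous_Rplus z ->
  0 <= s -> s <= t -> (forall n, in_Dom (zn n) s t) -> in_Dom z s t ->
  (forall e : R, 0 < e -> exists N, forall n, (N <= n)%N ->
     forall r, s <= r <= t -> enorm (zn n r - z r) <= e) ->
  forall (e : R) N, 0 < e -> exists2 n, (N <= n)%N & path_cost z s t <=
    path_cost (zn n) s t + e.
Proof.
move=> czn cz s0 st Dzn Dz unif e N e0; apply: contrapT => H.
have {}H n : (N <= n)%N -> path_cost (zn n) s t < path_cost z s t - e.
  move=> Nn; rewrite ltNge; apply/negP => le; apply: H; exists n => //.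
  by rewrite -lerBlDr.
have [N1 HN1] := unif 1 ltr01.
have [B B0 HB] := continuous_Rplus_bounded t cz.
pose M := `|f (z s)| + L + L * (1 + B + B).
have sst : s <= s <= t by rewrite lexx.
have lb n r : (N1 <= n)%N -> s <= r <= t -> 0 <= f (zn n r) + M.
  move=> n1 /[dup] rst /andP[sr rt].
  have := rphi_growth (Dzn n r sr rt) (Dz s (lexx _) st).
  rewrite ler_norml => /andP[+ _].
  have : enorm (zn n r - z s) <= 1 + B + B.
    rewrite (le_trans (enorm_dist_triangle (z r) _ _))// -addrA lerD ?HN1//.
    rewrite (le_trans (enorm_triangle _ _))// enormN lerD ?HB//.
    exact: le_trans sr.
  move=> /(ler_wpM2l L_ge0); have := ler_norm (- f (z s)); rewrite normrN /M;
    lra.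
pose g n r := (f (zn (n + N1)%N r) + M)%:E.
have mg n : measurable_fun (`[s, t] : set (measurableTypeR R)) (g n).
  have := rphi_integrable (@czn (n + N1)%N) s0 st (@Dzn (n + N1)%N).
  case/integrableP => /measurable_EFinP mf _; apply/measurable_EFinP.
  by apply: measurable_funD.
have g0 n r : `[s, t]%classic r -> (0 <= g n r)%E.
  by rewrite /= in_itv/= => rst; rewrite lee_fin lb// leq_addl.
have := fatou mu (measurable_itv `[s, t]) mg g0.
apply/negP; rewrite -ltNge.
apply: (@le_lt_trans _ _ (path_cost z s t - e + M * (t - s))%:E).
  apply: (@limn_einf_le _ _ _ N) => n Nn.
  rewrite /g path_cost_shift// lee_fin lerD2r ltW// H//.
  exact: leq_trans (leq_addr _ _).
apply: (@lt_le_trans _ _ (path_cost z s t + M * (t - s))%:E).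
  by rewrite lte_fin ltrD2r gtrBl.
rewrite -path_cost_shift//; apply: ge0_le_integral => //.
- move=> r; rewrite /= in_itv/= => rst; rewrite lee_fin.
  have := ler_norm (- f (z s)); rewrite normrN.
  have /andP[sr rt] := rst.
  have := rphi_growth (Dz r sr rt) (Dz s (lexx _) st).
  rewrite ler_norml => /andP[+ _].
  have : enorm (z r - z s) <= 1 + B + B.
    rewrite (le_trans (enorm_triangle _ _))// enormN -addrA ler_wpDl// lerD
      ?HB//.
    exact: le_trans sr.
  move=> /(ler_wpM2l L_ge0); rewrite /M; lra.
- have := rphi_integrable cz s0 st Dz.
  case/integrableP => /measurable_EFinP mf _; apply/measurable_EFinP.
  by apply: measurable_funD.
- apply/measurableT_comp => //; apply: measurable_fun_limn_esup => n.
  by apply/measurableT_comp => //; exact: mg.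
move=> r; rewrite /= in_itv/= => /[dup] rst /andP[sr rt].
apply/lee_addgt0Pr => e' e'0; rewrite -leeBlDr// -EFinB.
have [|r' r'0 Hr'] := @rphi_lsc (z r) (f (z r) - e') (Dz r sr rt).
  by rewrite gtrBl.
have r'20 : 0 < r' / 2 by rewrite divr_gt0.
have [N2 HN2] := unif _ r'20.
apply: (@limn_einf_ge _ _ _ N2) => n n2; rewrite lee_fin.
have := Hr' (zn (n + N1)%N r) (@Dzn (n + N1)%N r sr rt) _.
have zr : enorm (zn (n + N1)%N r - z r) < r'.
  apply: le_lt_trans (HN2 _ _ r rst) _; first exact: leq_trans (leq_addr _ _).
  by rewrite ltr_pdivrMr// ltr_pMr// ltr1n.
move=> /(_ zr); lra.
Qed.


End PathCost.

(** * A priori estimates for one solution *)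

Definition drift_cst := 3 * L + 4 * rho.

Lemma drift_cst_ge0 : 0 <= drift_cst.
Proof. by rewrite addr_ge0// mulr_ge0. Qed.

Lemma solution_in_Dom x0 m x k s t : skorohod_solution rho gamma phi x0 m x k ->
  0 <= s -> in_Dom x s t.
Proof.
move=> S s0 r sr rt; apply: (Dom_closed).
by apply: (sp_domain S); exact: le_trans sr.
Qed.

(** The form in which the variational inequality is used: with the quadratic
   terms replaced by their bounds, only the integral against [k] remains to be
   computed for the test path at hand. *)
Lemma solution_test x0 m x k y s t c : skorohod_solution rho gamma phi x0 m x k
  ->
  continuous_Rplus y -> 0 <= s -> s <= t -> in_Dom y s t ->
  (forall r, s <= r <= t -> enorm (y r - x r) <= c) ->
  dot_integral s t (fun r => y r - x r) k + path_cost x s t <=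
    path_cost y s t + c ^+ 2 * (rho * (t - s) + gamma * (evar k t - evar k s)).
Proof.
move=> S cy s0 st Dy yx.
have [cx kc kBV] := And3 (sp_continuous_x S) (sp_continuous_k S) (sp_BV S).
have Dx := solution_in_Dom (t := t) S s0.
have := sp_ineq S s0 st cy.
move=> /(skorohod_real cx cy kBV kc s0 st Dx Dy).
move=> /le_trans; apply; rewrite lerD2l.
have cq := continuous_enorm_sqr (continuous_RplusB cy cx).
have c0 : 0 <= c by apply: le_trans (enorm_ge0 _) (yx s _); rewrite lexx.
have b r : s <= r <= t -> 0 <= enorm (y r - x r) ^+ 2 <= c ^+ 2.
  by move=> /yx H; rewrite sqr_ge0/= ler_pXn2r// nnegrE enorm_ge0.
have /andP[_ H1] := Lebesgue_itv_bounds st (Lebesgue_integrable s0 st cq) b.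
have /andP[_ H2] := dVar_integral_bounds kBV kc cq s0 st b.
have := ler_wpM2l rho_ge0 H1; have := ler_wpM2l gamma_ge0 H2.
move: (Rintegral _ _ _) (Rintegral _ _ _) => ? ?; lra.
Qed.

(** While the path stays within [delta] of its starting point, the interior
   ball condition lets it be pushed by [v + lam *: u] for every [u] in the unit
   ball. The direction of the increment of [k] on a subinterval makes [lam]
   times this increment appear; on the right the variation comes with the
   factor [gamma * (enorm v + lam) ^+ 2], and [sigma] bounds the difference
   from below. The path moves with [x], so that its difference to [x] is
   constant and its integral against [k] is explicit. *)
Lemma variation_estimate x0 m x k s t :
  skorohod_solution rho gamma phi x0 m x k -> 0 <= s -> s <= t ->
  (forall r, s <= r <= t -> enorm (x r - x s) <= delta) ->
  sigma * (evar k t - evar k s) <= enorm (k t - k s) + drift_cst * (t - s).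
Proof.
move=> S s0 st xd.
have [cx kc kBV] := And3 (sp_continuous_x S) (sp_continuous_k S) (sp_BV S).
have Dx := solution_in_Dom (t := t) S s0.
have [lam [v [/andP[lam0 lam1] v1 sig ball]]] := Dom_ball (Dx s (lexx _) st).
have v0 := enorm_ge0 v.
have push a b : s <= a -> a <= b -> b <= t ->
    lam * enorm (k b - k a) + dot v (k b - k a) <=
    drift_cst * (b - a) + (enorm v + lam) ^+ 2 * gamma * (evar k b - evar k a).
  move=> sa ab bt; have a0 : 0 <= a by exact: le_trans sa.
  set D' := k b - k a.
  have [u u1 uD] : exists2 u, enorm u <= 1 & dot u D' = enorm D'.
    have [D0|D0] := eqVneq (enorm D') 0.
      by exists 0; rewrite ?enorm0// dot0l D0.
    have Dp : 0 < enorm D' by rewrite lt_neqAle eq_sym D0 enorm_ge0.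
    exists ((enorm D')^-1 *: D').
      by rewrite enormZ gtr0_norm ?invr_gt0// mulVf.
    by rewrite dotZl -enorm_sqr expr2 mulrA mulVf// mul1r.
  pose c := v + lam *: u.
  have cn : enorm c <= enorm v + lam.
    rewrite (le_trans (enorm_triangle _ _))// lerD2l enormZ gtr0_norm//.
    by rewrite ler_piMr// ltW.
  (* The double negation is the form to which [continuous_RplusB] applies. *)
  pose y r := x r - - c.
  have cy : continuous_Rplus y.
    by apply: continuous_RplusB => //; exact: continuous_Rplus_cst.
  have yx r : y r - x r = c by rewrite /y opprK addrC addKr.
  have Dy : in_Dom y a b.
    move=> r ar rb; have srt : s <= r <= t by rewrite (le_trans sa ar)
      (le_trans rb).
    have /andP[sr rt] := srt.
    apply: (ball (x r)); [exact: Dx|exact: xd|].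
    rewrite /y /c opprK /ecball/=.
    have -> : x r + (v + lam *: u) - (x r + v) = lam *: u.
      by apply/matrixP => i j; rewrite !mxE; ring.
    by rewrite enormZ gtr0_norm// ler_piMr// ltW.
  have cxn r : a <= r <= b -> enorm (y r - x r) <= enorm c by rewrite yx.
  have := solution_test S cy a0 ab Dy cxn.
  have zz r : a <= r <= b -> enorm ((y r - x r) - c) <= 0.
    by rewrite yx subrr enorm0.
  have := dot_integral_approx kBV kc (continuous_RplusB cy cx) a0 ab zz.
  rewrite mul0r mulr0 normr_le0 subr_eq0 => /eqP ->.
  have := path_cost_dist cx cy a0 ab
    (in_DomW sa bt Dx) Dy cxn.
  rewrite ler_norml => /andP[_]; rewrite -/D' /c dotDl dotZl uD -/c.
  have c2 : enorm c <= 2 by lra.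
  have := ler_wpM2r (_ : 0 <= b - a) (ler_wpM2l L_ge0 c2).
  rewrite subr_ge0 => /(_ ab).
  have cc : enorm c ^+ 2 <= (enorm v + lam) ^+ 2.
    by rewrite ler_pXn2r// nnegrE ?enorm_ge0// addr_ge0// ltW.
  have c4 : enorm c ^+ 2 <= 4 by have := enorm_ge0 c; nra.
  have := ler_wpM2r (_ : 0 <= rho * (b - a)) c4.
  rewrite mulr_ge0 ?subr_ge0// => /(_ isT).
  have := ler_wpM2r (_ : 0 <= gamma * (evar k b - evar k a)) cc.
  rewrite mulr_ge0 ?subr_ge0 ?(evar_nd kBV)// => /(_ isT).
  rewrite /drift_cst; move: (path_cost _ _ _) (path_cost _ _ _) => ? ?; lra.
pose G r := (drift_cst * r + (enorm v + lam) ^+ 2 * gamma * evar k r - dot v (k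
  r)) / lam.
have := @evar_le _ _ k kBV G s t s0 st.
have GB a b : G b - G a = (drift_cst * (b - a) +
    (enorm v + lam) ^+ 2 * gamma * (evar k b - evar k a) - dot v (k b - k a)) /
      lam.
  by rewrite /G dotBr -mulrBl; congr (_ / _); ring.
have GH s' t' : s <= s' -> s' <= t' -> t' <= t ->
    enorm (k t' - k s') <= G t' - G s'.
  move=> ss st' tt; rewrite GB ler_pdivlMr// mulrC.
  by have := push s' t' ss st' tt; lra.
move=> /(_ GH); rewrite GB ler_pdivlMr//.
have := ler_norm (- dot v (k t - k s)); rewrite normrN.
move=> /le_trans/(_ (ler_dot _ _)).
have : enorm v * enorm (k t - k s) <= enorm (k t - k s).
  by rewrite ler_piMl ?enorm_ge0.
have := ler_wpM2r (_ : 0 <= evar k t - evar k s) sig.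
rewrite subr_ge0 (evar_nd kBV)// => /(_ isT).
lra.
Qed.

(** The path is tested against its frozen position [x s]. Since [x] and [k] add
   up to [m], up to a constant, [x s - x r] is [k r - k s] up to the
   oscillation of [m], and the integral against [k] is half of [enorm (k t - k
   s) ^+ 2]. *)
Lemma oscillation_estimate x0 m x k s t om e : continuous_Rplus m ->
  skorohod_solution rho gamma phi x0 m x k -> 0 <= s -> s <= t ->
  (forall r, s <= r <= t -> enorm (x r - x s) <= e) ->
  (forall r, s <= r <= t -> enorm (m r - m s) <= om) ->
  enorm (k t - k s) ^+ 2 / 2 <= om * (evar k t - evar k s) + (L + L * e) * (t -
    s)
    + e ^+ 2 * (rho * (t - s) + gamma * (evar k t - evar k s)).
Proof.
move=> cm S s0 st xe mom.
have [cx kc kBV] := And3 (sp_continuous_x S) (sp_continuous_k S) (sp_BV S).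
have Dx := solution_in_Dom (t := t) S s0.
have cc := @continuous_Rplus_cst R d.
have Dy : in_Dom (fun=> x s) s t by move=> r _ _; exact: Dx.
have xe' r : s <= r <= t -> enorm (x s - x r) <= e by move/xe; rewrite enormBC.
have := solution_test S (cc (x s)) s0 st Dy xe'.
have := path_cost_dist cx (cc (x s)) s0 st Dx Dy xe'.
rewrite ler_norml => /andP[_].
have := @square_chain_rule_le _ _ k (fun=> k s) kBV kc (BV_loc_cst (k s)) (cc
  (k s))
  (fun r => m r - m s) s t om (continuous_RplusB cm (cc (m s))) s0 st mom.
rewrite (evar_cst (k s) s0 st) subrr enorm0 expr0n/= subr0 addr0.
have xk r : 0 <= r -> x r + k r = x0 + m r by exact: (sp_equation S).
have gE r : s <= r <= t -> k r - k s - (m r - m s) = x s - x r.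
  move=> /andP[sr rt]; have r0 : 0 <= r by exact: le_trans sr.
  have -> : k r = x0 + m r - x r by rewrite -xk// addrC addKr.
  have -> : k s = x0 + m s - x s by rewrite -xk// addrC addKr.
  by apply/matrixP => i j; rewrite !mxE; ring.
rewrite (eq_dot_integral k gE).
have -> : dot_integral s t (fun r => k r - k s - (m r - m s)) (fun=> k s) = 0.
  have [B B0 HB] := continuous_Rplus_bounded t
    (continuous_RplusB (continuous_RplusB kc (cc (k s)))
      (continuous_RplusB cm (cc (m s)))).
  have := @dot_integral_approx _ _ _ (BV_loc_cst (k s)) (cc (k s)) _ s t 0 B
    (continuous_RplusB (continuous_RplusB kc (cc (k s)))
      (continuous_RplusB cm (cc (m s)))) s0 st.
  rewrite (evar_cst (k s) s0 st) !mulr0 dot0l subr0 normr_le0 => H; apply/eqP/H.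
  by move=> r /andP[sr rt]; rewrite subr0; apply: HB => //; exact: le_trans sr.
move: (path_cost _ _ _) (path_cost _ _ _) (dot_integral _ _ _ _) => ? ? ?; lra.
Qed.

(** The largest oscillation for which [equicontinuity] works: its cube, times
   [gamma / sigma], must be a small part of its square. *)
Definition radius_cst := Num.min delta (Num.min 1 (sigma / (64 * (gamma + 1)))).

(** For an oscillation [e] of [x], the time and the oscillation of [m] must be
   at most [rate_cst * e ^+ 2]; the second bound keeps the sum of all terms of
   [oscillation_estimate] other than the cubic one below [e ^+ 2 / 64]. *)
Definition rate_cst := Num.min 8^-1 (64 * (2 + drift_cst + 2 * L * sigma
  + rho * sigma + gamma * (1 + drift_cst) + sigma) / sigma)^-1.

Lemma rate_cst_gt0 : 0 < rate_cst.
Proof.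
rewrite lt_min invr_gt0 ltr0n/= invr_gt0 divr_gt0// mulr_gt0//.
by rewrite ltr_wpDl// !(addr_ge0, mulr_ge0)// ?drift_cst_ge0// ltW.
Qed.

Lemma radius_cst_gt0 : 0 < radius_cst.
Proof.
by rewrite !lt_min delta_gt0 ltr01 divr_gt0// mulr_gt0// ltr_wpDl.
Qed.

(** Here [K] stands for [enorm (k t - k s)], [X] for [enorm (x t - x s)], [V]
   for the variation and [h] for the time. If [X] were larger than [e / 2], [K]
   would be at least [3 / 8 * e] and the left-hand side of the quadratic
   inequality at least [9 / 128 * e ^+ 2], whereas the right-hand side is at
   most [e ^+ 2 / 32]. *)
Let equicontinuity_arith (e h K V X : R) : 0 < e /\ e <= 1 ->
  e <= sigma / (64 * (gamma + 1)) -> 0 <= V -> 0 <= h ->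
  h <= rate_cst * e ^+ 2 -> 0 <= K ->
  sigma * V <= K + drift_cst * h ->
  K ^+ 2 / 2 <= rate_cst * e ^+ 2 * V + (L + L * e) * h
    + e ^+ 2 * (rho * h + gamma * V) ->
  K <= rate_cst * e ^+ 2 + e -> X <= rate_cst * e ^+ 2 + K -> X <= e / 2.
Proof.
move=> [e0 e1] es V0 h0 h1 K0 E1 E2 k1 k2.
have C0 := drift_cst_ge0; have eta0 := rate_cst_gt0.
have eta8 : rate_cst <= 8^-1 by rewrite ge_min lexx.
pose Q := 2 + drift_cst + 2 * L * sigma + rho * sigma + gamma * (1 + drift_cst).
have Q0 : 0 <= Q by rewrite !(addr_ge0, mulr_ge0)// ltW.
have etaQ : rate_cst * (64 * (Q + sigma)) <= sigma.
  have Qs : 0 < 64 * (Q + sigma) by rewrite mulr_gt0// ltr_wpDl.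
  rewrite -ler_pdivlMr// -invf_div -/Q.
  by rewrite /rate_cst -/drift_cst ge_min lexx orbT.
move: etaQ eta8 eta0 h1 E2 k1 k2; move: rate_cst => eta etaQ eta8 eta0.
have e2 : e ^+ 2 <= e by rewrite expr2 ler_piMr// ltW.
have e20 : 0 < e ^+ 2 by rewrite exprn_gt0.
set om := eta * e ^+ 2 => h1 E2 k1 k2.
have om0 : 0 < om by rewrite mulr_gt0.
have om8 : om <= e / 8.
  rewrite /om mulrC (le_trans (ler_wpM2l (ltW e20) eta8))//.
  by rewrite ler_wpM2r.
have omQ : om * Q <= sigma * e ^+ 2 / 64.
  have : eta * Q * 64 <= sigma by have := mulr_gt0 eta0 sigma_gt0; lra.
  by move=> /(ler_wpM2r (ltW e20)); rewrite /om; lra.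
have g3 : gamma * e <= sigma / 64.
  have g1 : 0 < gamma + 1 by rewrite ltr_wpDl.
  move: es; rewrite ler_pdivlMr ?mulr_gt0//; nra.
rewrite leNgt; apply/negP => eX.
have K38 : 3 / 8 * e <= K by lra.
have K2 : 9 / 64 * e ^+ 2 <= K ^+ 2.
  by rewrite (_ : 9 / 64 * e ^+ 2 = (3 / 8 * e) ^+ 2);
    [rewrite ler_pXn2r// nnegrE mulr_ge0// ltW|field].
have sV : sigma * V <= e + (1 + drift_cst) * om.
  have := ler_wpM2l C0 h1; lra.
have sV2 : sigma * V <= 2 + drift_cst.
  have om1 : om <= 1 by lra.
  have := ler_wpM2l C0 om1; lra.
have T1 : om * (sigma * V) <= om * (2 + drift_cst) by rewrite ler_pM2l.
have T2 : (L + L * e) * (sigma * h) <= 2 * L * sigma * om.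
  have sh : sigma * h <= sigma * om by rewrite ler_pM2l.
  have Le : L + L * e <= 2 * L by have := ler_wpM2l L_ge0 e1; lra.
  have sh0 : 0 <= sigma * h by rewrite mulr_ge0// ltW.
  have := ler_wpM2r sh0 Le; have := ler_wpM2l L_ge0 sh; lra.
have T3 : e ^+ 2 * (rho * (sigma * h)) <= rho * sigma * om.
  have sh : sigma * h <= sigma * om by rewrite ler_pM2l.
  have r0 : 0 <= rho * (sigma * h) by rewrite !mulr_ge0// ltW.
  have e21 : e ^+ 2 <= 1 by lra.
  have := ler_wpM2r r0 e21; have := ler_wpM2l rho_ge0 sh; lra.
have T4 : e ^+ 2 * (gamma * (sigma * V)) <= sigma * e ^+ 2 / 64 + gamma * (1 +
  drift_cst) * om.
  have ge : 0 <= gamma * e ^+ 2 by rewrite mulr_ge0// ltW.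
  have := ler_wpM2l ge sV.
  have := ler_wpM2l (ltW e20) g3.
  have gC : 0 <= gamma * (1 + drift_cst) * om.
    by rewrite mulr_ge0 ?(ltW om0)// mulr_ge0// addr_ge0.
  have e21 : e ^+ 2 <= 1 by lra.
  have := ler_wpM2l gC e21; lra.
have := ler_wpM2l (ltW sigma_gt0) E2; have := ler_wpM2l (ltW sigma_gt0) K2.
have : 0 < sigma * e ^+ 2 by rewrite mulr_gt0.
rewrite /Q in omQ; lra.
Qed.

(** A bootstrap: while [x] stays within [e] of [x s], the estimates confine it
   to [e / 2], and a short step cannot lead from [e / 2] beyond [e]. Hence [x]
   never gets there, and its modulus of continuity is governed by that of [m].
   *)
Lemma equicontinuity x0 m x k s t e : continuous_Rplus m ->
  skorohod_solution rho gamma phi x0 m x k -> 0 < e <= radius_cst ->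
  0 <= s -> s <= t -> t - s <= rate_cst * e ^+ 2 ->
  (forall r, s <= r <= t -> enorm (m r - m s) <= rate_cst * e ^+ 2) ->
  forall r, s <= r <= t -> enorm (x r - x s) <= e / 2.
Proof.
rewrite /radius_cst !le_min => cm S /andP[e0 /and3P[ed e1 es]] s0 st ts mom.
have [cx kc kBV] := And3 (sp_continuous_x S) (sp_continuous_k S) (sp_BV S).
have e20 : 0 < e / 2 by rewrite divr_gt0.
(* Steps of length [tau] move [x] by at most [e / 2]. *)
have [tau tau0 Htau] := (continuous_RplusP x).1 cx t (e / 2) e20.
suff : forall r, s <= r -> r <= t -> enorm (x r - x s) <= e / 2.
  by move=> H r /andP[]; exact: H.
move=> rr srr rrt.
apply: (@step_ind _ (fun r => forall r', s <= r' -> r' <= r ->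
  enorm (x r' - x s) <= e / 2) s t tau) => //.
  move=> r' sr' r's; have -> : r' = s by apply/le_anti/andP.
  by rewrite subrr enorm0 divr_ge0// ltW.
move=> r r1 sr rr1 r1t r1r IH.
have near r' : s <= r' -> r' <= r1 -> enorm (x r' - x s) <= e.
  move=> sr' r'r1; have [r'r|/ltW rr'] := leP r' r.
    by rewrite (le_trans (IH r' sr' r'r))// ler_pdivrMr// ler_peMr ?(ltW e0)//
      ler1n.
  rewrite (le_trans (enorm_dist_triangle (x r) _ _))// [e]splitr lerD ?IH//.
  apply: Htau => //; [exact: le_trans sr|exact: le_trans r'r1 r1t|].
  by rewrite (le_trans _ r1r)// lerD2r.
move=> r' sr' r'r1; have r't := le_trans r'r1 r1t.
have nearr u : s <= u <= r' -> enorm (x u - x s) <= e.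
  by move=> /andP[su ur]; apply: near => //; exact: le_trans r'r1.
have mr u : s <= u <= r' -> enorm (m u - m s) <= rate_cst * e ^+ 2.
  by move=> /andP[su ur]; apply: mom; rewrite su (le_trans ur).
have neard u : s <= u <= r' -> enorm (x u - x s) <= delta.
  by move/nearr => /le_trans; apply.
have E1 := variation_estimate S s0 sr' neard.
have E2 := oscillation_estimate cm S s0 sr' nearr mr.
have xk u : 0 <= u -> x u + k u = x0 + m u by exact: (sp_equation S).
have r'0 : 0 <= r' by exact: le_trans sr'.
have dk : k r' - k s = (m r' - m s) - (x r' - x s).
  have -> : k r' = x0 + m r' - x r' by rewrite -xk// addrC addKr.
  have -> : k s = x0 + m s - x s by rewrite -xk// addrC addKr.
  by apply/matrixP => i j; rewrite !mxE; ring.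
have mm := mr r' (introT andP (conj sr' (lexx _))).
have xx := nearr r' (introT andP (conj sr' (lexx _))).
have k1 : enorm (k r' - k s) <= rate_cst * e ^+ 2 + e.
  by rewrite dk (le_trans (enorm_triangle _ _))// enormN lerD.
have k2 : enorm (x r' - x s) <= rate_cst * e ^+ 2 + enorm (k r' - k s).
  have -> : x r' - x s = (m r' - m s) - (k r' - k s).
    by rewrite dk; apply/matrixP => i j; rewrite !mxE; ring.
  by rewrite (le_trans (enorm_triangle _ _))// enormN lerD.
have h1 : r' - s <= rate_cst * e ^+ 2 by rewrite (le_trans _ ts)// lerD2r.
have V0 : 0 <= evar k r' - evar k s by rewrite subr_ge0 evar_nd.
have h0 : 0 <= r' - s by rewrite subr_ge0.
have K0 := enorm_ge0 (k r' - k s).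
apply: (equicontinuity_arith (conj e0 e1) es V0 h0 h1 K0 E1 E2 k1 k2).
Qed.


(** * Comparison of two solutions *)
Section Stability.
Variables (x0 x0' : 'rV[R]_d) (m m' x x' k k' : R -> 'rV[R]_d).
Hypothesis S : skorohod_solution rho gamma phi x0 m x k.
Hypothesis S' : skorohod_solution rho gamma phi x0' m' x' k'.
Hypotheses (cm : continuous_Rplus m) (cm' : continuous_Rplus m').

Local Notation u r := (k r - k' r).
Local Notation data r := (x0 - x0' + (m r - m' r)).

(** Each solution is tested against the other one; the integrals of [phi]
   cancel in the sum. *)
Lemma comparison s t om c : 0 <= s -> s <= t ->
  (forall r, s <= r <= t -> enorm (data r) <= om) ->
  (forall r, s <= r <= t -> enorm (x r - x' r) <= c) ->
  (enorm (u t) ^+ 2 - enorm (u s) ^+ 2) / 2 <=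
    om * (evar k t - evar k s + (evar k' t - evar k' s)) +
    c ^+ 2 * (2 * rho * (t - s) + gamma * (evar k t - evar k s + (evar k' t -
      evar k' s))).
Proof.
move=> s0 st Hom Hc.
have [cx kc kBV] := And3 (sp_continuous_x S) (sp_continuous_k S) (sp_BV S).
have [cx' kc' kBV'] := And3 (sp_continuous_x S') (sp_continuous_k S') (sp_BV
  S').
have Dx := solution_in_Dom (t := t) S s0.
have Dx' := solution_in_Dom (t := t) S' s0.
have Hc' r : s <= r <= t -> enorm (x' r - x r) <= c by move=> /Hc;
  rewrite enormBC.
have := solution_test S cx' s0 st Dx' Hc'.
have := solution_test S' cx s0 st Dx Hc.
have cM : continuous_Rplus (fun r => data r).
  have cc := @continuous_Rplus_cst R d (x0 - x0').
  have := continuous_RplusB cc (continuous_RplusB cm' cm).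
  by congr continuous_Rplus; apply/funext => r; rewrite opprB.
have := square_chain_rule_le kBV kc kBV' kc' cM s0 st Hom.
have xk r : 0 <= r -> x r + k r = x0 + m r by exact: (sp_equation S).
have xk' r : 0 <= r -> x' r + k' r = x0' + m' r by exact: (sp_equation S').
have gE r : s <= r <= t -> u r - data r = x' r - x r.
  move=> /andP[sr rt]; have r0 : 0 <= r by exact: le_trans sr.
  have -> : k r = x0 + m r - x r by rewrite -xk// addrC addKr.
  have -> : k' r = x0' + m' r - x' r by rewrite -xk'// addrC addKr.
  by apply/matrixP => i j; rewrite !mxE; ring.
rewrite !(eq_dot_integral _ gE).
have -> : dot_integral s t (fun r => x r - x' r) k' =
    - dot_integral s t (fun r => x' r - x r) k'.
  rewrite -(dot_integralN kBV' kc' (continuous_RplusB cx' cx) s0 st).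
  by apply: eq_dot_integral => r _; rewrite opprB.
move: (path_cost _ _ _) (path_cost _ _ _) (dot_integral _ _ _ _) (dot_integral
  _ _ _ _).
move=> ? ? ? ?; lra.
Qed.

(** Where time and variations are small, the quadratic term of [comparison] is
   absorbed by the left-hand side. *)
Lemma stability s t om : 0 <= s -> s <= t ->
  (forall r, s <= r <= t -> enorm (data r) <= om) ->
  2 * rho * (t - s) + gamma * (evar k t - evar k s + (evar k' t - evar k' s))
    <= 16^-1 ->
  forall r, s <= r <= t -> enorm (u r) ^+ 2 <=
    2 * (enorm (u s) ^+ 2 + 2 * om * (evar k t - evar k s + (evar k' t - evar
      k' s)) + om ^+ 2).
Proof.
move=> s0 st Hom small.
have [cx kc kBV] := And3 (sp_continuous_x S) (sp_continuous_k S) (sp_BV S).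
have [cx' kc' kBV'] := And3 (sp_continuous_x S') (sp_continuous_k S') (sp_BV
  S').
have om0 : 0 <= om by apply: le_trans (enorm_ge0 _) (Hom s _); rewrite lexx.
have [B B0 HB] := continuous_Rplus_bounded t (continuous_RplusB kc kc').
apply: (@sqr_self_bound _ _ (fun r => s <= r <= t) (fun r => enorm (u r)) _ B).
- by move=> r _; exact: enorm_ge0.
- by move=> r /andP[sr rt]; apply: HB => //; exact: le_trans sr.
move=> U HU r /andP[sr rt].
have r0 : 0 <= r by exact: le_trans sr.
have U0 : 0 <= U by apply: le_trans (enorm_ge0 _) (HU s _); rewrite lexx.
have xk a : 0 <= a -> x a + k a = x0 + m a by exact: (sp_equation S).
have xk' a : 0 <= a -> x' a + k' a = x0' + m' a by exact: (sp_equation S').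
have xx a : s <= a <= r -> enorm (x a - x' a) <= om + U.
  move=> /andP[sa ar]; have a0 : 0 <= a by exact: le_trans sa.
  have at' : s <= a <= t by rewrite sa (le_trans ar).
  have -> : x a - x' a = data a - u a.
    have -> : x a = x0 + m a - k a by rewrite -xk// addrK.
    have -> : x' a = x0' + m' a - k' a by rewrite -xk'// addrK.
    by apply/matrixP => i j; rewrite !mxE; ring.
  by rewrite (le_trans (enorm_triangle _ _))// enormN lerD ?Hom ?HU.
have Hom' a : s <= a <= r -> enorm (data a) <= om.
  by move=> /andP[sa ar]; apply: Hom; rewrite sa (le_trans ar).
have := comparison s0 sr Hom' xx.
have W1 := evar_nd kBV r0 rt; have W1' := evar_nd kBV' r0 rt.
set V := evar k r - evar k s + _; set V' := evar k t - evar k s + _ in small *.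
have VV : V <= V' by exact: lerD (lerB W1 (lexx _)) (lerB W1' (lexx _)).
have sm : 2 * rho * (r - s) + gamma * V <= 16^-1.
  apply: le_trans small; rewrite lerD ?ler_wpM2l//; last by rewrite lerD2r.
  by rewrite mulr_ge0.
have := ler_wpM2l (sqr_ge0 (om + U)) sm.
have := ler_wpM2l om0 VV.
have := sqr_ge0 (om - U).
have := sqr_ge0 om; lra.
Qed.

End Stability.

(** * Sequences of solutions *)
Section Sequence.
Variables (x0n : nat -> 'rV[R]_d) (x0 : 'rV[R]_d).
Variables (mn : nat -> R -> 'rV[R]_d) (m : R -> 'rV[R]_d).
Variables (xn kn : nat -> R -> 'rV[R]_d).
Hypothesis mn_cont : forall n, continuous_Rplus (mn n).
Hypothesis m_cont : continuous_Rplus m.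
Hypothesis sol : forall n,
  skorohod_solution rho gamma phi (x0n n) (mn n) (xn n) (kn n).
Hypothesis x0n_cvg : x0n n @[n --> \oo] --> x0.
Hypothesis mn_cvg : forall T : R, 0 <= T ->
    supnorm T (fun r => mn n r - m r) @[n --> \oo] --> 0%E.
Local Notation C := drift_cst.

Lemma input_uniform (T e : R) : 0 < e -> exists N, forall n, (N <= n)%N ->
  forall r, 0 <= r -> r <= T -> enorm (mn n r - m r) <= e.
Proof.
move=> e0; have [T0|T0] := leP 0 T.
  exact: (supnorm_cvgP (fun n r => mn n r - m r) T0).1 (mn_cvg T0) e e0.
by exists 0%N => n _ r r0 rT; have := le_lt_trans (le_trans r0 rT) T0;
  rewrite ltxx.
Qed.

(** The tail of the sequence inherits the modulus of continuity of the limit,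
   and finitely many functions remain. *)
Lemma input_equicontinuous (T e : R) : 0 < e -> exists2 tau, 0 < tau & forall n
  s t,
  0 <= s -> s <= t -> t <= T -> t - s <= tau -> enorm (mn n t - mn n s) <= e.
Proof.
move=> e0; have e30 : 0 < e / 3 by rewrite divr_gt0.
have [N HN] := input_uniform T e30.
have [tau0 tau00 H0] := (continuous_RplusP m).1 m_cont T _ e30.
have [tau1 tau10 H1] : exists2 tau, 0 < tau & forall n s t, (n < N)%N ->
    0 <= s -> s <= t -> t <= T -> t - s <= tau -> enorm (mn n t - mn n s) <= e.
  elim: N {HN} => [|N [tau tau0' IH]]; first by exists 1.
  have [tau' tau'0 H'] := (continuous_RplusP (mn N)).1 (@mn_cont N) T e e0.
  exists (Num.min tau tau'); first by rewrite lt_min tau0'.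
  move=> n s t; rewrite ltnS leq_eqVlt le_min => /predU1P[->|nN] s0 st tT
    /andP[ts ts'].
    exact: H'.
  exact: IH.
exists (Num.min tau0 tau1); first by rewrite lt_min tau00.
move=> n s t s0 st tT; rewrite le_min => /andP[ts0 ts1].
have [nN|Nn] := ltnP n N; first exact: H1.
have t0 := le_trans s0 st; have sT := le_trans st tT.
have -> : mn n t - mn n s = (mn n t - m t) + (m t - m s) - (mn n s - m s).
  by apply/matrixP => i j; rewrite !mxE; ring.
apply: le_trans (enorm_triangle _ _) _; rewrite enormN.
have := enorm_triangle (mn n t - m t) (m t - m s).
have := HN n Nn t t0 tT; have := HN n Nn s s0 sT; have := H0 s t s0 st tT ts0.
lra.
Qed.

(** The last bound does not involve [e]; it is the one that survives in the
   limit. *)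
Lemma solutions_equicontinuous (T e : R) : 0 < e -> exists2 tau, 0 < tau &
  forall n s t,
  0 <= s -> s <= t -> t <= T -> t - s <= tau ->
  [/\ enorm (xn n t - xn n s) <= e, enorm (kn n t - kn n s) <= e,
      evar (kn n) t - evar (kn n) s <= e &
      sigma * (evar (kn n) t - evar (kn n) s) <= enorm (kn n t - kn n s) + C *
        (t - s)].
Proof.
move=> e0; pose r0 := radius_cst.
(* The last bound leaves room for the drift when the increment of [k] is turned
   into its variation, which costs a factor [sigma^-1]. *)
pose e1 := Num.min r0 (Num.min e (sigma * e / 2)).
have r00 : 0 < r0 by exact: radius_cst_gt0.
have C0 : 0 <= C by exact: drift_cst_ge0.
have C1 : 0 < C + 1 by rewrite ltr_wpDl.
have e10 : 0 < e1 by rewrite lt_min r00 lt_min e0 divr_gt0// mulr_gt0.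
have [e1r e1e e1s] : [/\ e1 <= r0, e1 <= e & e1 <= sigma * e / 2].
  by have := lexx e1; rewrite {2}/e1 !le_min => /and3P[].
have [e11 e1d] : e1 <= 1 /\ e1 <= delta.
  by move: e1r; rewrite /r0 /radius_cst !le_min => /and3P[].
pose eta := rate_cst.
have eta0 : 0 < eta by exact: rate_cst_gt0.
have eta8 : eta <= 8^-1 by rewrite ge_min lexx.
have om0 : 0 < eta * e1 ^+ 2 by rewrite mulr_gt0// exprn_gt0.
have om8 : eta * e1 ^+ 2 <= e1 / 8.
  have := ler_wpM2r (sqr_ge0 e1) eta8.
  have : e1 ^+ 2 <= e1 by rewrite expr2 ler_piMr// ltW.
  lra.
have [tau tau0 Htau] := input_equicontinuous T om0.
exists (Num.min tau (Num.min (eta * e1 ^+ 2) (sigma * e / (2 * (C + 1))))).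
  by rewrite !lt_min tau0 om0 divr_gt0// mulr_gt0.
move=> n s t s0 st tT; rewrite !le_min => /and3P[ts1 ts2 ts3].
have mm r : s <= r <= t -> enorm (mn n r - mn n s) <= eta * e1 ^+ 2.
  move=> /andP[sr rt]; apply: Htau => //; first exact: le_trans rt tT.
  by rewrite (le_trans _ ts1)// lerD2r.
have e1rr : 0 < e1 <= r0 by rewrite e10.
have xx := equicontinuity (@mn_cont n) (sol n) e1rr s0 st ts2 mm.
have sst : s <= t <= t by rewrite st lexx.
have xk r : 0 <= r -> xn n r + kn n r = x0n n + mn n r by exact: (sp_equation
  (sol n)).
have t0 := le_trans s0 st.
have kk : enorm (kn n t - kn n s) <= e1.
  have -> : kn n t - kn n s = (mn n t - mn n s) - (xn n t - xn n s).
    have -> : kn n t = x0n n + mn n t - xn n t by rewrite -xk// addrC addKr.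
    have -> : kn n s = x0n n + mn n s - xn n s by rewrite -xk// addrC addKr.
    by apply/matrixP => i j; rewrite !mxE; ring.
  apply: le_trans (enorm_triangle _ _) _; rewrite enormN.
  have := mm t sst; have := xx t sst; lra.
have xd r : s <= r <= t -> enorm (xn n r - xn n s) <= delta by move/xx; lra.
have var := variation_estimate (sol n) s0 st xd.
have h0 : 0 <= t - s by rewrite subr_ge0.
split => //.
- by have := xx t sst; lra.
- exact: le_trans kk _.
have Ch : C * (t - s) <= sigma * e / 2.
  have : (C + 1) * (t - s) <= sigma * e / 2.
    by rewrite mulrC -ler_pdivlMr// (le_trans ts3)// invfM mulrA.
  lra.
by rewrite -(ler_pM2l sigma_gt0); lra.
Qed.

Lemma solution_evar0 n : evar (kn n) 0 = 0.
Proof. exact: evar0 (sp_BV (sol n)). Qed.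

Lemma solutions_evar_bounded (T : R) : exists2 B, 0 <= B &
  forall n t, 0 <= t -> t <= T -> evar (kn n) t <= B.
Proof.
have [T0|T0] := leP 0 T; last first.
  by exists 0 => // n t t0 tT; have := le_lt_trans (le_trans t0 tT) T0;
    rewrite ltxx.
have [tau tau0 H] := solutions_equicontinuous T ltr01.
apply: (@step_ind _ (fun s => exists2 B, 0 <= B & forall n t, 0 <= t -> t <= s
  ->
  evar (kn n) t <= B) 0 T tau) => //.
  exists 0 => // n t t0 t0'; have -> : t = 0 by apply/le_anti/andP.
  by rewrite solution_evar0.
move=> s s' s0 ss' s'T tr [B B0 HB]; exists (B + 1); first by rewrite addr_ge0.
move=> n t t0 ts'; have [ts|/ltW st] := leP t s.
  by rewrite (le_trans (HB n t t0 ts))// lerDl.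
have [|_ _ + _] := H n s t s0 st (le_trans ts' s'T).
  by rewrite (le_trans _ tr)// lerD2r.
by have := HB n s s0 (lexx _); lra.
Qed.

Lemma solutions_Var_bounded (T : R) : 0 <= T ->
  (ereal_sup (range (fun n => Var (kn n) T)) < +oo)%E.
Proof.
move=> T0; have [B B0 HB] := solutions_evar_bounded T.
apply: (@le_lt_trans _ _ B%:E); last exact: ltry.
apply: ge_ereal_sup => _ [n _ <-].
by rewrite (evarE (sp_BV (sol n)))// lee_fin HB.
Qed.

(** The numerical part of one step of [solutions_cauchy]. *)
Lemma small_step_bound (e om Us V : R) : 0 <= om -> om <= 1 ->
  om <= e ^+ 2 / 16 -> 0 <= Us -> 0 <= e -> Us <= e / 4 -> V <= 1 ->
  2 * (Us ^+ 2 + 2 * om * V + om ^+ 2) <= e ^+ 2.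
Proof.
move=> om0 om1 ome Us0 e0 Use V1.
have omV : om * V <= om by rewrite ler_piMr.
have om2 : om ^+ 2 <= om by rewrite expr2 ler_piMr.
have Us2 : Us ^+ 2 <= (e / 4) ^+ 2 by rewrite ler_pXn2r// nnegrE divr_ge0.
lra.
Qed.

(** The Cauchy property propagates along steps of a common length: by
   equicontinuity of the variations, [stability] applies to all pairs of
   solutions on the same intervals. *)
Lemma solutions_cauchy (T : R) : 0 <= T -> forall e : R, 0 < e -> exists N,
  forall n p,
  (N <= n)%N -> (N <= p)%N -> forall r, 0 <= r -> r <= T ->
  enorm (kn n r - kn p r) <= e.
Proof.
move=> T0.
have g1 : 0 < 64 * (gamma + 1) by rewrite mulr_gt0// ltr_wpDl.
have r1 : 0 < 64 * (rho + 1) by rewrite mulr_gt0// ltr_wpDl.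
(* On steps of length [tau'] and with variations at most [e1], time and
   variations add up to at most [1 / 16] in [stability]. *)
pose e1 := (64 * (gamma + 1))^-1.
have e10 : 0 < e1 by rewrite invr_gt0.
have e1g : gamma * e1 <= 64^-1 by rewrite /e1 ler_pdivrMr//; lra.
have e11 : e1 <= 64^-1 by rewrite /e1 lef_pV2 ?posrE//; have := gamma_ge0; lra.
have e12 : e1 + e1 <= 1 by lra.
have small0 (a v w : R) : a <= 64^-1 -> gamma * v <= 64^-1 ->
    gamma * w <= 64^-1 -> 2 * a + gamma * (v + w) <= 16^-1 by lra.
have rho1 : rho * (64 * (rho + 1))^-1 <= 64^-1 by rewrite ler_pdivrMr//; lra.
have [tau tau0 H] := solutions_equicontinuous T e10.
pose tau' := Num.min tau (64 * (rho + 1))^-1.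
have tau'0 : 0 < tau' by rewrite lt_min tau0 invr_gt0.
pose P t := forall e : R, 0 < e -> exists N, forall n p,
  (N <= n)%N -> (N <= p)%N -> forall r, 0 <= r -> r <= t ->
  enorm (kn n r - kn p r) <= e.
apply: (@step_ind _ P 0 T tau') => //.
  move=> e e0; exists 0%N => n p _ _ r r0 r0'.
  have -> : r = 0 by apply/le_anti/andP.
  by rewrite !(sp_k0 (sol _)) subrr enorm0 ltW.
move=> s t s0 st tT; rewrite le_min => /andP[ts1 ts2] IH e e0.
have e40 : 0 < e / 4 by rewrite divr_gt0.
have [N1 HN1] := IH _ e40.
pose om := Num.min 1 (e ^+ 2 / 16).
have om0 : 0 < om by rewrite lt_min ltr01 divr_gt0// exprn_gt0.
have om1 : om <= 1 by rewrite ge_min lexx.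
have ome : om <= e ^+ 2 / 16 by rewrite ge_min lexx orbT.
have om40 : 0 < om / 4 by rewrite divr_gt0.
have [N2 HN2] := cvg_enorm x0n_cvg om40.
have [N3 HN3] := input_uniform T om40.
exists (maxn N1 (maxn N2 N3)) => n p; rewrite !geq_max.
move=> /and3P[n1 n2 n3] /and3P[p1 p2 p3] r r0 rt.
have [rs|/ltW sr] := leP r s.
  by rewrite (le_trans (HN1 n p n1 p1 r r0 rs))// ler_pdivrMr// ler_peMr ?(ltW
    e0)// ler1n.
have data u : s <= u <= t -> enorm (x0n n - x0n p + (mn n u - mn p u)) <= om.
  move=> /andP[su ut]; have u0 := le_trans s0 su; have uT := le_trans ut tT.
  have -> : x0n n - x0n p + (mn n u - mn p u) =
      (x0n n - x0) - (x0n p - x0) + ((mn n u - m u) - (mn p u - m u)).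
    by apply/matrixP => i j; rewrite !mxE; ring.
  apply: le_trans (enorm_triangle _ _) _.
  have := enorm_triangle (x0n n - x0) (- (x0n p - x0)).
  have := enorm_triangle (mn n u - m u) (- (mn p u - m u)).
  rewrite !enormN.
  have := HN2 n n2; have := HN2 p p2; have := HN3 n n3 u u0 uT.
  have := HN3 p p3 u u0 uT; lra.
have [_ _ Wn _] := H n s t s0 st tT ts1.
have [_ _ Wp _] := H p s t s0 st tT ts1.
have Wn0 : 0 <= evar (kn n) t - evar (kn n) s by rewrite subr_ge0 (evar_nd
  (sp_BV (sol n))).
have Wp0 : 0 <= evar (kn p) t - evar (kn p) s by rewrite subr_ge0 (evar_nd
  (sp_BV (sol p))).
have tr : rho * (t - s) <= 64^-1 by exact: le_trans (ler_wpM2l rho_ge0 ts2)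
  rho1.
have small : 2 * rho * (t - s) + gamma * (evar (kn n) t - evar (kn n) s +
    (evar (kn p) t - evar (kn p) s)) <= 16^-1.
  rewrite -mulrA; apply: small0 => //; apply: le_trans e1g; exact: ler_wpM2l.
have srt : s <= r <= t by rewrite sr.
have := stability (sol n) (sol p)
  (@mn_cont n) (@mn_cont p) s0 st data small srt.
have := HN1 n p n1 p1 s s0 (lexx _).
have := enorm_ge0 (kn n s - kn p s); have := enorm_ge0 (kn n r - kn p r).
set U := enorm (kn n r - _); set Us := enorm (kn n s - _); set V := _ + (_ - _).
move=> U0 Us0 Use Ule.
have V1 : V <= 1 by exact: le_trans (lerD Wn Wp) e12.
rewrite -(@ler_pXn2r _ 2)// ?nnegrE// ?(ltW e0)//.
apply: le_trans Ule _; apply: small_step_bound => //; exact: ltW.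
Qed.

Lemma limit_exists : exists x k : R -> 'rV[R]_d,
  [/\ continuous_Rplus x, continuous_Rplus k,
      forall r, x r + k r = x0 + m r,
      forall T e : R, 0 < e -> exists N, forall n, (N <= n)%N ->
        forall r, 0 <= r -> r <= T -> enorm (kn n r - k r) <= e &
      forall T e : R, 0 < e -> exists N, forall n, (N <= n)%N ->
        forall r, 0 <= r -> r <= T -> enorm (xn n r - x r) <= e].
Proof.
have lim_k r : exists l, 0 <= r -> forall e : R, 0 < e -> exists N, forall n,
    (N <= n)%N -> enorm (kn n r - l) <= e.
  have [r0|r0] := leP 0 r; last first.
    by exists 0.
  have [|l Hl] := @enorm_cauchy_cvg _ _ (fun n => kn n r); last by exists l.
  move=> e e0; have [N HN] := solutions_cauchy r0 e0; exists N => n p Nn Np.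
  exact: HN.
have [k Hk] := choice lim_k.
have unif T e : 0 < e -> exists N, forall n, (N <= n)%N ->
    forall r, 0 <= r -> r <= T -> enorm (kn n r - k r) <= e.
  move=> e0; have [T0|T0] := leP 0 T; last first.
    by exists 0%N => n _ r r0 rT; have := le_lt_trans (le_trans r0 rT) T0;
      rewrite ltxx.
  have [N HN] := solutions_cauchy T0 e0; exists N => n Nn r r0 rT.
  apply/ler_addgt0Pr => e' e'0; have [N' HN'] := Hk r r0 e' e'0.
  apply: le_trans (enorm_dist_triangle (kn (maxn N N') r) _ _) _.
  by rewrite lerD ?HN ?HN'// ?leq_maxl ?leq_maxr.
have kc : continuous_Rplus k.
  apply/continuous_RplusP => T e e0; have e30 : 0 < e / 3 by rewrite divr_gt0.
  have [N HN] := unif T _ e30; have [tau tau0 H] := solutions_equicontinuous T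
    e30.
  exists tau => // s t s0 st tT ts; have [_ + _ _] := H N s t s0 st tT ts.
  have := HN N (leqnn _) t (le_trans s0 st) tT.
  have := HN N (leqnn _) s s0 (le_trans st tT).
  have -> : k t - k s = (kn N t - kn N s) + (kn N s - k s) - (kn N t - k t).
    by apply/matrixP => i j; rewrite !mxE; ring.
  have := enorm_triangle (kn N t - kn N s + (kn N s - k s)) (- (kn N t - k t)).
  have := enorm_triangle (kn N t - kn N s) (kn N s - k s).
  rewrite enormN; lra.
have cc := @continuous_Rplus_cst R d.
exists (fun r => m r - (k r - x0)), k; split => //.
- exact: continuous_RplusB m_cont (continuous_RplusB kc (cc x0)).
- by move=> r; apply/matrixP => i j; rewrite !mxE; ring.
move=> T e e0; have e30 : 0 < e / 3 by rewrite divr_gt0.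
have [N1 HN1] := unif T _ e30; have [N2 HN2] := cvg_enorm x0n_cvg e30.
have [N3 HN3] := input_uniform T e30.
exists (maxn N1 (maxn N2 N3)) => n;
  rewrite !geq_max => /and3P[n1 n2 n3] r r0 rT.
have -> : xn n r = x0n n + mn n r - kn n r.
  by rewrite -(sp_equation (sol n))// addrK.
have -> : x0n n + mn n r - kn n r - (m r - (k r - x0)) =
    (x0n n - x0) + (mn n r - m r) - (kn n r - k r).
  by apply/matrixP => i j; rewrite !mxE; ring.
apply: le_trans (enorm_triangle _ _) _; rewrite enormN.
have := enorm_triangle (x0n n - x0) (mn n r - m r).
have := HN1 n n1 r r0 rT; have := HN2 n n2; have := HN3 n n3 r r0 rT; lra.
Qed.


Variables x k : R -> 'rV[R]_d.
Hypotheses (cx : continuous_Rplus x) (kc : continuous_Rplus k).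
Hypothesis kn_unif : forall T e : R, 0 < e -> exists N, forall n, (N <= n)%N ->
        forall r, 0 <= r -> r <= T -> enorm (kn n r - k r) <= e.
Hypothesis xn_unif : forall T e : R, 0 < e -> exists N, forall n, (N <= n)%N ->
        forall r, 0 <= r -> r <= T -> enorm (xn n r - x r) <= e.

Lemma limit_in_Dom s t : 0 <= s -> in_Dom x s t.
Proof.
move=> s0 r sr rt; apply: (Dom_closed) => V.
move=> /nbhs_enormP[e e0 eV].
have e20 : 0 < e / 2 by rewrite divr_gt0.
have r0 := le_trans s0 sr.
have [N HN] := xn_unif r e20; exists (xn N r); split.
  exact: (solution_in_Dom (sol N) r0 (lexx r) (lexx r)).
apply: eV; apply: le_lt_trans (HN N (leqnn _) r r0 (lexx _)) _.
by rewrite ltr_pdivrMr// ltr_pMr// ltr1n.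
Qed.

Lemma limit_k0 : k 0 = 0.
Proof.
apply/eqP; rewrite -subr_eq0 subr0; apply/eqP/enorm_eq0/le_anti.
rewrite enorm_ge0 andbT; apply/ler_addgt0Pr => e e0; rewrite add0r.
have [N HN] := kn_unif 0 e0.
have := HN N (leqnn _) 0 (lexx _) (lexx _).
by rewrite (sp_k0 (sol N)) sub0r enormN.
Qed.

(** Each partition sum of the limit is, up to a small error for each of its
   terms, one of an approximation. *)
Lemma limit_BV : BV_loc k.
Proof.
move=> t t0; have [B B0 HB] := solutions_evar_bounded t.
apply: (@le_lt_trans _ _ (B + 2)%:E); last exact: ltry.
apply: ge_ereal_sup => _ [l tl <-]; rewrite lee_fin.
(* The error [2 * e] occurs once for each of the [size l] terms. *)
pose e : R := (size l).+1%:R^-1.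
have e0 : 0 < e by rewrite invr_gt0.
have [N HN] := kn_unif t e0.
have := @partition_sum_le _ (fun a b => enorm (k b - k a) - 2 * e) (evar (kn
  N)) t 0 t l tl.
rewrite sumrB big_const_nat subn0 iter_addr_0 => H.
have : (2 * e) *+ size l <= 2.
  rewrite -mulr_natr -mulrA ler_piMr// /e mulrC ler_pdivrMr// mul1r ler_nat.
  exact: leqnSn.
have := HB N t t0 (lexx _).
have /H : forall s t0, 0 <= s -> s <= t0 -> t0 <= t ->
    enorm (k t0 - k s) - 2 * e <= evar (kn N) t0 - evar (kn N) s.
  move=> a b a0 ab bt; have b0 := le_trans a0 ab; have at' := le_trans ab bt.
  apply: le_trans (evar_ge (sp_BV (sol N)) a0 ab).
  have := HN N (leqnn _) a a0 at'; have := HN N (leqnn _) b b0 bt.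
  have -> : k b - k a = (kn N b - kn N a) + (kn N a - k a) - (kn N b - k b).
    by apply/matrixP => i j; rewrite !mxE; ring.
  have := enorm_triangle (kn N b - kn N a + (kn N a - k a)) (- (kn N b - k b)).
  have := enorm_triangle (kn N b - kn N a) (kn N a - k a).
  rewrite enormN; lra.
rewrite solution_evar0 subr0 /=; lra.
Qed.

(** * The variational inequality of the limit *)

(** The last summand is the bound of [variation_estimate], in the limit, for
   the variations of the approximations. *)
Definition mass_bound s t := (t - s) + enorm (k t - k s) +
  (enorm (k t - k s) + C * (t - s)) / sigma.

(** What passes to the limit directly: an inequality for constant tests on
   short intervals, with the degraded constant [2 * (rho + gamma)]. The base
   point [r0] is free, for [path_cost_mean] to choose it later. *)
Lemma limit_local T kap : 0 < kap -> kap <= 1 -> exists2 tau, 0 < tau &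
  forall s t r0, 0 <= s -> s < t -> t <= T -> t - s <= tau -> s <= r0 <= t ->
  forall z, D z ->
  dot (k t - k s) (z - x r0) + path_cost x s t <= (t - s) * f z +
    2 * (rho + gamma) * mass_bound s t * enorm (z - x r0) ^+ 2 + kap ^+ 2 *
      mass_bound s t.
Proof.
move=> kap0 kap1; pose Q := 8 * (rho + gamma) + 2 * d%:R + 1.
(* [eps] is the oscillation of the approximations: the errors [8 * (rho +
   gamma) * eps ^+ 2] and [2 * d * eps] must be at most [kap ^+ 2]. *)
have rg0 : 0 <= rho + gamma by rewrite addr_ge0.
have dR : 0 <= d%:R :> R by exact: ler0n.
have Q1 : 1 <= Q by rewrite lerDr addr_ge0// mulr_ge0.
have Q0 : 0 < Q by exact: lt_le_trans Q1.
pose eps := kap ^+ 2 / Q.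
have eps0 : 0 < eps by rewrite divr_gt0// exprn_gt0.
have epsQ : eps * Q = kap ^+ 2 by rewrite /eps divfK// gt_eqF.
have kap2 : kap ^+ 2 <= 1 by rewrite exprn_ile1// ltW.
have eps1 : eps <= 1 by rewrite ler_pdivrMr// mul1r (le_trans kap2).
have [tau tau0 Htau] := solutions_equicontinuous T eps0.
exists tau => // s t r0 s0 st tT ts /andP[sr0 r0t] z Dz.
have C0 : 0 <= C by exact: drift_cst_ge0.
have h0 : 0 <= t - s by rewrite subr_ge0 ltW.
have t0 : 0 <= t by rewrite (le_trans s0)// ltW.
have r00 : 0 <= r0 by exact: le_trans sr0.
set b := enorm (z - x r0); have b0 : 0 <= b by exact: enorm_ge0.
(* The distance [e1] to the limit is made arbitrarily small for fixed [z], [s]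
   and [t], whereas [eps] is fixed in advance by [kap]. *)
apply/ler_addgt0Pr => e e0.
pose Z := (2 * b ^+ 2 + 8 * eps ^+ 2) * gamma * (2 / sigma) +
  2 * d%:R * eps * (2 / sigma) + 2 * b + 1.
have s20 : 0 <= 2 / sigma by rewrite divr_ge0// ltW.
have bb0 : 0 <= 2 * b ^+ 2 + 8 * eps ^+ 2 by rewrite addr_ge0// mulr_ge0
  ?sqr_ge0.
have Z0 : 0 < Z.
  have : 0 <= (2 * b ^+ 2 + 8 * eps ^+ 2) * gamma * (2 / sigma).
    by rewrite mulr_ge0// mulr_ge0.
  have : 0 <= 2 * d%:R * eps * (2 / sigma).
    by rewrite mulr_ge0// mulr_ge0 ?(ltW eps0)// mulr_ge0.
  rewrite /Z; lra.
pose e1 := Num.min eps (e / Z).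
have e10 : 0 < e1 by rewrite lt_min eps0 divr_gt0.
have e1eps : e1 <= eps by rewrite ge_min lexx.
have e1Z : e1 * Z <= e by rewrite -ler_pdivlMr// ge_min lexx orbT.
have [N1 HN1] := kn_unif T e10; have [N2 HN2] := xn_unif T e10.
have Dx := limit_in_Dom (t := t) s0.
have unif e' : 0 < e' -> exists N, forall n, (N <= n)%N ->
    forall r, s <= r <= t -> enorm (xn n r - x r) <= e'.
  move=> e'0; have [N HN] := xn_unif t e'0; exists N => n Nn r /andP[sr rt].
  by apply: HN => //; exact: le_trans sr.
have Dxn n : in_Dom (xn n) s t.
  exact (solution_in_Dom (t := t) (sol n) s0).
have cxn n : continuous_Rplus (xn n) by exact: sp_continuous_x (sol n).
have [n] := path_cost_fatou cxn cx s0 (ltW st) Dxn Dx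
  unif (maxn N1 N2) e10.
rewrite geq_max => /andP[n1 n2] fat.
have [_ _ _ Wn] := Htau n s t s0 (ltW st) tT ts.
have sT : s <= T by exact: le_trans (ltW st) tT.
have ks := HN1 n n1 s s0 sT; have kt := HN1 n n1 t t0 tT.
have dkn : enorm ((kn n t - kn n s) - (k t - k s)) <= 2 * e1.
  have -> : (kn n t - kn n s) - (k t - k s) = (kn n t - k t) - (kn n s - k s).
    by apply/matrixP => i j; rewrite !mxE; ring.
  by have := enorm_triangle (kn n t - k t) (- (kn n s - k s)); rewrite enormN;
    lra.
have knk : enorm (kn n t - kn n s) <= enorm (k t - k s) + 2 * e1.
  rewrite -(subrK (k t - k s) (kn n t - kn n s)).
  by rewrite (le_trans (enorm_triangle _ _))// addrC lerD2l.
have osc r : s <= r <= t -> enorm (xn n r - xn n r0) <= eps.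
  move=> /andP[sr rt]; have r'0 := le_trans s0 sr.
  have [rr|/ltW rr] := leP r r0.
    rewrite enormBC; have [|+ _ _ _] := Htau n r r0 r'0 rr (le_trans r0t tT);
      last by [].
    lra.
  have [|+ _ _ _] := Htau n r0 r r00 rr (le_trans rt tT); last by [].
  lra.
have xx0 : enorm (x r0 - xn n r0) <= e1.
  by rewrite enormBC; apply: HN2 => //; exact: le_trans r0t tT.
have xd r : s <= r <= t -> enorm ((z - xn n r) - (z - x r0)) <= 2 * eps.
  move=> /osc H; have -> : (z - xn n r) - (z - x r0) = (x r0 - xn n r0) - (xn n
    r - xn n r0).
    by apply/matrixP => i j; rewrite !mxE; ring.
  by have := enorm_triangle (x r0 - xn n r0) (- (xn n r - xn n r0));
    rewrite enormN; lra.
have zx r : s <= r <= t -> enorm (z - xn n r) <= b + 2 * eps.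
  move=> /xd H; rewrite -(subrK (z - x r0) (z - xn n r)).
  by rewrite (le_trans (enorm_triangle _ _))// addrC lerD2l.
have cz := @continuous_Rplus_cst R d z.
have Dz' : in_Dom (fun=> z) s t by [].
have test := solution_test
  (sol n) cz s0 (ltW st) Dz' zx.
have knBV := sp_BV (sol n).
have := dot_integral_approx knBV (sp_continuous_k (sol n))
  (continuous_RplusB cz (cxn n)) s0 (ltW st) xd.
rewrite ler_norml => /andP[app _].
have Ipz : path_cost (fun=> z) s t <= f z * (t - s).
  have /andP[] := @path_cost_bounds (fun=> z) s t (f z) (f z)
    cz s0 (ltW st) Dz' (fun _ _ => introT andP (conj (lexx _) (lexx _))).
  by [].
have dotn : dot (k t - k s) (z - x r0) - 2 * b * e1 <= dot (z - x r0) (kn n t -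
  kn n s).
  have := ler_dot (z - x r0) ((kn n t - kn n s) - (k t - k s)).
  rewrite ler_norml dotBr (dotC (k t - k s)) => /andP[+ _].
  by have := ler_wpM2l b0 dkn; rewrite -/b; lra.
set V := evar (kn n) t - evar (kn n) s in Wn test app.
have V0 : 0 <= V by rewrite subr_ge0 (evar_nd knBV)// ltW.
set V1 := (enorm (k t - k s) + C * (t - s)) / sigma.
have VV1 : V <= V1 + 2 / sigma * e1.
  rewrite -(ler_pM2l sigma_gt0).
  have -> : sigma * (V1 + 2 / sigma * e1) =
      enorm (k t - k s) + C * (t - s) + 2 * e1.
    by rewrite /V1; field; rewrite gt_eqF.
  lra.
have K0 := enorm_ge0 (k t - k s).
have V10 : 0 <= V1.
  by rewrite divr_ge0 ?(ltW sigma_gt0)// addr_ge0// mulr_ge0.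
have mE : mass_bound s t = (t - s) + enorm (k t - k s) + V1 by [].
have V1m : V1 <= mass_bound s t by rewrite mE lerDr addr_ge0.
have hm : t - s <= mass_bound s t by rewrite mE -addrA lerDl addr_ge0.
have b2 : (b + 2 * eps) ^+ 2 <= 2 * b ^+ 2 + 8 * eps ^+ 2.
  by have := sqr_ge0 (b - 2 * eps); lra.
set q2 := (b + 2 * eps) ^+ 2 in test b2.
set q3 := 2 * b ^+ 2 + 8 * eps ^+ 2 in b2 bb0.
move: mE hm V1m; move: (mass_bound s t) => Nm mE hm V1m.
have N0 : 0 <= Nm by exact: le_trans h0 hm.
have T1 : q2 * (rho * (t - s) + gamma * V) <=
    q3 * (rho * (t - s) + gamma * V1) + q3 * gamma * (2 / sigma) * e1.
  have a0 : 0 <= rho * (t - s) + gamma * V by rewrite addr_ge0// mulr_ge0.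
  have := ler_wpM2r a0 b2; have := ler_wpM2l bb0 (ler_wpM2l gamma_ge0 VV1); lra.
have T2 : q3 * (rho * (t - s) + gamma * V1) <= q3 * ((rho + gamma) * Nm).
  rewrite ler_wpM2l// mulrDl lerD// ler_wpM2l//.
have T3 : d%:R * (2 * eps * V) <= 2 * d%:R * eps * Nm + 2 * d%:R * eps * (2 /
  sigma) * e1.
  have a0 : 0 <= d%:R * (2 * eps) by rewrite mulr_ge0// mulr_ge0// ltW.
  have := ler_wpM2l a0 VV1; have := ler_wpM2l a0 V1m; lra.
have eps2 : eps ^+ 2 <= eps by rewrite expr2 ler_piMr// ltW.
have T4 : (8 * (rho + gamma)) * eps ^+ 2 * Nm <= 8 * (rho + gamma) * eps * Nm.
  by rewrite ler_wpM2r// ler_wpM2l// mulr_ge0.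
have T5 : kap ^+ 2 * Nm = eps * Nm * Q by rewrite -epsQ mulrAC.
rewrite T5 /Q; have : 0 <= eps * Nm by rewrite mulr_ge0// ltW.
rewrite /Z -/q3 in e1Z.
move: test fat app dotn Ipz.
move: (path_cost _ _ _) (path_cost _ _ _) (path_cost _ _ _) (dot_integral _ _ _
  _) => I1 I2 I3 I4.
move=> test fat app dotn Ipz epsN.
have T6 : q3 * ((rho + gamma) * Nm) = 2 * b ^+ 2 * (rho + gamma) * Nm +
    8 * (rho + gamma) * eps ^+ 2 * Nm by rewrite /q3; ring.
lra.
Qed.


Let Dx s t (s0 : 0 <= s) : in_Dom x s t.
Proof. exact (limit_in_Dom s0). Qed.

Let kBV : BV_loc k.
Proof. exact limit_BV. Qed.


Lemma mass_bound_le s t : s <= t ->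
  mass_bound s t <= (1 + (1 + C) / sigma) * ((t - s) + enorm (k t - k s)).
Proof.
move=> st; rewrite /mass_bound; have C0 : 0 <= C by exact: drift_cst_ge0.
have K0 := enorm_ge0 (k t - k s); have h0 : 0 <= t - s by rewrite subr_ge0.
have : (enorm (k t - k s) + C * (t - s)) / sigma <=
    (1 + C) * ((t - s) + enorm (k t - k s)) / sigma.
  rewrite ler_wpM2r ?invr_ge0 ?(ltW sigma_gt0)//.
  have : 0 <= C * enorm (k t - k s) by exact: mulr_ge0.
  lra.
lra.
Qed.

Lemma sqr_lower (b w e : R) : 0 <= e -> 0 <= b -> 0 <= w -> b <= w + 2 * e ->
  b ^+ 2 - 4 * e * b <= w ^+ 2.
Proof.
move=> e0 b0 w0 bw; have [eb|be] := leP (2 * e) b; last by nra.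
have : (b - 2 * e) ^+ 2 <= w ^+ 2 by rewrite ler_pXn2r// ?nnegrE; lra.
by have := sqr_ge0 e; lra.
Qed.

(** Both sides of the inequality are additive in the interval, so it suffices
   to have it on short intervals up to an error small against time and
   variation. There [x] and [y] are replaced by values at which [phi] is at
   most its mean, and [prox_improve] turns [limit_local] into the sharp
   inequality; what remains are oscillations of [x] and [y], of size [kap]. *)
Lemma limit_ineq_in_Dom y s t : continuous_Rplus y -> 0 <= s -> s <= t ->
  in_Dom y s t ->
  dot_integral s t (fun r => y r - x r) k + path_cost x s t <= path_cost y s t +
    (rho * \int[mu]_(r in `[s, t]) (enorm (y r - x r) ^+ 2) +
     gamma * \int[dVar k]_(r in `[s, t]) (enorm (y r - x r) ^+ 2)).
Proof.
move=> cy s0 st Dy; have cyx := continuous_RplusB cy cx.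
have cq := continuous_enorm_sqr cyx.
pose Phi a b := dot_integral a b (fun r => y r - x r) k + path_cost x a b -
  (path_cost y a b + (rho * \int[mu]_(r in `[a, b]) (enorm (y r - x r) ^+ 2) +
     gamma * \int[dVar k]_(r in `[a, b]) (enorm (y r - x r) ^+ 2))).
suff : Phi s t <= 0 by rewrite /Phi subr_le0.
apply: (@additive_le0 _ Phi (fun r => r + evar k r)) => //.
  move=> a r b sa ar rb bt; have a0 := le_trans s0 sa;
    have ab := le_trans ar rb.
  rewrite /Phi (dot_integralD kBV kc cyx a0 ar rb).
  rewrite (path_costD cx a0 ar rb (Dx a0)).
  rewrite (path_costD cy a0 ar rb (in_DomW sa bt Dy)).
  rewrite (Lebesgue_itvD ar rb (Lebesgue_integrable a0 ab cq)).
  rewrite (dVar_integralD kBV kc cq a0 ar rb).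
  move: (dot_integral a r _ _) (dot_integral r b _ _) => ? ?.
  move: (Rintegral _ _ _) (Rintegral _ _ _) (Rintegral _ _ _) (Rintegral _ _ _)
    => ? ? ? ?.
  move: (path_cost _ _ _) (path_cost _ _ _) (path_cost _ _ _) (path_cost _ _ _)
    => ? ? ? ?; lra.
move=> eta eta0.
have [By By0 HBy] := continuous_Rplus_bounded t cy.
have [Bx Bx0 HBx] := continuous_Rplus_bounded t cx.
pose B := By + Bx; have B0 : 0 <= B by rewrite addr_ge0.
pose c := 2 * (rho + gamma); have c0 : 0 <= c by rewrite mulr_ge0// addr_ge0.
pose I := improve_cst c.
have I0 : 0 <= I by exact: improve_cst_ge0.
have C0 : 0 <= C by exact: drift_cst_ge0.
pose c2 := 1 + (1 + C) / sigma.
have c20 : 0 <= c2.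
  have : 0 <= (1 + C) / sigma by apply: divr_ge0; [exact: addr_ge0|exact: ltW].
  rewrite /c2; lra.
pose Z := 2 * d%:R + 1 + c2 * I * (1 + B) ^+ 2 + 4 * B * (rho + gamma).
have Z0 : 0 < Z.
  have : 0 <= c2 * I * (1 + B) ^+ 2 by rewrite mulr_ge0 ?sqr_ge0// mulr_ge0.
  have : 0 <= 4 * B * (rho + gamma).
    by apply: mulr_ge0; [exact: mulr_ge0|exact: addr_ge0].
  have : 0 <= d%:R :> R by exact: ler0n.
  rewrite /Z; lra.
pose kap := Num.min 1 (eta / Z).
have kap0 : 0 < kap by rewrite lt_min ltr01 divr_gt0.
have kap1 : kap <= 1 by rewrite ge_min lexx.
have kapZ : kap * Z <= eta by rewrite -ler_pdivlMr// ge_min lexx orbT.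
have [t1 t10 H1] := limit_local t kap0 kap1.
have [t2 t20 H2] := (continuous_RplusP x).1 cx t kap kap0.
have [t3 t30 H3] := (continuous_RplusP y).1 cy t kap kap0.
exists (Num.min t1 (Num.min t2 t3)); first by rewrite !lt_min t10 t20.
move=> a b sa ab bt; rewrite !le_min => /and3P[ab1 ab2 ab3].
have a0 := le_trans s0 sa; have ab' := ltW ab.
have kap20 : 0 < kap ^+ 2 by rewrite exprn_gt0.
have Dyab := in_DomW sa bt Dy.
(* Points where [phi] is at most its mean along [x] and along [y]. *)
have [r1 r1ab fx] := path_cost_mean cx a0 ab (Dx a0) kap20.
have [r2 r2ab fy] := path_cost_mean cy a0 ab Dyab kap0.
have oscg z tau u v : (forall s t0, 0 <= s -> s <= t0 -> t0 <= t -> t0 - s <=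
  tau ->
      enorm (z t0 - z s : 'rV[R]_d) <= kap) -> b - a <= tau ->
    a <= u <= b -> a <= v <= b -> enorm (z u - z v) <= kap.
  move=> Hz tab /andP[au ub] /andP[av vb].
  have u0 := le_trans a0 au; have v0 := le_trans a0 av.
  have [uv|/ltW vu] := leP u v; last first.
    apply: Hz => //; first exact: le_trans ub bt.
    by apply: le_trans tab; rewrite lerB.
  rewrite enormBC; apply: Hz => //; first exact: le_trans vb bt.
  by apply: le_trans tab; rewrite lerB.
have /andP[ar1 r1b] := r1ab; have /andP[ar2 r2b] := r2ab.
have Dx1 : Dom phi (x r1) by exact: (Dx (t := b) a0 ar1 r1b).
have Dy2 : Dom phi (y r2) by exact: Dyab.
have h0 : 0 < b - a by rewrite subr_gt0.
have K0 := enorm_ge0 (k b - k a).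
have V0 : 0 <= (enorm (k b - k a) + C * (b - a)) / sigma.
  by rewrite divr_ge0 ?(ltW sigma_gt0)// addr_ge0// mulr_ge0// ltW.
have hm : b - a <= mass_bound a b by rewrite /mass_bound; lra.
have qm : enorm (k b - k a) <= mass_bound a b by rewrite /mass_bound; lra.
have km : kap ^+ 2 * (b - a) <= kap ^+ 2 * mass_bound a b by rewrite ler_pM2l.
have kap01 : 0 <= kap <= 1 by rewrite kap1 ltW.
have fx' : (b - a) * rphi (x r1) <= path_cost x a b + kap ^+ 2 * mass_bound a b
  by lra.
have := prox_improve h0 hm qm c0 kap01 Dx1 fx' (H1 a b r1 a0 ab bt ab1 r1ab)
  Dy2.
set q := k b - k a in K0 V0 qm *; set be := enorm (y r2 - x r1).
have be0 : 0 <= be by exact: enorm_ge0.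
have yx r : a <= r <= b -> enorm ((y r - x r) - (y r2 - x r1)) <= 2 * kap.
  move=> rab; have -> : (y r - x r) - (y r2 - x r1) = (y r - y r2) - (x r - x
    r1).
    by apply/matrixP => i j; rewrite !mxE; ring.
  have := enorm_triangle (y r - y r2) (- (x r - x r1)); rewrite enormN.
  have := oscg y t3 r r2 H3 ab3 rab r2ab;
    have := oscg x t2 r r1 H2 ab2 rab r1ab; lra.
have := dot_integral_approx kBV kc cyx a0 ab' yx.
rewrite ler_norml -/q (dotC (y r2 - x r1)) => /andP[_ app].
have beB : be <= B.
  rewrite (le_trans (enorm_triangle _ _))// enormN lerD ?HBy ?HBx//.
  - exact: le_trans ar2.
  - exact: le_trans r2b bt.
  - exact: le_trans ar1.
  - exact: le_trans r1b bt.
have sq r : a <= r <= b -> be ^+ 2 - 4 * kap * be <= enorm (y r - x r) ^+ 2 <=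
  B ^+ 2.
  move=> /[dup] rab /andP[ar rb]; apply/andP; split.
    have : be <= enorm (y r - x r) + 2 * kap.
      have := yx r rab; rewrite enormBC.
      have := enorm_triangle (y r - x r) ((y r2 - x r1) - (y r - x r)).
      by rewrite addrC subrK -/be; lra.
    by apply: sqr_lower => //; [exact: ltW|exact: enorm_ge0].
  rewrite ler_pXn2r ?nnegrE ?enorm_ge0//.
  rewrite (le_trans (enorm_triangle _ _))// enormN lerD ?HBy ?HBx//.
  - exact: le_trans ar.
  - exact: le_trans rb bt.
  - exact: le_trans ar.
  - exact: le_trans rb bt.
have /andP[lI _] := Lebesgue_itv_bounds ab' (Lebesgue_integrable a0 ab' cq) sq.
have /andP[lJ _] := dVar_integral_bounds kBV kc cq a0 ab' sq.
have qW : enorm q <= evar k b - evar k a by exact: (evar_ge kBV a0 ab').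
have mle := mass_bound_le ab'; rewrite -/q -/c2 in mle.
move: lI lJ app; rewrite /Phi.
have -> : b + evar k b - (a + evar k a) = (b - a) + (evar k b - evar k a) by
  ring.
move: (Rintegral _ _ _) (Rintegral _ _ _) => J2 I2.
move: (dot_integral _ _ _ _) => DI lI lJ app prox.
move: fy fx' prox; move: (path_cost _ _ _) (path_cost _ _ _) => Ix Iy fy fx'
  prox.
move: qW lJ app; move: (evar k b - evar k a) => V qW lJ app.
move: lI; move: (mass_bound a b) mle hm qm km prox {fx' fx H1} => M mle hm qm
  km prox lI.
move: (b - a) h0 ab1 ab2 ab3 V0 hm km mle fy prox lI => h h0 _ _ _ V0 hm km mle
  fy prox lI.
move: (enorm q) K0 V0 qm qW mle prox => K K0 V0 qm qW mle prox.
have V00 : 0 <= V by exact: le_trans qW.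
have r1' : rho * ((be ^+ 2 - 4 * kap * be) * h) <= rho * I2 by rewrite
  ler_wpM2l.
have r2' : gamma * ((be ^+ 2 - 4 * kap * be) * V) <= gamma * J2 by rewrite
  ler_wpM2l.
have r3 : gamma * K * be ^+ 2 <= gamma * V * be ^+ 2.
  by rewrite ler_wpM2r ?sqr_ge0// ler_wpM2l.
have kI : 0 <= kap * I by rewrite mulr_ge0// ltW.
have r4 : kap * M * I * (1 + be) ^+ 2 <= kap * I * c2 * (h + V) * (1 + B) ^+ 2.
  have m1 : M <= c2 * (h + V).
    by apply: le_trans mle _; rewrite ler_wpM2l// lerD2l.
  have b1 : (1 + be) ^+ 2 <= (1 + B) ^+ 2.
    by rewrite ler_pXn2r ?nnegrE ?addr_ge0// lerD2l.
  have M0 : 0 <= M by exact: (le_trans (ltW h0) hm).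
  have := ler_pM (mulr_ge0 kI M0) (sqr_ge0 (1 + be)) (ler_wpM2l kI m1) b1; lra.
have r5 : kap * be * (rho * h + gamma * V) <= kap * B * ((rho + gamma) * (h +
  V)).
  have a1 : rho * h + gamma * V <= (rho + gamma) * (h + V).
    have := mulr_ge0 rho_ge0 V00; have := mulr_ge0 gamma_ge0 (ltW h0); lra.
  have a2 : 0 <= rho * h + gamma * V by rewrite addr_ge0// mulr_ge0// ltW.
  by apply: ler_pM a1 => //; [rewrite mulr_ge0// ltW|rewrite ler_pM2l].
have hV0 : 0 <= h + V by rewrite addr_ge0// ltW.
have r6 := ler_wpM2r hV0 kapZ.
have dV : 0 <= d%:R * kap * h by rewrite mulr_ge0 ?(ltW h0)// mulr_ge0// ltW.
have kV : 0 <= kap * V by rewrite mulr_ge0// ltW.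
rewrite -/I in prox; rewrite /Z in r6; lra.
Qed.

Lemma limit_ineq y s t : continuous_Rplus y -> 0 <= s -> s <= t ->
  skorohod_ineq rho gamma phi x k y s t.
Proof.
move=> cy s0 st; have cyx := continuous_RplusB cy cx.
have [Dy|NDy] := pselect (in_Dom y s t).
  apply/(skorohod_real cx cy kBV kc s0 st (Dx s0) Dy).
  exact: limit_ineq_in_Dom.
have q0 (nu : {measure set (measurableTypeR R) -> \bar R}) :
    (0 <= \int[nu]_(r in `[s, t]) (enorm (y r - x r) ^+ 2)%:E)%E.
  by apply: integral_ge0 => r _; rewrite lee_fin sqr_ge0.
have rest0 : (0 <= rho%:E * \int[mu]_(r in `[s, t]) (enorm (y r - x r) ^+ 2)%:E
  +
    gamma%:E * \int[dVar k]_(r in `[s, t]) (enorm (y r - x r) ^+ 2)%:E)%E.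
  by rewrite adde_ge0// mule_ge0// q0.
rewrite /skorohod_ineq; move: st; rewrite le_eqVlt => /predU1P[stE|st].
  subst t.
  have [B B0 HB] := continuous_Rplus_bounded s cyx.
  have := @dot_integral_approx _ _ _ kBV kc _ s s 0 B cyx s0 (lexx _).
  rewrite !subrr dot0l subr0 !mulr0 normr_le0 => /(_ _)/eqP ->; last first.
    by move=> r /andP[sr rs]; rewrite subr0 HB// (le_trans s0).
  rewrite add0e set_itv1 !integral_set1 add0e.
  by move: rest0; rewrite set_itv1 !integral_set1.
rewrite (integral_phi_infty cy s0 st NDy).
by rewrite addye ?leey// -ltNye (lt_le_trans _ rest0).
Qed.


End Sequence.

End Skorohod.

Theorem corollary24 (R : realType) (d : nat) (rho gamma L delta sigma : R)
  (phi : 'rV[R]_d -> \bar R)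
  (x0n : nat -> 'rV[R]_d) (x0 : 'rV[R]_d)
  (mn : nat -> R -> 'rV[R]_d) (m : R -> 'rV[R]_d)
  (xn kn : nat -> R -> 'rV[R]_d)
  (rho_ge0 : 0 <= rho) (gamma_ge0 : 0 <= gamma) (L_ge0 : 0 <= L)
  (delta_gt0 : 0 < delta) (sigma_gt0 : 0 < sigma)
  (phi_gtNy : forall v, (-oo < phi v)%E)
  (phi_proper : proper_fun phi)
  (phi_lsc : lower_semicontinuous phi)
  (phi_semiconvex : semiconvex_fun rho gamma phi)
  (phi_growth : forall x y, Dom phi x -> Dom phi y ->
    (`|phi x - phi y| <= (L + L * enorm (x - y))%:E)%E)
  (Dom_ball : shifted_uniform_interior_ball gamma delta sigma (Dom phi))
  (x0n_dom : forall n, closure (Dom phi) (x0n n))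
  (x0_dom : closure (Dom phi) x0)
  (mn_cont : forall n, continuous_Rplus (mn n))
  (m_cont : continuous_Rplus m)
  (mn0 : forall n, mn n 0 = 0)
  (m0 : m 0 = 0)
  (xn_kn_SP : forall n,
    skorohod_solution rho gamma phi (x0n n) (mn n) (xn n) (kn n))
  (x0n_cvg : x0n n @[n --> \oo] --> x0)
  (mn_cvg : forall T : R, 0 <= T ->
    supnorm T (fun r => mn n r - m r) @[n --> \oo] --> 0%E) :
  (forall T : R, 0 <= T ->
    (ereal_sup (range (fun n => Var (kn n) T)) < +oo)%E) /\
  (exists x k : R -> 'rV[R]_d,
    [/\ continuous_Rplus x, continuous_Rplus k &
      forall T : R, 0 <= T ->
        ((supnorm T (fun r => xn n r - x r)%R +
          supnorm T (fun r => kn n r - k r)%R)%E @[n --> \oo] --> 0%E) /\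
        skorohod_solution rho gamma phi x0 m x k]).
Proof.
have [_ _ semiconvex] := phi_semiconvex.
split.
  exact: (solutions_Var_bounded rho_ge0 gamma_ge0 L_ge0 delta_gt0 sigma_gt0
    phi_gtNy phi_lsc phi_growth Dom_ball mn_cont m_cont xn_kn_SP mn_cvg).
have [x [k [cx kc xk kn_unif xn_unif]]] := limit_exists rho_ge0 gamma_ge0 L_ge0
  delta_gt0 sigma_gt0 phi_gtNy phi_lsc phi_growth Dom_ball mn_cont m_cont
  xn_kn_SP x0n_cvg mn_cvg.
exists x, k; split=> // T T0.
have Dx s t (s0 : 0 <= s) : in_Dom phi x s t.
  exact: (limit_in_Dom L_ge0 phi_gtNy phi_lsc phi_growth xn_kn_SP xn_unif s0).
split.
  rewrite -[X in _ --> X]adde0; apply: cvgeD => //.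
    apply/(supnorm_cvgP (fun n r => xn n r - x r) T0) => e e0; exact: xn_unif.
  apply/(supnorm_cvgP (fun n r => kn n r - k r) T0) => e e0; exact: kn_unif.
split => //.
- by move=> t t0; apply: subset_closure; exact: (Dx 0 t).
- move=> t t0; have iz := rphi_integrable L_ge0 phi_gtNy phi_lsc phi_growth cx
  (lexx 0) t0 (Dx 0 t (lexx 0)).
  apply: eq_integrable iz => // r; rewrite inE/= in_itv/= => /andP[r0 rt].
  by rewrite phiE//; exact: (Dx 0 t).
- exact: (limit_BV rho_ge0 gamma_ge0 L_ge0 delta_gt0 sigma_gt0
    phi_gtNy phi_lsc phi_growth Dom_ball mn_cont m_cont xn_kn_SP mn_cvg
      kn_unif).
- exact: (limit_k0 xn_kn_SP kn_unif).
move=> s t s0 st y cy.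
exact: (limit_ineq rho_ge0 gamma_ge0 L_ge0 delta_gt0 sigma_gt0
  phi_gtNy phi_lsc phi_growth semiconvex Dom_ball mn_cont m_cont xn_kn_SP mn_cvg
  cx kc kn_unif xn_unif cy s0 st).
Qed.
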